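(* Let $d\in\{1,2,3\}$, $k\in\{2,4,6\}$, and let $A_\kappa$ be the conjugate operator on $\ell^2(\mathbb{Z}^d)$ with $\kappa_j=k$ for all $1\le j\le d$. The following inclusions hold. Open sets contained in $\boldsymbol{\mu}_{A_\kappa}(D)\cap[0,1]$: - $k=2$: $(0,1)$ for $d=1,2,3$. - $k=4$: $(0,1)\setminus\{\frac1{\sqrt2}\}$ for $d=1$; $\left(0,\frac12\right)\cup\left(\frac1{\sqrt2},1\right)$ for $d=2$; $\left(0,\frac{\sqrt{3-\sqrt3}}4\right)\cup\left(\frac1{\sqrt2},1\right)$ for $d=3$. - $k=6$: $(0,1)\setminus\{\frac12,\frac{\sqrt3}2\}$ for $d=1$; $(0,0.21)\cup(0.53,0.71)\cup\left(\frac{\sqrt3}2,1\right)$ for $d=2$; $(0,0.08)\cup(0.57,0.58)\cup\left(\frac{\sqrt3}2,1\right)$ for $d=3$. Closed sets contained in $[0,1]\setminus\boldsymbol{\mu}_{A_\kappa}(D)$: - $k=2$: $\{0,1\}$ for $d=1,2,3$. - $k=4$: $\{0,\frac1{\sqrt2},1\}$ for $d=1$; $\left[\frac12,\frac1{\sqrt2}\right]\cup\{0,1\}$ for $d=2$; $\left[\frac1{2\sqrt2},\frac1{\sqrt2}\right]\cup\{0,1\}$ for $d=3$. - $k=6$: $\{0,\frac12,\frac{\sqrt3}2,1\}$ for $d=1$; $\left[\frac14,\frac12\right]\cup\left[\frac34,\frac{\sqrt3}2\right]\cup\{0,1\}$ for $d=2$; $\left[\frac18,\frac12\right]\cup\left[\frac{3\sqrt3}8,\frac{\sqrt3}2\right]\cup\{0,1\}$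 for $d=3$.
   Context: On $\ell^2(\mathbb{Z}^d)$, $S_j$ is the shift $(S_ju)(n)=u(n_1,\ldots,n_j-1,\ldots,n_d)$, $\Delta_j=\frac12(S_j+S_j^{-1})$, $D=\prod_{j=1}^d\Delta_j$ (Molchanov-Vainberg Laplacian, $\sigma(D)=[-1,1]$), $(N_ju)(n)=n_ju(n)$. For $\kappa=(\kappa_j)$ with positive integer entries, $A_\kappa$ is the self-adjoint closure, from finitely supported sequences, of $\sum_{j=1}^d\frac{1}{4\mathrm{i}}[(S_j^{\kappa_j}-S_j^{-\kappa_j})N_j+N_j(S_j^{\kappa_j}-S_j^{-\kappa_j})]$. $[D,\mathrm{i}A_\kappa]_\circ$ is the bounded extension of the commutator form. $\boldsymbol{\mu}^\pm_{A_\kappa}(D)$ is the set of $E\in\sigma(D)$ for which there are an open interval $I\ni E$ and $\gamma>0$ with $\pm E_I(D)[D,\mathrm{i}A_\kappa]_\circ E_I(D)\ge\gamma E_I(D)$, where $E_I(D)$ is the spectral projection, and $\boldsymbol{\mu}_{A_\kappa}(D)=\boldsymbol{\mu}^+_{A_\kappa}(D)\cup\boldsymbol{\mu}^-_{A_\kappa}(D)$. *)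

(* Defs.v *)
From HB Require Import structures.
From mathcomp Require Import all_boot all_order all_algebra.
From mathcomp Require Import all_classical all_reals all_analysis.
From mathcomp Require Import complex.

Set Implicit Arguments.
Unset Strict Implicit.
Unset Printing Implicit Defensive.

Import Order.TTheory GRing.Theory Num.Theory.
Import numFieldNormedType.Exports.

Local Open Scope classical_set_scope.
Local Open Scope ring_scope.

(** * The Hilbert space l^2(I)

    An operator on l^2(I) is represented by a map on all complex families
    indexed by I; only its values on [l2] are meaningful, and every condition
    imposed on operators below is relativized to [l2]. *)

Section Hilbert.
Context {R : realType} {I : choiceType}.

Definition fam : Type := I -> R[i].
Definition op : Type := fam -> fam.

Implicit Types (u v f g : fam) (T : op).

Definition addf u v : fam := fun n => u n + v n.
Definition scalef (a : R[i]) u : fam := fun n => a * u n.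
Definition subf u v : fam := fun n => u n - v n.

Definition l2 : set fam :=
  [set u | summable [set: I] (fun n => (complex.Re (`|u n| ^+ 2))%:E)].

(* Unconditional sum of an absolutely summable real family: the sum of the
   positive parts minus the sum of the negative parts. *)
Definition rsum (a : I -> R) : R :=
  fine (\esum_(n in [set: I]) (Num.max (a n) 0)%:E) -
  fine (\esum_(n in [set: I]) (Num.max (- a n) 0)%:E).

Definition csum (a : I -> R[i]) : R[i] :=
  Complex (rsum (fun n => complex.Re (a n))) (rsum (fun n => complex.Im (a n))).

(* Antilinear in the first argument. *)
Definition inner u v : R[i] := csum (fun n => (u n)^*%C * v n).

Definition norm2 u : R := Num.sqrt (complex.Re (inner u u)).

Definition bounded_op T : Prop :=
  [/\ forall u, l2 u -> l2 (T u),
      forall a u v, l2 u -> l2 v ->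
        T (addf (scalef a u) v) = addf (scalef a (T u)) (T v)
    & exists M : R, forall u, l2 u -> norm2 (T u) <= M * norm2 u].

Definition orthogonal_projection T : Prop :=
  [/\ bounded_op T,
      forall u, l2 u -> T (T u) = T u
    & forall u v, l2 u -> l2 v -> inner (T u) v = inner u (T v)].

Definition spectrum T : set R[i] :=
  [set z | ~ exists S : op, bounded_op S /\
     forall u, l2 u -> S (subf (T u) (scalef z u)) = u /\
                       subf (T (S u)) (scalef z (S u)) = u].

(* [spectral_measure T P]: P is the projection-valued Borel measure of the
   bounded self-adjoint operator T, i.e. T = \int x dP(x).  The integral is
   written in the weak sense, <u, T u> = \int x d<u, P(x) u>, which determines
   T by polarization; countable additivity of P is the requirement that
   B |-> <u, P(B) u> be a measure.  P is indexed by all sets of reals, but is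
   only constrained on Borel sets.  By the spectral theorem such a P exists and
   is unique (on Borel sets and on l2). *)
Definition spectral_measure T (P : set (measurableTypeR R) -> op) : Prop :=
  [/\ forall B, measurable B -> orthogonal_projection (P B),
      forall u, l2 u -> P [set: measurableTypeR R] u = u,
      forall B1 B2 u, measurable B1 -> measurable B2 -> l2 u ->
        P (B1 `&` B2) u = P B1 (P B2 u)
    & forall u, l2 u ->
        exists mu : {finite_measure set (measurableTypeR R) -> \bar R},
          [/\ forall B, measurable B ->
                mu B = (complex.Re (inner u (P B u)))%:E,
              mu.-integrable [set: measurableTypeR R] (fun x => (x : R)%:E)
            & inner u (T u) =
                Complex (\int[mu]_(x in [set: measurableTypeR R]) (x : R)) 0]].

(** Unbounded operators are given by their graphs, [A u f] meaning that u is
    in the domain and that A u = f. *)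

Definition cvg_l2 (u_ : nat -> fam) u : Prop :=
  (fun m => norm2 (subf (u_ m) u)) @ \oo --> (0 : R).

Definition closure_of (A0 : op) (dom : set fam) : fam -> fam -> Prop :=
  fun u f => [/\ l2 u, l2 f &
    exists u_ : nat -> fam,
      [/\ forall m, dom (u_ m), cvg_l2 u_ u & cvg_l2 (fun m => A0 (u_ m)) f]].

(* B is a bounded extension of the form [T, iA] defined on the domain of A by
   <u, [T, iA] v> = <T u, i A v> + <i A u, T v>. *)
Definition extends_commutator T (A : fam -> fam -> Prop) (B : op) : Prop :=
  bounded_op B /\
  forall u f v g, A u f -> A v g ->
    inner u (B v) = inner (T u) (scalef 'i%C g) + inner (scalef 'i%C f) (T v).

(* The operator [T, iA]_o. *)
Definition commutator T (A : fam -> fam -> Prop) : op :=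
  xget (fun u => u) [set B : op | extends_commutator T A B].

Definition op_le T1 T2 : Prop :=
  forall u, l2 u -> inner u (T1 u) <= inner u (T2 u).

(* The sets mu^+_A(T) and mu^-_A(T), where P is the spectral measure of T. *)
Definition mu_plus (P : set (measurableTypeR R) -> op) T
    (A : fam -> fam -> Prop) : set R :=
  [set E | spectrum T (E%:C)%C /\
    exists a b c : R, [/\ a < E, E < b, 0 < c &
      op_le (fun u => scalef (c%:C)%C (P (`]a, b[%classic) u))
            (fun u => P (`]a, b[%classic) (commutator T A (P (`]a, b[%classic) u)))]].

Definition mu_minus (P : set (measurableTypeR R) -> op) T
    (A : fam -> fam -> Prop) : set R :=
  [set E | spectrum T (E%:C)%C /\
    exists a b c : R, [/\ a < E, E < b, 0 < c &
      op_le (fun u => scalef (c%:C)%C (P (`]a, b[%classic) u))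
            (fun u => scalef (-1) (P (`]a, b[%classic) (commutator T A (P (`]a, b[%classic) u))))]].

Definition mu_set (P : set (measurableTypeR R) -> op) T
    (A : fam -> fam -> Prop) : set R :=
  mu_plus P T A `|` mu_minus P T A.

End Hilbert.
Arguments fam : clear implicits.
Arguments op : clear implicits.

(** * The Molchanov-Vainberg Laplacian and its conjugate operators on Z^d *)

Section Lattice.
Context {R : realType} {d : nat}.

Local Notation Zd := 'rV[int]_d.
Implicit Types (u : fam R Zd) (j : 'I_d).

Definition shift_op j : op R Zd := fun u n => u (n - delta_mx 0 j).
Definition shift_inv j : op R Zd := fun u n => u (n + delta_mx 0 j).

Definition Delta j : op R Zd :=
  fun u => scalef (2^-1) (addf (shift_op j u) (shift_inv j u)).

Definition MV_laplacian : op R Zd :=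
  \big[(fun f g => f \o g)/id]_(j < d) Delta j.

Definition position j : op R Zd := fun u n => (n 0 j)%:~R * u n.

(* S_j^k - S_j^{-k} *)
Definition shift_diff j (k : nat) : op R Zd :=
  fun u => subf (iter k (shift_op j) u) (iter k (shift_inv j) u).

Definition finitely_supported : set (fam R Zd) :=
  [set u | finite_set [set n | u n != 0]].

Definition conjugate_core (kappa : 'I_d -> nat) : op R Zd := fun u n =>
  \sum_(j < d) (4 * 'i%C)^-1 *
    (shift_diff j (kappa j) (position j u) n +
     position j (shift_diff j (kappa j) u) n).

Definition conjugate_operator (kappa : 'I_d -> nat) :
    fam R Zd -> fam R Zd -> Prop :=
  closure_of (conjugate_core kappa) finitely_supported.

End Lattice.

(** * The energy sets, for d in {1,2,3} and k in {2,4,6}; the last case of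
    each [match] is never used. *)

Section Regions.
Context {R : realType}.

Definition open_region (d k : nat) : set R :=
  match k, d with
  | 2, _ => `]0, 1[
  | 4, 1 => `]0, 1[ `\` [set 1 / Num.sqrt 2]
  | 4, 2 => `]0, 1 / 2[ `|` `]1 / Num.sqrt 2, 1[
  | 4, 3 => `]0, Num.sqrt (3 - Num.sqrt 3) / 4[ `|` `]1 / Num.sqrt 2, 1[
  | 6, 1 => `]0, 1[ `\` [set 1 / 2; Num.sqrt 3 / 2]
  | 6, 2 => `]0, 21 / 100[ `|` `]53 / 100, 71 / 100[ `|` `]Num.sqrt 3 / 2, 1[
  | 6, 3 => `]0, 8 / 100[ `|` `]57 / 100, 58 / 100[ `|` `]Num.sqrt 3 / 2, 1[
  | _, _ => set0
  end.

Definition closed_region (d k : nat) : set R :=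
  match k, d with
  | 2, _ => [set 0; 1]
  | 4, 1 => [set 0; 1 / Num.sqrt 2; 1]
  | 4, 2 => `[1 / 2, 1 / Num.sqrt 2] `|` [set 0; 1]
  | 4, 3 => `[1 / (2 * Num.sqrt 2), 1 / Num.sqrt 2] `|` [set 0; 1]
  | 6, 1 => [set 0; 1 / 2; Num.sqrt 3 / 2; 1]
  | 6, 2 => `[1 / 4, 1 / 2] `|` `[3 / 4, Num.sqrt 3 / 2] `|` [set 0; 1]
  | 6, 3 => `[1 / 8, 1 / 2] `|` `[3 * Num.sqrt 3 / 8, Num.sqrt 3 / 2]
              `|` [set 0; 1]
  | _, _ => set0
  end.

End Regions.

(* Main.v *)
Require Import Defs.
From mathcomp Require Import all_boot all_order all_algebra.
From mathcomp Require Import all_classical all_reals all_analysis.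
From mathcomp Require cyclic separable cyclotomic.
From mathcomp Require Import complex zify ring lra.

Import Order.TTheory GRing.Theory Num.Theory.
Import numFieldNormedType.Exports.
Import Defs.

Set Implicit Arguments.
Unset Strict Implicit.
Unset Printing Implicit Defensive.

Local Open Scope classical_set_scope.
Local Open Scope ring_scope.

(** Fourier series turn [D] into multiplication by [energy x], the product of
    the numbers [x j = cos t_j], and the identity
    [sin (k t) sin t = cos t * gfun k (cos t ^ 2)], valid for the three even
    [k], turns the commutator into multiplication by
    [virial k x = energy x * \sum_j gfun k (x j ^ 2)].  Hence an [E] in [[0, 1]] lies
    in the set [mu] exactly when [virial k] keeps a strict sign on the compact set of
    all [x] in the cube [[-1, 1]^d] with [energy x = E], and the theorem
    becomes a list of polynomial inequalities in the variables [x j ^ 2], whose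
    product is [E ^ 2].

    Neither Fourier integrals nor a joint functional calculus is used.
    The operators in play are finite combinations of translations, and such an
    operator has a nonnegative quadratic form if and only if its symbol is
    nonnegative on the torus.  One direction ([toeplitz_pos]) embeds a finitely
    supported family in a large finite torus and applies the discrete Fourier
    transform; the other ([toeplitz_symbol]) tests the form on plane waves cut
    off to large cubes.

    A Mourre estimate at [E] is in turn equivalent to a single inequality of
    quadratic forms, [c <= [D, iA] + M (D - E)^2] for some [M] and some
    [c > 0] ([localize_form_bound], [form_bound_of_localized]).  Of the
    spectral measure this uses only that its projections commute with [D] and
    that [D] lies between [a] and [b] on the range of the projection of an
    interval from [a] to [b].  Passing to symbols, the inequality reads
    [c <= virial k x + M (energy x - E)^2] on the cube, and by compactness such
    [M] and [c] exist as soon as [virial k] is positive where [energy x = E]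
    ([virial_penalty]).  This is [signed_estimateP].

    For the open regions the sign of the sum of the [gfun k (x j ^ 2)] is
    determined in [open_region_sign].  For the closed regions two points
    suffice, the corner [(E, 1, .., 1)] and the point of the diagonal with the
    same energy: the virial takes values of opposite signs there, or vanishes
    ([indefinite_mixed], [indefinite_corner]).
*)

(** * Absolutely summable real families *)

Section Sums.
Context {R : realType} {I : choiceType}.
Implicit Types (a b c : I -> R).

Definition asum a := summable [set: I] (fun n => (a n)%:E).

Definition nsum a : R := fine (\esum_(n in [set: I]) (a n)%:E).

Lemma asum_le a b : (forall n, `|a n| <= b n) -> asum b -> asum a.
Proof.
move=> ab; apply: le_lt_trans; apply: le_esum => n _ /=.
by rewrite lee_fin (le_trans (ab n)) ?ler_norm.
Qed.

Lemma asumD a b : asum a -> asum b -> asum (fun n => a n + b n).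
Proof. exact: summableD. Qed.

Lemma asumN a : asum a -> asum (fun n => - a n).
Proof. by rewrite /asum (summableN _ (fun n => (a n)%:E)). Qed.

Lemma asum_abs a : asum a -> asum (fun n => `|a n|).
Proof.
by apply: le_lt_trans; apply: le_esum => n _ /=; rewrite lee_fin normr_id.
Qed.

Lemma asumZ (r : R) a : asum a -> asum (fun n => r * a n).
Proof.
move=> sa; suff: (\esum_(n in [set: I]) `|(r * a n)%:E| <=
   `|r|%:E * \esum_(n in [set: I]) `|(a n)%:E|)%E.
  by move=> /le_lt_trans; apply; rewrite lte_mul_pinfty.
apply: ge_ereal_sup => _ [X [finX XI] <-].
rewrite (eq_fsbigr (fun n => (`|r|%:E * `|(a n)%:E|)%E)); last first.
  by move=> n _; rewrite /= normrM EFinM.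
rewrite -ge0_mule_fsumr//; apply: lee_pmul => //.
  by rewrite fsume_ge0.
by apply: ereal_sup_ubound; exists X.
Qed.

Lemma nsum_esum a : (forall n, 0 <= a n) -> asum a ->
  (nsum a)%:E = \esum_(n in [set: I]) (a n)%:E.
Proof.
move=> a0 sa; rewrite /nsum fineK//.
move: sa; rewrite /asum summableE; congr (_ \is a fin_num).
by apply: eq_esum => n _; rewrite /= ger0_norm.
Qed.

Lemma nsum_ge0 a : (forall n, 0 <= a n) -> 0 <= nsum a.
Proof. by move=> a0; apply: fine_ge0; apply: esum_ge0 => n _; rewrite lee_fin. Qed.

Lemma nsumD a b : (forall n, 0 <= a n) -> (forall n, 0 <= b n) ->
  asum a -> asum b -> nsum (fun n => a n + b n) = nsum a + nsum b.
Proof.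
move=> a0 b0 sa sb; apply: EFin_inj; rewrite EFinD !nsum_esum//.
- by rewrite -esumD// => n _; rewrite lee_fin.
- by move=> n; rewrite addr_ge0.
- exact: asumD.
Qed.

Lemma nsum_fin_le a (F : set I) : (forall n, 0 <= a n) -> asum a ->
  finite_set F -> \sum_(n \in F) a n <= nsum a.
Proof.
move=> a0 sa fF; rewrite -lee_fin nsum_esum// -fsumEFin//.
by apply: ereal_sup_ubound; exists F.
Qed.

Lemma nsum_approx a (e : R) : (forall n, 0 <= a n) -> asum a -> 0 < e ->
  exists2 F : set I, finite_set F & nsum a - e < \sum_(n \in F) a n.
Proof.
move=> a0 sa e0; have sE := nsum_esum a0 sa.
have : ((nsum a - e)%:E < \esum_(n in [set: I]) (a n)%:E)%E.
  by rewrite -sE lte_fin ltrBlDr ltrDl.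
by move=> /ereal_sup_gt[_ [F [fF _] <-]]; rewrite fsumEFin// => h; exists F.
Qed.

Lemma nsum_eq0 a : (forall n, 0 <= a n) -> asum a -> nsum a = 0 -> forall n, a n = 0.
Proof.
move=> a0 sa s0 n; apply/eqP; rewrite eq_le a0 andbT -s0.
by have := nsum_fin_le a0 sa (finite_set1 n); rewrite fsbig_set1.
Qed.

(** The unconditional sum is defined through positive and negative parts, but
    every splitting into summable nonnegative families computes it; additivity
    rests on this freedom. *)
Lemma rsum_sub a b : (forall n, 0 <= a n) -> (forall n, 0 <= b n) ->
  asum a -> asum b -> rsum (fun n => a n - b n) = nsum a - nsum b.
Proof.
move=> a0 b0 sa sb.
have sp : asum (fun n => Num.max (a n - b n) 0).
  apply: asum_le (asumD sa sb) => n.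
  by rewrite ger0_norm ?le_max ?lexx ?orbT// ge_max lerD2l addr_ge0// ge0_cp.
have sn : asum (fun n => Num.max (- (a n - b n)) 0).
  apply: asum_le (asumD sa sb) => n.
  rewrite ger0_norm ?le_max ?lexx ?orbT// ge_max opprB addrC lerD2r addr_ge0//.
  by rewrite ge0_cp.
apply: EFin_inj.
have := esumB (D := setT) (f := fun n => (a n)%:E) (g := fun n => (b n)%:E) sa sb.
rewrite -!nsum_esum// -EFinB => <-; try by move=> n _; rewrite lee_fin.
rewrite /rsum EFinB; congr (_ - _)%E.
  rewrite nsum_esum//; last by move=> n; rewrite le_max lexx orbT.
  by apply: eq_esum => n _; rewrite funeposE /= -EFinB EFin_max.
rewrite nsum_esum//; last by move=> n; rewrite le_max lexx orbT.
by apply: eq_esum => n _; rewrite funenegE EFin_max.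
Qed.

Lemma rsum_nsum a : (forall n, 0 <= a n) -> asum a -> rsum a = nsum a.
Proof.
move=> a0 sa; have s0 : asum (fun=> 0).
  by apply: asum_le sa => n; rewrite normr0.
have -> : nsum a = nsum a - nsum (fun=> 0).
  by rewrite [nsum (fun=> 0)]/nsum esum1 ?subr0.
by rewrite -rsum_sub//; congr rsum; apply/funext => n; rewrite subr0.
Qed.

(** Unlike the maximum with zero, this form of the positive part is a linear
    expression in [a] and its absolute value, so summability is inherited. *)
Definition posp a n := (`|a n| + a n) / 2.
Definition negp a n := (`|a n| - a n) / 2.

Lemma posp_ge0 a n : 0 <= posp a n.
Proof. by rewrite divr_ge0// -lerBlDr sub0r -normrN ler_norm. Qed.
Lemma negp_ge0 a n : 0 <= negp a n.
Proof. by rewrite divr_ge0// subr_ge0 ler_norm. Qed.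
Lemma asum_posp a : asum a -> asum (posp a).
Proof.
move=> sa; have := asumZ 2^-1 (asumD (asum_abs sa) sa).
by congr asum; apply/funext => n; rewrite mulrC.
Qed.
Lemma asum_negp a : asum a -> asum (negp a).
Proof.
move=> sa; have := asumZ 2^-1 (asumD (asum_abs sa) (asumN sa)).
by congr asum; apply/funext => n; rewrite mulrC.
Qed.
Lemma posneg a n : a n = posp a n - negp a n.
Proof. by rewrite /posp /negp; field. Qed.

Lemma rsum_posneg a : asum a -> rsum a = nsum (posp a) - nsum (negp a).
Proof.
move=> sa; rewrite -rsum_sub;
  [|exact: posp_ge0|exact: negp_ge0|exact: asum_posp|exact: asum_negp].
by congr rsum; apply/funext => n; rewrite -posneg.
Qed.

Lemma rsumD a b : asum a -> asum b ->
  rsum (fun n => a n + b n) = rsum a + rsum b.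
Proof.
move=> sa sb.
have pa := posp_ge0 a; have na := negp_ge0 a.
have pb := posp_ge0 b; have nb := negp_ge0 b.
have spa := asum_posp sa; have sna := asum_negp sa.
have spb := asum_posp sb; have snb := asum_negp sb.
rewrite (rsum_posneg sa) (rsum_posneg sb).
rewrite addrACA -opprD -!nsumD// -rsum_sub//.
- by congr rsum; apply/funext => n; rewrite [in LHS]posneg [b n]posneg; ring.
- by move=> n; rewrite addr_ge0.
- by move=> n; rewrite addr_ge0.
- exact: asumD.
- exact: asumD.
Qed.

Lemma rsumN a : rsum (fun n => - a n) = - rsum a.
Proof.
rewrite /rsum opprB; congr (_ - _).
by congr fine; apply: eq_esum => n _; rewrite opprK.
Qed.

Lemma nsumZ (r : R) a : 0 <= r -> (forall n, 0 <= a n) -> asum a ->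
  nsum (fun n => r * a n) = r * nsum a.
Proof.
have H (s : R) b : 0 <= s -> (forall n, 0 <= b n) -> asum b ->
    nsum (fun n => s * b n) <= s * nsum b.
  move=> s0 b0 sb; rewrite -lee_fin nsum_esum//; last 2 first.
  - by move=> n; rewrite mulr_ge0.
  - exact: asumZ.
  apply: ge_ereal_sup => _ [X [finX XI] <-].
  rewrite fsumEFin// lee_fin -mulr_fsumr ler_wpM2l//.
  exact: nsum_fin_le.
rewrite le_eqVlt => /orP[/eqP<-|r0] a0 sa.
  rewrite mul0r /nsum esum1// => n _; first by rewrite mul0r.
apply/eqP; rewrite eq_le H//= ?(ltW r0)//.
have := H r^-1 (fun n => r * a n).
rewrite invr_ge0 (ltW r0) => /(_ isT).
have -> : (fun n => r^-1 * (r * a n)) = a.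
  by apply/funext => n; rewrite mulKf// gt_eqF.
rewrite -(ler_pM2l r0) mulVKf ?gt_eqF//; apply.
- by move=> n; rewrite mulr_ge0// ltW.
- exact: asumZ.
Qed.

Lemma rsumZ (r : R) a : asum a -> rsum (fun n => r * a n) = r * rsum a.
Proof.
have H (s : R) b : 0 <= s -> asum b -> rsum (fun n => s * b n) = s * rsum b.
  move=> s0 sb.
  have pb := posp_ge0 b; have nb := negp_ge0 b.
  have spb := asum_posp sb; have snb := asum_negp sb.
  rewrite (rsum_posneg sb)// mulrBr -!nsumZ// -rsum_sub.
  - by congr rsum; apply/funext => n; rewrite {1}[b n]posneg mulrBr.
  - by move=> n; rewrite mulr_ge0.
  - by move=> n; rewrite mulr_ge0.
  - exact: asumZ.
  - exact: asumZ.
move=> sa; have [r0|/ltW r0] := leP 0 r; first exact: H.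
rewrite -[r]opprK mulNr -H// ?oppr_ge0// -rsumN.
by congr rsum; apply/funext => n; rewrite mulNr.
Qed.

Lemma rsum_reindex (e : I -> I) a : bijective e ->
  rsum (fun n => a (e n)) = rsum a.
Proof.
move=> be; have bs : set_bij [set: I] [set: I] e by rewrite setTT_bijective.
rewrite /rsum; congr (fine _ - fine _).
  exact/esym/(reindex_esum _ _ e (fun n => (Num.max (a n) 0)%:E) bs).
exact/esym/(reindex_esum _ _ e (fun n => (Num.max (- a n) 0)%:E) bs).
Qed.

Lemma asum_reindex (e : I -> I) a : bijective e -> asum a -> asum (fun n => a (e n)).
Proof.
move=> be; have bs : set_bij [set: I] [set: I] e by rewrite setTT_bijective.
by rewrite /asum /summable (reindex_esum _ _ e (fun n => `|(a n)%:E|%E) bs).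
Qed.

Lemma nsum_fin (s : seq I) a : (forall n, 0 <= a n) -> uniq s ->
  (forall n, n \notin s -> a n = 0) ->
  asum a /\ nsum a = \sum_(n <- s) a n.
Proof.
move=> a0 us as0.
have E b : (forall n, 0 <= b n) -> (forall n, n \notin s -> b n = 0) ->
    \esum_(n in [set: I]) (b n)%:E = (\sum_(n <- s) b n)%:E.
  move=> b0 bs0.
  rewrite -(setUv [set` s]) (esum_mkcond _ _).
  have fs : finite_set [set` s] by exact: finite_seq.
  transitivity (\esum_(n in [set` s]) (b n)%:E).
    rewrite [RHS]esum_mkcond; apply: eq_esum => n _.
    rewrite setUv mem_set//; case: ifPn => // /negP; rewrite inE /= => /negP ns.
    by rewrite bs0.
  transitivity (\sum_(n \in [set` s]) (b n)%:E)%E.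
    by apply: esum_fset => // n _; rewrite lee_fin; exact: b0.
  by rewrite fsumEFin// -fsbig_seq.
split; last by rewrite /nsum E.
rewrite /asum /summable (E (fun n => `|a n|)) ?ltry// => n /as0->.
by rewrite normr0.
Qed.

Lemma rsum_fin (s : seq I) a : uniq s -> (forall n, n \notin s -> a n = 0) ->
  asum a /\ rsum a = \sum_(n <- s) a n.
Proof.
move=> us as0.
have [sp Ep] : asum (posp a) /\ nsum (posp a) = \sum_(n <- s) posp a n.
  apply: nsum_fin => //; first exact: posp_ge0.
  by move=> n /as0 an; rewrite /posp an normr0 addr0 mul0r.
have [sn En] : asum (negp a) /\ nsum (negp a) = \sum_(n <- s) negp a n.
  apply: nsum_fin => //; first exact: negp_ge0.
  by move=> n /as0 an; rewrite /negp an normr0 subr0 mul0r.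
have sa : asum a.
  have := asumD sp (asumN sn).
  by congr asum; apply/funext => n; rewrite -posneg.
split=> //; rewrite rsum_posneg// Ep En -sumrB.
by apply: eq_bigr => n _; rewrite -posneg.
Qed.

End Sums.

(** * The Hilbert space of square-summable families *)

Section ComplexParts.
Context {R : realType}.
Implicit Types (x y : R[i]).
Lemma cRe_add x y : complex.Re (x + y) = complex.Re x + complex.Re y.
Proof. by case: x y => [a b] [c d]. Qed.
Lemma cIm_add x y : complex.Im (x + y) = complex.Im x + complex.Im y.
Proof. by case: x y => [a b] [c d]. Qed.
Lemma cRe_opp x : complex.Re (- x) = - complex.Re x.
Proof. by case: x => [a b]. Qed.
Lemma cIm_opp x : complex.Im (- x) = - complex.Im x.
Proof. by case: x => [a b]. Qed.
Lemma cRe_mul x y : complex.Re (x * y) =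
  complex.Re x * complex.Re y - complex.Im x * complex.Im y.
Proof. by case: x y => [a b] [c d]. Qed.
Lemma cIm_mul x y : complex.Im (x * y) =
  complex.Re x * complex.Im y + complex.Im x * complex.Re y.
Proof. by case: x y => [a b] [c d]. Qed.
Lemma cRe_conj x : complex.Re (x^*)%C = complex.Re x.
Proof. by case: x => [a b]. Qed.
Lemma cIm_conj x : complex.Im (x^*)%C = - complex.Im x.
Proof. by case: x => [a b]. Qed.
Lemma complex_ext x y : complex.Re x = complex.Re y ->
  complex.Im x = complex.Im y -> x = y.
Proof. by case: x y => [a b] [c d] /= -> ->. Qed.

Definition nsq x : R := complex.Re x ^+ 2 + complex.Im x ^+ 2.

Lemma nsq_ge0 x : 0 <= nsq x.
Proof. by rewrite addr_ge0 ?sqr_ge0. Qed.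

Lemma Re_sqr_norm x : complex.Re (`|x| ^+ 2) = nsq x.
Proof. by rewrite -add_Re2_Im2. Qed.

Lemma conjM_nsq x : (x^*)%C * x = Complex (nsq x) 0.
Proof.
by case: x => a b; apply: complex_ext; rewrite ?cRe_mul ?cIm_mul /nsq /=; ring.
Qed.

Lemma nsqM x y : nsq (x * y) = nsq x * nsq y.
Proof. by rewrite /nsq cRe_mul cIm_mul; ring. Qed.

Lemma nsq_eq0 x : nsq x = 0 -> x = 0.
Proof.
move=> /eqP; rewrite paddr_eq0 ?sqr_ge0// !sqrf_eq0 => /andP[/eqP a /eqP b].
exact: complex_ext.
Qed.

Lemma nsqD_le x y : nsq (x + y) <= 2 * (nsq x + nsq y).
Proof.
rewrite /nsq cRe_add cIm_add.
have := sqr_ge0 (complex.Re x - complex.Re y).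
have := sqr_ge0 (complex.Im x - complex.Im y).
by lra.
Qed.

End ComplexParts.
Definition ReImE := (@cRe_add, @cIm_add, @cRe_opp, @cIm_opp, @cRe_mul, @cIm_mul, @cRe_conj, @cIm_conj).

Section L2.
Context {R : realType} {I : choiceType}.
Local Notation fam := (fam R I).
Implicit Types (u v w f g : fam).

Lemma l2P u : l2 u <-> asum (fun n => nsq (u n)).
Proof.
rewrite /l2 /= /asum.
have -> : (fun n => (nsq (u n))%:E) = (fun n => (complex.Re (`|u n| ^+ 2))%:E) => //.
by apply/funext => n; rewrite Re_sqr_norm.
Qed.

Lemma l2_add u v : l2 u -> l2 v -> l2 (addf u v).
Proof.
move=> /l2P su /l2P sv; apply/l2P.
apply: asum_le (asumZ 2 (asumD su sv)) => n.
by rewrite ger0_norm ?nsq_ge0// nsqD_le.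
Qed.

Lemma l2_scale (a : R[i]) u : l2 u -> l2 (scalef a u).
Proof.
move=> /l2P su; apply/l2P; apply: asum_le (asumZ (nsq a) su) => n.
by rewrite ger0_norm ?nsq_ge0// nsqM.
Qed.

Lemma subfE u v : subf u v = addf u (scalef (-1) v).
Proof. by apply/funext => n; rewrite /subf /addf /scalef mulN1r. Qed.

Lemma l2_sub u v : l2 u -> l2 v -> l2 (subf u v).
Proof. by move=> su sv; rewrite subfE; apply: l2_add => //; exact: l2_scale. Qed.

Lemma l2_zero : l2 ((fun=> 0) : fam).
Proof.
apply/l2P; have [] // := @rsum_fin R I [::] (fun n => nsq (0 : R[i])).
by move=> n _; rewrite /nsq /= expr0n /= addr0.
Qed.

Lemma asum_prod_Re u v : l2 u -> l2 v ->
  asum (fun n => complex.Re ((u n)^*%C * v n)).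
Proof.
move=> /l2P su /l2P sv; apply: asum_le (asumD su sv) => n.
rewrite cRe_mul cRe_conj cIm_conj /nsq.
move: (complex.Re (u n)) (complex.Im (u n)) (complex.Re (v n)) (complex.Im (v n)).
move=> a b c d; rewrite ler_norml; apply/andP; split.
  have := sqr_ge0 (a + c); have := sqr_ge0 (b + d); have := sqr_ge0 a.
  have := sqr_ge0 b; have := sqr_ge0 c; have := sqr_ge0 d; lra.
have := sqr_ge0 (a - c); have := sqr_ge0 (b - d); have := sqr_ge0 a.
have := sqr_ge0 b; have := sqr_ge0 c; have := sqr_ge0 d; lra.
Qed.

Lemma asum_prod_Im u v : l2 u -> l2 v ->
  asum (fun n => complex.Im ((u n)^*%C * v n)).
Proof.
move=> su sv; have := asumN (asum_prod_Re su (l2_scale 'i%C sv)).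
congr asum; apply/funext => n; rewrite /scalef !ReImE /=; ring.
Qed.

Lemma innerDr u v w : l2 u -> l2 v -> l2 w ->
  inner u (addf v w) = inner u v + inner u w.
Proof.
move=> su sv sw; apply: complex_ext; rewrite ?cRe_add ?cIm_add /inner /csum /=.
  rewrite -rsumD; [|exact: asum_prod_Re..].
  by congr rsum; apply/funext => n; rewrite mulrDr cRe_add.
rewrite -rsumD; [|exact: asum_prod_Im..].
by congr rsum; apply/funext => n; rewrite mulrDr cIm_add.
Qed.

Lemma innerZr a u v : l2 u -> l2 v -> inner u (scalef a v) = a * inner u v.
Proof.
move=> su sv; have sr := asum_prod_Re su sv; have si := asum_prod_Im su sv.
apply: complex_ext; rewrite ?cRe_mul ?cIm_mul /inner /csum /=.
  rewrite -!rsumZ// -rsumN -rsumD; [|exact: asumZ|exact/asumN/asumZ].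
  by congr rsum; apply/funext => n; rewrite mulrCA cRe_mul.
rewrite -!rsumZ// -rsumD; [|exact: asumZ..].
by congr rsum; apply/funext => n; rewrite mulrCA cIm_mul.
Qed.

Lemma innerC u v : inner v u = (inner u v)^*%C.
Proof.
apply: complex_ext; rewrite ?cRe_conj ?cIm_conj /inner /csum /=.
  by congr rsum; apply/funext => n; rewrite !ReImE; ring.
by rewrite -rsumN; congr rsum; apply/funext => n; rewrite !ReImE; ring.
Qed.

Lemma innerDl u v w : l2 u -> l2 v -> l2 w ->
  inner (addf v w) u = inner v u + inner w u.
Proof. by move=> *; rewrite innerC innerDr// (innerC u v) (innerC u w) rmorphD. Qed.

Lemma innerZl a u v : l2 u -> l2 v -> inner (scalef a v) u = a^*%C * inner v u.
Proof. by move=> *; rewrite innerC innerZr// (innerC u v) rmorphM. Qed.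

Lemma innerBr u v w : l2 u -> l2 v -> l2 w ->
  inner u (subf v w) = inner u v - inner u w.
Proof.
by move=> *; rewrite subfE innerDr ?innerZr ?mulN1r//; exact: l2_scale.
Qed.

Lemma innerBl u v w : l2 u -> l2 v -> l2 w ->
  inner (subf v w) u = inner v u - inner w u.
Proof. by move=> *; rewrite innerC innerBr// (innerC u v) (innerC u w) rmorphB. Qed.

(** The squared norm; unlike [norm2] it is quadratic, which keeps the form
    inequalities polynomial. *)
Definition N2 u : R := complex.Re (inner u u).

Lemma N2E u : l2 u -> N2 u = nsum (fun n => nsq (u n)).
Proof.
move=> /l2P su; rewrite -rsum_nsum//; last by move=> n; exact: nsq_ge0.
by rewrite /N2 /=; congr rsum; apply/funext => n; rewrite conjM_nsq.
Qed.

Lemma N2_ge0 u : l2 u -> 0 <= N2 u.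
Proof. by move=> su; rewrite N2E// nsum_ge0// => n; exact: nsq_ge0. Qed.

Lemma inner_self u : inner u u = Complex (N2 u) 0.
Proof.
apply: complex_ext => //=.
rewrite [X in rsum X](_ : _ = fun=> 0); last first.
  by apply/funext => n; rewrite conjM_nsq.
by have [] := @rsum_fin R I [::] (fun=> 0) isT (fun _ _ => erefl); rewrite big_nil.
Qed.

Lemma norm2E u : norm2 u = Num.sqrt (N2 u). Proof. by []. Qed.

Lemma sqr_norm2 u : l2 u -> norm2 u ^+ 2 = N2 u.
Proof. by move=> su; rewrite norm2E sqr_sqrtr// N2_ge0. Qed.

Lemma N2_eq0 u : l2 u -> N2 u = 0 -> u = (fun=> 0).
Proof.
move=> su; rewrite N2E// => u0; apply/funext => n.
apply: nsq_eq0; have nu m : 0 <= nsq (u m) by exact: nsq_ge0.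
exact: (nsum_eq0 nu ((l2P u).1 su) u0 n).
Qed.

(** Real inequalities between quadratic forms only see this real bilinear form;
    imaginary parts are recovered from it by [inner_Im]. *)
Definition rip u v : R := complex.Re (inner u v).

Lemma ripC u v : rip u v = rip v u.
Proof. by rewrite /rip innerC cRe_conj. Qed.
Lemma ripDr u v w : l2 u -> l2 v -> l2 w -> rip u (addf v w) = rip u v + rip u w.
Proof. by move=> *; rewrite /rip innerDr// cRe_add. Qed.
Lemma ripDl u v w : l2 u -> l2 v -> l2 w -> rip (addf v w) u = rip v u + rip w u.
Proof. by move=> *; rewrite /rip innerDl// cRe_add. Qed.
Lemma ripBr u v w : l2 u -> l2 v -> l2 w -> rip u (subf v w) = rip u v - rip u w.
Proof. by move=> *; rewrite /rip innerBr// cRe_add cRe_opp. Qed.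
Lemma ripBl u v w : l2 u -> l2 v -> l2 w -> rip (subf v w) u = rip v u - rip w u.
Proof. by move=> *; rewrite /rip innerBl// cRe_add cRe_opp. Qed.
Lemma ripZr (a : R) u v : l2 u -> l2 v -> rip u (scalef (a%:C)%C v) = a * rip u v.
Proof. by move=> *; rewrite /rip innerZr// cRe_mul /= mul0r subr0. Qed.
Lemma ripZl (a : R) u v : l2 u -> l2 v -> rip (scalef (a%:C)%C u) v = a * rip u v.
Proof. by move=> *; rewrite ripC ripZr// ripC. Qed.
Lemma ripN2 u : rip u u = N2 u. Proof. by []. Qed.

Lemma inner_Im u v : l2 u -> l2 v ->
  complex.Im (inner u v) = rip u (scalef (- 'i)%C v).
Proof. by move=> su sv; rewrite /rip innerZr// cRe_mul /=; ring. Qed.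

Lemma N2Z a u : l2 u -> N2 (scalef a u) = nsq a * N2 u.
Proof.
move=> su; have sa := l2_scale a su; rewrite (N2E sa) (N2E su).
have nu m : 0 <= nsq (u m) by exact: nsq_ge0.
rewrite -(nsumZ (nsq_ge0 a) nu ((l2P u).1 su)).
by congr nsum; apply/funext => n; rewrite nsqM.
Qed.

Lemma N2D u v : l2 u -> l2 v -> N2 (addf u v) = N2 u + 2 * rip u v + N2 v.
Proof.
move=> su sv; rewrite -!ripN2 ripDr//; last exact: l2_add.
by rewrite !ripDl// (ripC v u); ring.
Qed.

Lemma N2B u v : l2 u -> l2 v -> N2 (subf u v) = N2 u - 2 * rip u v + N2 v.
Proof.
move=> su sv; rewrite -!ripN2 ripBr//; last exact: l2_sub.
by rewrite !ripBl// (ripC v u); ring.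
Qed.

(** The squared norm of [e u - v] is nonnegative.  This version of the
    Cauchy-Schwarz inequality, with a free parameter, absorbs cross terms. *)
Lemma rip_AMGM (e : R) u v : 0 < e -> l2 u -> l2 v ->
  2 * rip u v <= e * N2 u + e^-1 * N2 v.
Proof.
move=> e0 su sv; have sa := l2_scale (e%:C)%C su.
have := N2_ge0 (l2_sub sa sv); rewrite N2B// N2Z// ripZl// /nsq /= expr0n /= addr0.
move=> h; rewrite -subr_ge0.
have i0 : 0 <= e^-1 by rewrite invr_ge0 ltW.
have := mulr_ge0 i0 h; congr (_ <= _).
by field; rewrite gt_eqF.
Qed.

Lemma rip_CS u v : l2 u -> l2 v -> rip u v <= norm2 u * norm2 v.
Proof.
move=> su sv.
have [u0|u0] := eqVneq (N2 u) 0.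
  rewrite (N2_eq0 su u0); have -> : rip (fun=> 0) v = 0.
    rewrite /rip (_ : (fun=> 0) = scalef 0 v).
      by rewrite innerZl// rmorph0 mul0r.
    by apply/funext => n; rewrite /scalef mul0r.
  by rewrite mulr_ge0// sqrtr_ge0.
have [v0|v0] := eqVneq (N2 v) 0.
  rewrite (N2_eq0 sv v0); have -> : rip u (fun=> 0) = 0.
    rewrite /rip (_ : (fun=> 0) = scalef 0 u).
      by rewrite innerZr// mul0r.
    by apply/funext => n; rewrite /scalef mul0r.
  by rewrite mulr_ge0// sqrtr_ge0.
have nu : 0 < norm2 u by rewrite sqrtr_gt0 lt_neqAle eq_sym u0 N2_ge0.
have nv : 0 < norm2 v by rewrite sqrtr_gt0 lt_neqAle eq_sym v0 N2_ge0.
have := rip_AMGM (divr_gt0 nv nu) su sv; rewrite -!sqr_norm2//.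
have -> : norm2 v / norm2 u * norm2 u ^+ 2 + (norm2 v / norm2 u)^-1 * norm2 v ^+ 2
   = 2 * (norm2 u * norm2 v) by field; rewrite !gt_eqF.
by rewrite ler_pM2l.
Qed.

Lemma norm2_ge0 u : 0 <= norm2 u. Proof. exact: sqrtr_ge0. Qed.

Lemma norm2Z a u : l2 u -> norm2 (scalef a u) = Num.sqrt (nsq a) * norm2 u.
Proof. by move=> su; rewrite !norm2E N2Z// sqrtrM// nsq_ge0. Qed.

Lemma norm2N u : norm2 (scalef (-1) u) = norm2 u.
Proof.
rewrite /norm2; congr (Num.sqrt (complex.Re _)).
rewrite /inner; congr csum; apply/funext => n.
by rewrite /scalef rmorphM rmorphN1 /= mulN1r mulN1r mulrNN.
Qed.

Lemma norm2D u v : l2 u -> l2 v -> norm2 (addf u v) <= norm2 u + norm2 v.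
Proof.
move=> su sv; rewrite -(ler_pXn2r (n:=2))// ?nnegrE ?addr_ge0 ?norm2_ge0//.
rewrite sqr_norm2; last exact: l2_add.
rewrite N2D// sqrrD !sqr_norm2//; have := rip_CS su sv; rewrite -mulr_natl; lra.
Qed.

Lemma rip_abs u v : l2 u -> l2 v -> `|rip u v| <= norm2 u * norm2 v.
Proof.
move=> su sv; rewrite ler_norml rip_CS// andbT lerNl.
rewrite -(norm2N v) (_ : - rip u v = rip u (scalef (-1) v)).
  by apply: rip_CS => //; exact: l2_scale.
by rewrite /rip innerZr// mulN1r cRe_opp.
Qed.

End L2.

(** * Finitely supported families and density *)

Section Density.
Context {R : realType} {I : choiceType}.
Local Notation fam := (fam R I).
Local Notation op := (op R I).
Implicit Types (u v w f g : fam) (T : op).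

Definition finsupp u := finite_set [set n | u n != 0].

Lemma finsupp_seq u : finsupp u ->
  exists2 s : seq I, uniq s & forall n, n \notin s -> u n = 0.
Proof.
move=> /finite_seqP[s Es]; exists (undup s); first exact: undup_uniq.
move=> n; rewrite mem_undup => ns; apply/eqP; apply: contraNT ns => un.
by have : [set n | u n != 0] n by []; rewrite Es.
Qed.

Lemma seq_finsupp u (s : seq I) : (forall n, n \notin s -> u n = 0) -> finsupp u.
Proof.
move=> us; apply: (sub_finite_set (B := [set` s])); last exact: finite_seq.
by move=> n /= un; apply: contraNT un => /us ->.
Qed.

Lemma inner_fin u v (s : seq I) : uniq s -> (forall n, n \notin s -> u n = 0) ->
  inner u v = \sum_(n <- s) (u n)^*%C * v n.
Proof.
move=> us u0.
have zR n : n \notin s -> complex.Re ((u n)^*%C * v n) = 0.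
  by move=> /u0 ->; rewrite rmorph0 mul0r.
have zI n : n \notin s -> complex.Im ((u n)^*%C * v n) = 0.
  by move=> /u0 ->; rewrite rmorph0 mul0r.
have [_ eR] := rsum_fin us zR; have [_ eI] := rsum_fin us zI.
apply: complex_ext; rewrite /inner /csum /=.
  by rewrite eR (big_morph (@complex.Re R) (@cRe_add R) erefl).
by rewrite eI (big_morph (@complex.Im R) (@cIm_add R) erefl).
Qed.

Lemma l2_fin u : finsupp u -> l2 u.
Proof.
move=> /finsupp_seq[s us u0]; apply/l2P.
have [|h _] := @rsum_fin R I s (fun n => nsq (u n)) us; last by [].
by move=> n /u0 ->; rewrite /nsq /= expr0n /= addr0.
Qed.

(** Restrict [u] to a finite set that carries all but [e ^ 2] of the sum of the
    squared moduli. *)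
Lemma density u (e : R) : l2 u -> 0 < e ->
  exists2 w, finsupp w & norm2 (subf w u) < e.
Proof.
move=> lu e0.
have nu m : 0 <= nsq (u m) by exact: nsq_ge0.
have su := (l2P u).1 lu.
have [F fF hF] := nsum_approx nu su (exprn_gt0 2 e0).
pose w : fam := fun n => if n \in F then u n else 0.
have fw : finsupp w.
  apply: (sub_finite_set (B := F)) => // n /=; rewrite /w.
  by case: ifPn; rewrite ?inE// eqxx.
have ld := l2_sub (l2_fin fw) lu.
exists w => //; rewrite -(ltr_pXn2r (n:=2))// ?nnegrE ?norm2_ge0 ?(ltW e0)//.
rewrite sqr_norm2// N2E//.
have nw m : 0 <= nsq (w m) by exact: nsq_ge0.
have nd m : 0 <= nsq (subf w u m) by exact: nsq_ge0.
have sw := (l2P w).1 (l2_fin fw); have sd := (l2P _).1 ld.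
have E : nsum (fun n => nsq (u n)) =
    nsum (fun n => nsq (w n)) + nsum (fun n => nsq (subf w u n)).
  rewrite -nsumD//; congr nsum; apply/funext => n; rewrite /subf /w.
  case: ifPn => _; first by rewrite subrr /nsq /= expr0n /= !addr0.
  by rewrite sub0r /nsq !ReImE !sqrrN /= expr0n /= addr0 add0r.
have : \sum_(n \in F) nsq (u n) <= nsum (fun n => nsq (w n)).
  rewrite (eq_fsbigr (fun n => nsq (w n))).
    exact: nsum_fin_le.
  by move=> n nF; rewrite /w nF.
move: hF; rewrite E; lra.
Qed.

Lemma density_seq u : l2 u ->
  exists2 u_ : nat -> fam, (forall m, finsupp (u_ m)) & cvg_l2 u_ u.
Proof.
move=> lu.
have h (m : nat) : exists w, finsupp w /\ norm2 (subf w u) < m.+1%:R^-1.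
  have [|w fw hw] := @density u (m.+1%:R^-1) lu; first by rewrite invr_gt0.
  by exists w.
have [u_ hu] := choice h; exists u_; first by move=> m; have [] := hu m.
apply: (@squeeze_cvgr _ _ _ _ (fun=> 0) (fun m => m.+1%:R^-1)).
- near=> m; rewrite norm2_ge0 /=; exact: (ltW (hu m).2).
- exact: cvg_cst.
- exact: cvg_harmonic.
Unshelve. all: by end_near. Qed.

Lemma rip_diff u v u' v' : l2 u -> l2 v -> l2 u' -> l2 v' ->
  `|rip u' v' - rip u v| <=
  norm2 (subf u' u) * (norm2 (subf v' v) + norm2 v) + norm2 u * norm2 (subf v' v).
Proof.
move=> lu lv lu' lv'.
have -> : rip u' v' - rip u v = rip (subf u' u) v' + rip u (subf v' v).
  by rewrite ripBl// ripBr//; ring.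
apply: le_trans (ler_normD _ _) _; apply: lerD.
  apply: le_trans (rip_abs (l2_sub lu' lu) lv') _.
  apply: ler_wpM2l; first exact: norm2_ge0.
  have -> : v' = addf (subf v' v) v.
    by apply/funext => n; rewrite /addf /subf subrK.
  apply: le_trans (norm2D _ lv) _; first exact: l2_sub.
  rewrite (_ : subf (addf _ _) _ = subf v' v)//.
  by apply/funext => n; rewrite /addf /subf; ring.
exact: (rip_abs lu (l2_sub lv' lv)).
Qed.

Lemma rip_cvg u v (u_ v_ : nat -> fam) : l2 u -> l2 v ->
  (forall m, l2 (u_ m)) -> (forall m, l2 (v_ m)) ->
  cvg_l2 u_ u -> cvg_l2 v_ v ->
  (fun m => rip (u_ m) (v_ m)) @ \oo --> rip u v.
Proof.
move=> lu lv lu_ lv_ cu cv; apply/cvgrPdist_le => e e0.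
pose a m := norm2 (subf (u_ m) u); pose b m := norm2 (subf (v_ m) v).
have : (fun m => a m * (b m + norm2 v) + norm2 u * b m) @ \oo -->
    (0 * (0 + norm2 v) + norm2 u * 0 : R).
  apply: cvgD; last by apply: cvgM => //; exact: cvg_cst.
  by apply: cvgM => //; apply: cvgD => //; exact: cvg_cst.
rewrite mul0r mulr0 addr0 => /cvgrPdist_le /(_ e e0); apply: filterS => m.
rewrite sub0r normrN distrC => /(le_trans (ler_norm _)).
by apply: le_trans; exact: rip_diff.
Qed.

Lemma cvg_l2_scale a u (u_ : nat -> fam) : l2 u -> (forall m, l2 (u_ m)) ->
  cvg_l2 u_ u -> cvg_l2 (fun m => scalef a (u_ m)) (scalef a u).
Proof.
move=> lu lu_ cu; rewrite /cvg_l2.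
have -> : (fun m => norm2 (subf (scalef a (u_ m)) (scalef a u))) =
   (fun m => Num.sqrt (nsq a) * norm2 (subf (u_ m) u)).
  apply/funext => m; rewrite -norm2Z; last exact: l2_sub.
  by congr norm2; apply/funext => n; rewrite /subf /scalef mulrBr.
by rewrite -[X in _ --> X](mulr0 (Num.sqrt (nsq a))); apply: cvgM => //; exact: cvg_cst.
Qed.

Lemma cvg_l2_cst u : l2 u -> cvg_l2 (fun=> u) u.
Proof.
move=> lu; rewrite /cvg_l2 (_ : norm2 _ = 0); first exact: cvg_cst.
rewrite norm2E N2B// ripN2.
by rewrite (_ : _ - _ + _ = 0) ?sqrtr0//; ring.
Qed.

Lemma Im_inner_cvg u v (u_ v_ : nat -> fam) : l2 u -> l2 v ->
  (forall m, l2 (u_ m)) -> (forall m, l2 (v_ m)) ->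
  cvg_l2 u_ u -> cvg_l2 v_ v ->
  (fun m => complex.Im (inner (u_ m) (v_ m))) @ \oo --> complex.Im (inner u v).
Proof.
move=> lu lv lu_ lv_ cu cv; rewrite inner_Im//.
rewrite (_ : (fun m => complex.Im _) = fun m => rip (u_ m) (scalef (- 'i)%C (v_ m))).
  apply: rip_cvg => //; first exact: l2_scale.
  - by move=> m; exact: l2_scale.
  - exact: cvg_l2_scale.
by apply/funext => m; rewrite inner_Im.
Qed.

(** Identities between inner products survive limits in norm: this is how they
    are extended from finitely supported families, here and in the next
    lemma. *)
Lemma inner_lim u v u' v' (u_ v_ u'_ v'_ : nat -> fam) :
  l2 u -> l2 v -> l2 u' -> l2 v' ->
  (forall m, l2 (u_ m)) -> (forall m, l2 (v_ m)) ->
  (forall m, l2 (u'_ m)) -> (forall m, l2 (v'_ m)) ->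
  cvg_l2 u_ u -> cvg_l2 v_ v -> cvg_l2 u'_ u' -> cvg_l2 v'_ v' ->
  (forall m, inner (u_ m) (v_ m) = inner (u'_ m) (v'_ m)) ->
  inner u v = inner u' v'.
Proof.
move=> lu lv lu' lv' lu_ lv_ lu'_ lv'_ cu cv cu' cv' E; apply: complex_ext.
  have c1 := rip_cvg lu lv lu_ lv_ cu cv.
  have c2 := rip_cvg lu' lv' lu'_ lv'_ cu' cv'.
  apply: (cvg_unique _ _ c2); first exact: norm_hausdorff.
  rewrite (_ : (fun m => rip (u'_ m) (v'_ m)) = fun m => rip (u_ m) (v_ m))//.
  by apply/funext => m; rewrite /rip E.
have c1 := Im_inner_cvg lu lv lu_ lv_ cu cv.
have c2 := Im_inner_cvg lu' lv' lu'_ lv'_ cu' cv'.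
apply: (cvg_unique _ _ c2); first exact: norm_hausdorff.
rewrite (_ : (fun m => _ (inner (u'_ m) (v'_ m))) =
  fun m => complex.Im (inner (u_ m) (v_ m)))//.
by apply/funext => m; rewrite E.
Qed.

Lemma inner_lim_add u v u1 v1 u2 v2 (u_ v_ u1_ v1_ u2_ v2_ : nat -> fam) :
  l2 u -> l2 v -> l2 u1 -> l2 v1 -> l2 u2 -> l2 v2 ->
  (forall m, l2 (u_ m)) -> (forall m, l2 (v_ m)) ->
  (forall m, l2 (u1_ m)) -> (forall m, l2 (v1_ m)) ->
  (forall m, l2 (u2_ m)) -> (forall m, l2 (v2_ m)) ->
  cvg_l2 u_ u -> cvg_l2 v_ v -> cvg_l2 u1_ u1 -> cvg_l2 v1_ v1 ->
  cvg_l2 u2_ u2 -> cvg_l2 v2_ v2 ->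
  (forall m, inner (u_ m) (v_ m) = inner (u1_ m) (v1_ m) + inner (u2_ m) (v2_ m)) ->
  inner u v = inner u1 v1 + inner u2 v2.
Proof.
move=> lu lv lu1 lv1 lu2 lv2 lu_ lv_ lu1_ lv1_ lu2_ lv2_ cu cv cu1 cv1 cu2 cv2 E.
apply: complex_ext.
  have c := rip_cvg lu lv lu_ lv_ cu cv.
  have c' : rip (u1_ m) (v1_ m) + rip (u2_ m) (v2_ m) @[m --> \oo] -->
      rip u1 v1 + rip u2 v2 by apply: cvgD; exact: rip_cvg.
  rewrite cRe_add; apply: (cvg_unique _ _ c'); first exact: norm_hausdorff.
  rewrite (_ : (fun m => rip _ _ + _) = fun m => rip (u_ m) (v_ m))//.
  by apply/funext => m; rewrite /rip E cRe_add.
have c := Im_inner_cvg lu lv lu_ lv_ cu cv.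
have c' : complex.Im (inner (u1_ m) (v1_ m)) + complex.Im (inner (u2_ m) (v2_ m))
    @[m --> \oo] --> complex.Im (inner u1 v1) + complex.Im (inner u2 v2).
  by apply: cvgD; exact: Im_inner_cvg.
rewrite cIm_add; apply: (cvg_unique _ _ c'); first exact: norm_hausdorff.
rewrite (_ : (fun m => _ + _) = fun m => complex.Im (inner (u_ m) (v_ m)))//.
by apply/funext => m; rewrite E cIm_add.
Qed.

Lemma bounded_norm T : bounded_op T ->
  exists2 M : R, 0 <= M & forall u, l2 u -> norm2 (T u) <= M * norm2 u.
Proof.
move=> [_ _ [M hM]]; exists `|M| => // u lu.
by rewrite (le_trans (hM u lu))// ler_wpM2r ?norm2_ge0// ler_norm.
Qed.

Lemma bounded_l2 T u : bounded_op T -> l2 u -> l2 (T u).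
Proof. by move=> [h _ _]; exact: h. Qed.

Lemma boundedD T u v : bounded_op T -> l2 u -> l2 v ->
  T (addf u v) = addf (T u) (T v).
Proof.
move=> [_ h _] lu lv; have := h 1 u v lu lv.
have E w : scalef 1 w = w by apply/funext => n; rewrite /scalef mul1r.
by rewrite !E.
Qed.

Lemma boundedZ T a u : bounded_op T -> l2 u -> T (scalef a u) = scalef a (T u).
Proof.
move=> bT lu; have lz := @l2_zero R I.
have E w : addf w (fun=> 0) = w by apply/funext => n; rewrite /addf addr0.
have z0 : T (fun=> 0) = (fun=> 0).
  have := boundedD bT lz lz; rewrite E => /(congr1 (subf ^~ (T (fun=> 0)))) z.
  apply/funext => n; move/(congr1 (fun w => w n)) : z.
  by rewrite /subf /addf addrK subrr => <-.
by case: (bT) => _ /(_ a u (fun=> 0) lu lz) + _; rewrite z0 !E.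
Qed.

Lemma boundedB T u v : bounded_op T -> l2 u -> l2 v ->
  T (subf u v) = subf (T u) (T v).
Proof.
move=> bT lu lv; rewrite !subfE boundedD//; last exact: l2_scale.
by rewrite boundedZ.
Qed.

Lemma bounded_cvg T u (u_ : nat -> fam) : bounded_op T -> l2 u ->
  (forall m, l2 (u_ m)) -> cvg_l2 u_ u -> cvg_l2 (fun m => T (u_ m)) (T u).
Proof.
move=> bT lu lu_ cu; have [M M0 hM] := bounded_norm bT.
apply: (@squeeze_cvgr _ _ _ _ (fun=> 0) (fun m => M * norm2 (subf (u_ m) u))).
- near=> m; rewrite norm2_ge0 /= -boundedB// hM//; exact: l2_sub.
- exact: cvg_cst.
- by rewrite -[X in _ --> X](mulr0 M); apply: cvgM => //; exact: cvg_cst.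
Unshelve. all: by end_near. Qed.

(** Test against the families supported at one point. *)
Lemma inner_inj u v : l2 u -> l2 v ->
  (forall w, finsupp w -> inner w u = inner w v) -> u = v.
Proof.
move=> lu lv h; apply/funext => n.
pose w : fam := fun m => if m == n then 1 else 0.
have w0 m : m \notin [:: n] -> w m = 0 by rewrite inE /w => /negbTE->.
have := h w (seq_finsupp w0).
rewrite !(inner_fin _ (s := [:: n]))// !big_seq1 /w eqxx rmorph1.
by rewrite !mul1r.
Qed.

End Density.

(** * Projection-valued measures of bounded operators *)

Section SpectralMeasure.
Context {R : realType} {I : choiceType}.
Local Notation fam := (fam R I).
Local Notation op := (op R I).
Variables (T : op) (P : set (measurableTypeR R) -> op).
Hypothesis hP : spectral_measure T P.
Hypothesis bT : bounded_op T.
Hypothesis symT : forall u v, l2 u -> l2 v -> inner (T u) v = inner u (T v).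
Implicit Types (u v w : fam) (B C X : set (measurableTypeR R)).

Lemma proj_bounded B : measurable B -> bounded_op (P B).
Proof. by case: hP => h _ _ _ mB; have [] := h B mB. Qed.

Lemma proj_l2 B u : measurable B -> l2 u -> l2 (P B u).
Proof. by move=> mB; apply: bounded_l2; exact: proj_bounded. Qed.

Lemma proj_idem B u : measurable B -> l2 u -> P B (P B u) = P B u.
Proof. by case: hP => h _ _ _ mB; have [_ + _] := h B mB; apply. Qed.

Lemma proj_sym B u v : measurable B -> l2 u -> l2 v ->
  inner (P B u) v = inner u (P B v).
Proof. by case: hP => h _ _ _ mB; have [_ _ +] := h B mB; apply. Qed.

Lemma projI B C u : measurable B -> measurable C -> l2 u ->
  P (B `&` C) u = P B (P C u).
Proof. by case: hP => _ _ + _; apply. Qed.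

Lemma inner_proj B u : measurable B -> l2 u -> inner u (P B u) = Complex (N2 (P B u)) 0.
Proof.
move=> mB lu; rewrite -{1}(proj_idem mB lu) -proj_sym//; last exact: proj_l2.
exact: inner_self.
Qed.

Lemma proj_measure u : l2 u ->
  exists mu : {finite_measure set (measurableTypeR R) -> \bar R},
  [/\ forall B, measurable B -> mu B = (N2 (P B u))%:E,
      mu.-integrable [set: measurableTypeR R] (fun x => (x : R)%:E)
    & rip u (T u) = \int[mu]_(x in [set: measurableTypeR R]) (x : R)].
Proof.
move=> lu; case: hP => _ _ _ /(_ u lu) [mu [h1 h2 h3]]; exists mu; split => //.
  by move=> B mB; rewrite h1// inner_proj.
by rewrite /rip h3.
Qed.

Lemma proj_set0 u : l2 u -> P set0 u = (fun=> 0).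
Proof.
move=> lu; apply: N2_eq0; first exact: proj_l2.
by have [mu [h _ _]] := proj_measure lu; have := h _ measurable0; rewrite measure0 => -[].
Qed.

Lemma proj_disj B C u : measurable B -> measurable C -> B `&` C = set0 -> l2 u ->
  P B (P C u) = (fun=> 0).
Proof. by move=> mB mC BC lu; rewrite -projI// BC proj_set0. Qed.

Lemma rip0 u : l2 u -> rip u (fun=> 0) = 0.
Proof.
move=> lu; have -> : (fun=> 0) = scalef 0 u :> fam.
  by apply/funext => n; rewrite /scalef mul0r.
by rewrite /rip innerZr// mul0r.
Qed.

(** Additivity of the measure of [u] gives the Pythagorean identity for the two
    projections, which leaves no norm for the remainder. *)
Lemma proj_split B u : measurable B -> l2 u -> u = addf (P B u) (P (~` B) u).
Proof.
move=> mB lu; have mC := measurableC mB.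
have [mu [h _ _]] := proj_measure lu.
have E : N2 u = N2 (P B u) + N2 (P (~` B) u).
  have : (N2 (P setT u))%:E = ((N2 (P B u))%:E + (N2 (P (~` B) u))%:E)%E.
    transitivity (mu setT); first by rewrite h.
    rewrite -(setUCr B); etransitivity.
      exact: (measureU mu mB mC (setICr B)).
    by congr (_ + _)%E; exact: h.
  by case: hP => _ -> // _ _ [].
have lB := proj_l2 mB lu; have lC := proj_l2 mC lu.
have lS := l2_add lB lC.
have o : rip (P B u) (P (~` B) u) = 0.
  by rewrite /rip proj_sym// proj_disj//; [exact: rip0|rewrite setICr].
have : N2 (subf u (addf (P B u) (P (~` B) u))) = 0.
  rewrite N2B// N2D// ripDr// o /rip !inner_proj//= E; ring.
move=> /(N2_eq0 (l2_sub lu lS)) h0; apply/funext => n.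
have /= := congr1 (fun w => w n) h0; rewrite /subf => /eqP.
by rewrite subr_eq0 => /eqP.
Qed.

(** The two vectors live over disjoint sets, so the measure of their sum is the
    sum of their measures.  Integrating the identity function shows that the
    form of [T] is additive on them, that is, its cross term vanishes. *)
Lemma form_orthogonal B u v : measurable B -> l2 u -> l2 v ->
  rip (P B u) (T (P (~` B) v)) = 0.
Proof.
move=> mB lu lv; have mC := measurableC mB.
set x := P B u; set y := P (~` B) v.
have lx : l2 x by exact: proj_l2.
have ly : l2 y by exact: proj_l2.
have lxy := l2_add lx ly.
have [m [h1 h2 h3]] := proj_measure lxy.
have [m1 [h11 h12 h13]] := proj_measure lx.
have [m2 [h21 h22 h23]] := proj_measure ly.
have E : rip (addf x y) (T (addf x y)) = rip x (T x) + rip y (T y).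
  rewrite h3 h13 h23 /Rintegral.
  rewrite (eq_measure_integral (measure_add m1 m2)); last first.
    move=> A mA _; etransitivity; first exact: (h1 _ mA).
    etransitivity; last exact/esym/(measure_addE m1 m2 A).
    transitivity ((N2 (P A x))%:E + (N2 (P A y))%:E)%E; last first.
      by congr (_ + _)%E; [exact/esym/h11|exact/esym/h21].
    rewrite -EFinD; congr EFin.
    rewrite boundedD//; last exact: proj_bounded.
    have lA1 := proj_l2 mA lx; have lA2 := proj_l2 mA ly.
    rewrite N2D// (_ : rip (P A x) (P A y) = 0); first by rewrite mulr0 addr0.
    rewrite /rip proj_sym// proj_idem// /x proj_sym// -projI// proj_disj//.
    - exact: rip0.
    - exact: measurableI.
    - by rewrite setIC setIA setICl set0I.
  rewrite integral_measure_add// fineD//.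
  - exact: integrable_fin_num.
  - exact: integrable_fin_num.
move: E; rewrite boundedD// ripDr//; [|exact: bounded_l2..].
rewrite !ripDl//; [|exact: bounded_l2..].
rewrite (ripC y (T x)) /rip (symT lx ly) -/(rip _ _); lra.
Qed.

Lemma form_orthogonal_inner B u v : measurable B -> l2 u -> l2 v ->
  inner (P B u) (T (P (~` B) v)) = 0.
Proof.
move=> mB lu lv; have mC := measurableC mB; apply: complex_ext.
  exact: form_orthogonal.
rewrite inner_Im; [|exact: proj_l2|by apply: bounded_l2 => //; exact: proj_l2].
rewrite -boundedZ//; last exact: proj_l2.
rewrite -boundedZ//; last exact: proj_bounded.
by rewrite form_orthogonal//; exact: l2_scale.
Qed.

Lemma proj_ker B u : measurable B -> l2 u ->
  (forall w, l2 w -> inner (P B w) u = 0) -> P B u = (fun=> 0).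
Proof.
move=> mB lu h; apply: N2_eq0; first exact: proj_l2.
by rewrite /N2 proj_sym//; [rewrite proj_idem// -proj_sym// h|exact: proj_l2].
Qed.

(** [T] has no matrix elements between the ranges of [P B] and [P (~` B)]. *)
Lemma proj_commute B u : measurable B -> l2 u -> T (P B u) = P B (T u).
Proof.
move=> mB lu; have mC := measurableC mB.
have lB := proj_l2 mB lu; have lC := proj_l2 mC lu.
have lTB := bounded_l2 bT lB; have lTC := bounded_l2 bT lC.
rewrite [in RHS](proj_split mB lu) boundedD//.
rewrite boundedD//; last exact: proj_bounded.
rewrite [P B (T (P (~` B) u))]proj_ker//; last first.
  by move=> w lw; exact: form_orthogonal_inner.
rewrite [LHS](proj_split mB lTB) [P (~` B) (T _)]proj_ker// => w lw.
by have := form_orthogonal_inner mC lw lu; rewrite setCK.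
Qed.

(** The measure of a vector in the range of [P B] is carried by [B]. *)
Lemma form_ge B (c : R) u : measurable B -> (forall x, B x -> c <= x) -> l2 u ->
  c * N2 (P B u) <= rip (P B u) (T (P B u)).
Proof.
move=> mB Bc lu; have lB := proj_l2 mB lu; have mC := measurableC mB.
have [mu [h1 h2 h3]] := proj_measure lB.
have mu0 : mu (~` B) = 0%E.
  rewrite h1// proj_disj//; last by rewrite setICl.
  by rewrite /N2 -/(rip _ _) rip0//; exact: l2_zero.
have muB : fine (mu B) = N2 (P B u) by rewrite h1// proj_idem.
have iB : mu.-integrable B (fun x => (x : R)%:E).
  exact: (integrableS measurableT).
rewrite h3 /Rintegral (negligible_integral mC)// setTD setCK -/(Rintegral _ _ _).
rewrite -muB -Rintegral_cst//; apply: le_Rintegral => //.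
by apply: finite_measure_integrable_cst.
Qed.

Lemma form_le B (c : R) u : measurable B -> (forall x, B x -> x <= c) -> l2 u ->
  rip (P B u) (T (P B u)) <= c * N2 (P B u).
Proof.
move=> mB Bc lu; have lB := proj_l2 mB lu; have mC := measurableC mB.
have [mu [h1 h2 h3]] := proj_measure lB.
have mu0 : mu (~` B) = 0%E.
  rewrite h1// proj_disj//; last by rewrite setICl.
  by rewrite /N2 -/(rip _ _) rip0//; exact: l2_zero.
have muB : fine (mu B) = N2 (P B u) by rewrite h1// proj_idem.
have iB : mu.-integrable B (fun x => (x : R)%:E).
  exact: (integrableS measurableT).
rewrite h3 /Rintegral (negligible_integral mC)// setTD setCK -/(Rintegral _ _ _).
rewrite -muB -Rintegral_cst//; apply: le_Rintegral => //.
by apply: finite_measure_integrable_cst.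
Qed.

End SpectralMeasure.

(** * Mourre estimates as inequalities of quadratic forms *)

Section Mourre.
Context {R : realType} {I : choiceType}.
Local Notation fam := (fam R I).
Local Notation op := (op R I).
Implicit Types (u v w : fam) (T G : op) (B : set (measurableTypeR R)).

Definition symmetric_op T :=
  forall u v, l2 u -> l2 v -> inner (T u) v = inner u (T v).

Definition sub_scalar T (E : R) : op := fun u => subf (T u) (scalef (E%:C)%C u).

Lemma rip_sym T u v : symmetric_op T -> l2 u -> l2 v -> rip (T u) v = rip u (T v).
Proof. by move=> sT lu lv; rewrite /rip sT. Qed.

Lemma sub_scalar_l2 T E u : bounded_op T -> l2 u -> l2 (sub_scalar T E u).
Proof. by move=> bT lu; apply: l2_sub; [exact: bounded_l2|exact: l2_scale]. Qed.

Lemma sub_scalar_sym T E u v : bounded_op T -> symmetric_op T -> l2 u -> l2 v ->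
  rip (sub_scalar T E u) v = rip u (sub_scalar T E v).
Proof.
move=> bT sT lu lv; have lTu := bounded_l2 bT lu; have lTv := bounded_l2 bT lv.
have lz w : l2 w -> l2 (scalef (E%:C)%C w) by exact: l2_scale.
by rewrite /sub_scalar ripBl ?ripBr ?ripZl ?ripZr//; [rewrite rip_sym|exact: lz..].
Qed.

Lemma sub_scalarD T E u v : bounded_op T -> l2 u -> l2 v ->
  sub_scalar T E (addf u v) = addf (sub_scalar T E u) (sub_scalar T E v).
Proof.
move=> bT lu lv; rewrite /sub_scalar boundedD//; apply/funext => n.
by rewrite /subf /addf /scalef; ring.
Qed.

Lemma sub_scalarZ T E a u : bounded_op T -> l2 u ->
  sub_scalar T E (scalef a u) = scalef a (sub_scalar T E u).
Proof.
move=> bT lu; rewrite /sub_scalar (boundedZ _ bT lu); apply/funext => n.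
by rewrite /subf /scalef; ring.
Qed.

Lemma N2_bound T : bounded_op T ->
  exists2 g : R, 0 <= g & forall u, l2 u -> N2 (T u) <= g * N2 u.
Proof.
move=> bT; have [M M0 hM] := bounded_norm bT.
exists (M ^+ 2) => [|u lu]; first exact: sqr_ge0.
rewrite -!sqr_norm2//; last exact: bounded_l2.
by rewrite -exprMn ler_pXn2r ?nnegrE ?mulr_ge0 ?norm2_ge0// hM.
Qed.

(** The substitute for a Mourre estimate near [E]: [c <= G + M (T - E)^2] as
    quadratic forms.  It involves no spectral projection, and is polynomial in
    the operators. *)
Definition form_bound G T (E M c : R) :=
  forall u, l2 u -> c * N2 u <= rip u (G u) + M * N2 (sub_scalar T E u).

(** A bounded inverse of [T - E] would bound [T - E] away from zero. *)
Lemma spectrumP T (E : R) : bounded_op T ->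
  (forall c : R, 0 < c -> exists2 u, l2 u & N2 (sub_scalar T E u) < c * N2 u) ->
  spectrum T (E%:C)%C.
Proof.
move=> bT h [S [bS hS]]; have [g g0 hg] := N2_bound bS.
have g1 : 0 < g + 1 by rewrite ltr_wpDl.
have [|u lu] := h (g + 1)^-1; first by rewrite invr_gt0.
have := hg _ (sub_scalar_l2 E bT lu); have [-> _] := hS u lu => h1.
have := N2_ge0 (sub_scalar_l2 E bT lu).
rewrite -(ltr_pM2l g1) mulrA divff ?gt_eqF// mul1r; lra.
Qed.

Variables (T : op) (P : set (measurableTypeR R) -> op).
Hypothesis hP : spectral_measure T P.
Hypothesis bT : bounded_op T.
Hypothesis sT : symmetric_op T.

Local Notation S E := (sub_scalar T E).

Lemma sub_scalar_proj B E u : measurable B -> l2 u ->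
  S E (P B u) = P B (S E u).
Proof.
move=> mB lu; have bB := proj_bounded hP mB.
rewrite /sub_scalar boundedB//; [|exact: bounded_l2|exact: l2_scale].
by rewrite (boundedZ _ bB lu) (proj_commute hP bT sT).
Qed.

Lemma sub_scalar_form_ge B (E c : R) u : measurable B -> (forall x : R, B x -> c <= x) ->
  l2 u -> P B u = u -> (c - E) * N2 u <= rip u (S E u).
Proof.
move=> mB Bc lu pu; have := form_ge hP mB Bc lu; rewrite pu.
rewrite /sub_scalar ripBr ?ripZr ?ripN2//; [|exact: bounded_l2|exact: l2_scale].
by lra.
Qed.

Lemma sub_scalar_form_le B (E c : R) u : measurable B -> (forall x : R, B x -> x <= c) ->
  l2 u -> P B u = u -> rip u (S E u) <= (c - E) * N2 u.
Proof.
move=> mB Bc lu pu; have := form_le hP mB Bc lu; rewrite pu.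
rewrite /sub_scalar ripBr ?ripZr ?ripN2//; [|exact: bounded_l2|exact: l2_scale].
by lra.
Qed.

(** Put [S = T - E].  On the range of [P B] both [e - S] and [e + S] have
    nonnegative forms, hence so do their products with the squares
    [(e + S)^2] and [(e - S)^2]; the sum of these two products is
    [2 e (e^2 - S^2)]. *)
Lemma localized_small B (E e : R) u : measurable B -> 0 < e ->
  (forall x : R, B x -> E - e <= x <= E + e) -> l2 u -> P B u = u ->
  N2 (S E u) <= e ^+ 2 * N2 u.
Proof.
move=> mB e0 Be lu pu.
have bB := proj_bounded hP mB.
pose Y := S E u; pose Z := S E Y.
have lY : l2 Y by exact: sub_scalar_l2.
have lZ : l2 Z by exact: sub_scalar_l2.
have pY : P B Y = Y by rewrite -sub_scalar_proj// pu.
pose eu := scalef (e%:C)%C u.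
have leu : l2 eu by exact: l2_scale.
have peu : P B eu = eu by rewrite boundedZ// pu.
have lo w : l2 w -> P B w = w -> - e * N2 w <= rip w (S E w).
  move=> lw pw; have -> : - e = (E - e) - E by ring.
  by apply: (@sub_scalar_form_ge B) => // x /Be /andP[].
have hi w : l2 w -> P B w = w -> rip w (S E w) <= e * N2 w.
  move=> lw pw; have -> : e = (E + e) - E by ring.
  by apply: (@sub_scalar_form_le B) => // x /Be /andP[].
have Seu : S E eu = scalef (e%:C)%C Y by rewrite sub_scalarZ.
have leY : l2 (scalef (e%:C)%C Y) by exact: l2_scale.
have hN : N2 eu = e ^+ 2 * N2 u.
  by rewrite /eu N2Z// /nsq /= expr0n /= addr0.
have ruZ : rip u Z = N2 Y by rewrite /Z -sub_scalar_sym.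
have h1 : rip (addf eu Y) (S E (addf eu Y)) <= e * N2 (addf eu Y).
  by apply: hi; [exact: l2_add|rewrite boundedD// peu pY].
have h2 : - e * N2 (subf eu Y) <= rip (subf eu Y) (S E (subf eu Y)).
  by apply: lo; [exact: l2_sub|rewrite boundedB// peu pY].
move: h1 h2; rewrite subfE.
have lmY : l2 (scalef (-1) Y) by exact: l2_scale.
rewrite (sub_scalarD E bT leu lY) (sub_scalarD E bT leu lmY).
rewrite (sub_scalarZ _ _ bT lY) Seu -/Z -!subfE -/Y.
clearbody Z; clearbody Y.
have lS := l2_add leY lZ; have lD := l2_sub leY lZ.
rewrite N2D// N2B// ripBl// !ripBr// ripDl// !ripDr// hN /eu !ripZl// !ripZr// ?ripZl//.
rewrite !ripN2 ruZ => h1 h2.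
have : 2 * e * N2 Y <= 2 * e * (e ^+ 2 * N2 u) by lra.
by rewrite ler_pM2l// mulr_gt0.
Qed.

(** On an interval of half-width [e] the term [M (T - E)^2] is at most
    [M e^2], which is at most [c / 2] for small [e]. *)
Lemma localize_form_bound G (E M c : R) : bounded_op G -> symmetric_op G -> 0 < c ->
  form_bound G T E M c ->
  exists a b c' : R, [/\ a < E, E < b, 0 < c' &
    op_le (fun u => scalef (c'%:C)%C (P (`]a, b[%classic) u))
          (fun u => P (`]a, b[%classic) (G (P (`]a, b[%classic) u)))].
Proof.
move=> bG sG c0 h.
(* Small enough for e <= 1 and M e <= c / 2. *)
pose e := c / (2 * (`|M| + c + 1)).
have M0 := normr_ge0 M.
have d0 : 0 < 2 * (`|M| + c + 1) by lra.
have e0 : 0 < e by exact: divr_gt0.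
have e1 : e <= 1 by rewrite ler_pdivrMr// mul1r; lra.
have Me : `|M| * e ^+ 2 <= c / 2.
  apply: (@le_trans _ _ (`|M| * e)).
    by rewrite ler_wpM2l// expr2 ler_piMl// ltW.
  rewrite /e mulrA ler_pdivrMr//.
  have := mulr_ge0 (ltW c0) M0; have := mulr_ge0 (ltW c0) (ltW c0); lra.
exists (E - e), (E + e), (c / 2); split; [lra..|].
set B := `]_, _[%classic.
have mB : measurable (B : set (measurableTypeR R)) by exact: measurable_itv.
move=> u lu; set w := P B u.
have lw : l2 w by exact: (proj_l2 hP).
have pw : P B w = w by exact: (proj_idem hP).
rewrite innerZr// (inner_proj hP)// -/w -(proj_sym hP)//; last exact: bounded_l2.
rewrite -/w lecE; apply/andP; split.
  have := sG w w lw lw; rewrite (innerC w (G w)) => /(congr1 (@complex.Im R)).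
  rewrite cIm_conj => hI.
  have -> : complex.Im (((c / 2)%:C)%C * Complex (N2 w) 0) = 0.
    by rewrite cIm_mul /= mul0r mulr0 addr0.
  by apply/eqP; lra.
have -> : complex.Re (((c / 2)%:C)%C * Complex (N2 w) 0) = c / 2 * N2 w.
  by rewrite cRe_mul /= mul0r subr0.
rewrite -/(rip w (G w)); have := h w lw.
have sm : N2 (S E w) <= e ^+ 2 * N2 w.
  apply: (localized_small mB) => // x; rewrite /B /= in_itv /= => /andP[h1 h2].
  by rewrite !ltW.
have := N2_ge0 (sub_scalar_l2 E bT lw).
set n2 := N2 (S E w) in sm *; move=> n20.
have h1 : M * n2 <= `|M| * n2 by rewrite ler_wpM2r// ler_norm.
have h2 : `|M| * n2 <= `|M| * (e ^+ 2 * N2 w) by rewrite ler_wpM2l.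
have h3 : `|M| * (e ^+ 2 * N2 w) <= c / 2 * N2 w.
  by rewrite mulrA ler_wpM2r// N2_ge0.
lra.
Qed.

Lemma pythagoras B u : measurable B -> l2 u ->
  N2 u = N2 (P B u) + N2 (P (~` B) u).
Proof.
move=> mB lu; have mC := measurableC mB.
have lB := proj_l2 hP mB lu; have lC := proj_l2 hP mC lu.
rewrite {1}(proj_split hP mB lu) N2D// /rip (proj_sym hP)//.
rewrite (proj_disj hP)// ?setICr// -/(rip _ _) rip0//; ring.
Qed.

Lemma pythagoras3 (a b : R) u : a < b -> l2 u ->
  N2 u = N2 (P `]-oo, a]%classic u) + N2 (P `[b, +oo[%classic u)
       + N2 (P `]a, b[%classic u).
Proof.
move=> ab lu.
have mA : measurable (`]-oo, a]%classic : set (measurableTypeR R)) by exact: measurable_itv.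
have mB : measurable (`[b, +oo[%classic : set (measurableTypeR R)) by exact: measurable_itv.
have mC := measurableC mA; have lC := proj_l2 hP mC lu.
rewrite (pythagoras mA lu) (pythagoras mB lC) addrA.
rewrite -!(projI hP)//; last exact: measurableC.
congr (_ + N2 (P _ u) + N2 (P _ u)).
  apply/seteqP; split => x /=; rewrite !in_itv /= ?andbT; first by case.
  by move=> bx; split => //; apply/negP; rewrite -ltNge (lt_le_trans ab).
apply/seteqP; split => x /=; rewrite !in_itv /= ?andbT.
  by move=> [/negP + /negP]; rewrite -!ltNge => -> ->.
by move=> /andP[h1 h2]; split; apply/negP; rewrite -ltNge.
Qed.

(** Over a half-line at distance [r] from [E] the form of [T - E] is at least [r]
    in absolute value, so by Cauchy-Schwarz the norm is at least [r] too. *)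
Lemma outside_large B (E r : R) u : measurable B -> 0 < r -> l2 u ->
  (forall x : R, B x -> x <= E - r) \/ (forall x : R, B x -> E + r <= x) ->
  r ^+ 2 * N2 (P B u) <= N2 (P B (S E u)).
Proof.
move=> mB r0 lu hB; rewrite -sub_scalar_proj//.
have lw := proj_l2 hP mB lu; have pw := proj_idem hP mB lu.
set w := P B u in lw pw *.
have lz : l2 (S E w) by exact: sub_scalar_l2.
suff : r * N2 w <= `|rip w (S E w)|.
  have := rip_AMGM r0 lw lz.
  have := rip_AMGM r0 lw (l2_scale (-1) lz).
  rewrite N2Z// (_ : nsq (-1) = 1) ?mul1r; last first.
    by rewrite /nsq /= oppr0 expr0n /= addr0 sqrrN expr1n.
  rewrite /rip innerZr// mulN1r cRe_opp -/(rip _ _) => h1 h2 h3.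
  have : r * N2 w <= r^-1 * N2 (S E w).
    by move: h3; case: (ger0P (rip w (S E w))) => _; lra.
  rewrite -(ler_pM2l r0) mulVKf ?gt_eqF// => h4.
  by rewrite expr2 -mulrA.
case: hB => hB.
  have := sub_scalar_form_le E mB hB lw pw; rewrite addrAC subrr sub0r => h.
  by rewrite -normrN; apply: le_trans (ler_norm _); lra.
have := sub_scalar_form_ge E mB hB lw pw; rewrite addrAC subrr add0r => h.
exact: le_trans h (ler_norm _).
Qed.

(** Split [u = p + q] with [p] over the interval.  The form of [G] is positive
    on [p]; the remaining terms are bounded by multiples of the squared norm of
    [q], and these are paid for by [(T - E)^2], which is at least [r^2] on [q],
    [r] being the distance from [E] to the ends of the interval. *)
Lemma form_bound_of_localized G (E a b c : R) : bounded_op G -> symmetric_op G ->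
  a < E -> E < b -> 0 < c ->
  op_le (fun u => scalef (c%:C)%C (P (`]a, b[%classic) u))
        (fun u => P (`]a, b[%classic) (G (P (`]a, b[%classic) u))) ->
  exists M c' : R, 0 < c' /\ form_bound G T E M c'.
Proof.
move=> bG sG aE Eb c0 h; have [g g0 hg] := N2_bound bG.
pose r := Num.min (E - a) (b - E).
have r0 : 0 < r by rewrite lt_min !subr_gt0 aE.
(* K bounds the cross term and the form on q, by rip_AMGM with parameters c / 2
   and 1; g bounds the square of G. *)
pose K := 2 * g / c + (1 + g) / 2.
exists ((K + c / 2) / r ^+ 2), (c / 2); split; first by rewrite divr_gt0.
move=> u lu; set B := `]a, b[%classic.
have mB : measurable (B : set (measurableTypeR R)) by exact: measurable_itv.
have mC := measurableC mB.
pose p := P B u; pose q := P (~` B) u.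
have lp : l2 p by exact: (proj_l2 hP).
have lq : l2 q by exact: (proj_l2 hP).
have lGp := bounded_l2 bG lp; have lGq := bounded_l2 bG lq.
have hp : c * N2 p <= rip p (G p).
  have := h u lu; rewrite innerZr// (inner_proj hP)// -/B -/p.
  rewrite -(proj_sym hP)//; rewrite -/B -/p lecE => /andP[_].
  by rewrite cRe_mul /= mul0r subr0.
have Eu := pythagoras mB lu; rewrite -/p -/q in Eu.
have hq : r ^+ 2 * N2 q <= N2 (S E u).
  have ab := lt_trans aE Eb.
  have lS := sub_scalar_l2 E bT lu.
  have := pythagoras3 ab lu; have := pythagoras3 ab lS.
  have mA1 : measurable (`]-oo, a]%classic : set (measurableTypeR R)) by exact: measurable_itv.
  have mA2 : measurable (`[b, +oo[%classic : set (measurableTypeR R)) by exact: measurable_itv.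
  have := @outside_large _ E r u mA1 r0 lu; have := @outside_large _ E r u mA2 r0 lu.
  have -> : N2 q = N2 u - N2 p by rewrite Eu; ring.
  rewrite -/B -/p => h1 h2 E1 E2.
  have {}h1 := h1 (or_intror _); have {}h2 := h2 (or_introl _).
  have N0 := N2_ge0 (proj_l2 hP mB lS).
  rewrite E1 E2.
  have {}h1 : r ^+ 2 * N2 (P `[b, +oo[%classic u) <= N2 (P `[b, +oo[%classic (S E u)).
    apply: h1 => x /=; rewrite in_itv /= andbT; apply: le_trans.
    have : r <= b - E by rewrite ge_min lexx orbT.
    lra.
  have {}h2 : r ^+ 2 * N2 (P `]-oo, a]%classic u) <= N2 (P `]-oo, a]%classic (S E u)).
    apply: h2 => x /=; rewrite in_itv /= => xa; apply: (le_trans xa).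
    have : r <= E - a by rewrite ge_min lexx.
    lra.
  lra.
have r20 : 0 < r ^+ 2 by rewrite exprn_gt0.
have lz := sub_scalar_l2 E bT lu.
have E1 : rip u (G u) = rip p (G p) + 2 * rip p (G q) + rip q (G q).
  rewrite (proj_split hP mB lu) -/p -/q boundedD//.
  have lGG := l2_add lGp lGq.
  rewrite ripDl// !ripDr// -(rip_sym sG lp lq) (ripC (G p) q); ring.
have c20 : 0 < c / 2 by lra.
have h1 := rip_AMGM c20 lp (l2_scale (-1) lGq).
have h2 := rip_AMGM ltr01 lq (l2_scale (-1) lGq).
move: h1 h2; rewrite !N2Z// (_ : nsq (-1) = 1) ?mul1r; last first.
  by rewrite /nsq /= oppr0 expr0n /= addr0 sqrrN expr1n.
rewrite /rip !innerZr// !mulN1r !cRe_opp -!/(rip _ _) invf_div invr1 mul1r => h1 h2.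
have hGq := hg q lq.
have h3 : 2 / c * N2 (G q) <= 2 / c * (g * N2 q).
  by rewrite ler_wpM2l// divr_ge0// ltW.
have K0 : 0 <= K + c / 2.
  rewrite /K !addr_ge0 ?divr_ge0 ?mulr_ge0 ?addr_ge0//; exact: ltW.
have h4 : (K + c / 2) * N2 q <= (K + c / 2) / r ^+ 2 * N2 (S E u).
  rewrite -mulrA ler_wpM2l// mulrC ler_pdivlMr// mulrC; exact: hq.
have h5 : K * N2 q = 2 / c * (g * N2 q) + (N2 q + g * N2 q) / 2.
  by rewrite /K; field; rewrite gt_eqF.
move: h4; rewrite E1 Eu mulrDl h5; lra.
Qed.

End Mourre.

(** * Laurent operators and their symbols *)

Section Laurent.
Context {R : realType} {d : nat}.
Local Notation C := R[i].
Local Notation Zd := 'rV[int]_d.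
Local Notation fam := (fam R Zd).
Local Notation op := (op R Zd).
Implicit Types (u v w : fam) (l : seq (C * Zd)) (z : 'I_d -> C) (m n : Zd).

Definition translate m : op := fun u n => u (n - m).

Lemma translate_bij m : bijective (fun n : Zd => n - m).
Proof. by exists (fun n => n + m) => n; rewrite ?subrK ?addrK. Qed.

Lemma l2_translate m u : l2 u -> l2 (translate m u).
Proof.
move=> /l2P lu; apply/l2P.
exact: (asum_reindex (translate_bij m) lu).
Qed.

Lemma N2_translate m u : N2 (translate m u) = N2 u.
Proof.
rewrite /N2 /inner /csum /=.
exact: (rsum_reindex (fun n => complex.Re ((u n)^*%C * u n)) (translate_bij m)).
Qed.

Lemma inner_translate m u v : inner (translate m u) v = inner u (translate (- m) v).
Proof.
rewrite /inner /csum; congr Complex.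
  rewrite -[RHS](rsum_reindex _ (translate_bij m)); congr rsum.
  by apply/funext => n; rewrite /translate opprK subrK.
rewrite -[RHS](rsum_reindex _ (translate_bij m)); congr rsum.
by apply/funext => n; rewrite /translate opprK subrK.
Qed.

(** A finite combination of translations, encoded by a list of coefficients and
    displacements.  Displacements may repeat, so that sums and products of
    operators are concatenations and products of lists. *)
Definition laurent_op l : op := fun u n => \sum_(p <- l) p.1 * u (n - p.2).

Lemma laurent_op_nil u : laurent_op [::] u = (fun=> 0).
Proof. by apply/funext => n; rewrite /laurent_op big_nil. Qed.

Lemma laurent_op_cons p l u :
  laurent_op (p :: l) u = addf (scalef p.1 (translate p.2 u)) (laurent_op l u).
Proof. by apply/funext => n; rewrite /laurent_op big_cons. Qed.

Lemma laurent_op_bounded l : bounded_op (laurent_op l).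
Proof.
have L u : l2 u -> l2 (laurent_op l u).
  move=> lu; elim: l => [|p l IH]; first by rewrite laurent_op_nil; exact: l2_zero.
  by rewrite laurent_op_cons; apply: l2_add => //; apply/l2_scale/l2_translate.
split=> //.
  move=> a u v lu lv; apply/funext => n; rewrite /laurent_op /addf /scalef.
  rewrite mulr_sumr -big_split /=; apply: eq_bigr => p _; ring.
exists (\sum_(p <- l) Num.sqrt (nsq p.1)) => u lu.
elim: l {L} => [|p l IH].
  rewrite laurent_op_nil big_nil mul0r /norm2.
  have -> : (fun=> 0) = scalef 0 u by apply/funext => n; rewrite /scalef mul0r.
  by rewrite innerZl//; [rewrite rmorph0 mul0r sqrtr0|exact: l2_scale].
rewrite laurent_op_cons big_cons mulrDl.
have lt := l2_translate p.2 lu.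
have ll : l2 (laurent_op l u).
  elim: l {IH} => [|q l IH]; first by rewrite laurent_op_nil; exact: l2_zero.
  by rewrite laurent_op_cons; apply: l2_add => //; apply/l2_scale/l2_translate.
apply: le_trans (norm2D (l2_scale _ lt) ll) _; apply: lerD => //.
by rewrite norm2Z// !norm2E N2_translate.
Qed.

Lemma laurent_op_l2 l u : l2 u -> l2 (laurent_op l u).
Proof. exact: (bounded_l2 (laurent_op_bounded l)). Qed.

Definition laurent_adj l := [seq ((p.1)^*%C, - p.2) | p <- l].

Lemma inner_laurent_op l u v : l2 u -> l2 v ->
  inner (laurent_op l u) v = inner u (laurent_op (laurent_adj l) v).
Proof.
move=> lu lv; elim: l => [|p l IH] /=.
  rewrite !laurent_op_nil.
  have E w : (fun=> 0) = scalef 0 w :> fam.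
    by apply/funext => n; rewrite /scalef mul0r.
  by rewrite [in LHS](E u) [in RHS](E v) innerZl// innerZr// rmorph0 !mul0r.
rewrite !laurent_op_cons /=.
have lt := l2_translate p.2 lu; have lt' := l2_translate (- p.2) lv.
rewrite innerDl ?innerDr//; [|exact: l2_scale|exact: laurent_op_l2..|exact: l2_scale|exact: laurent_op_l2].
by rewrite IH innerZl// innerZr// inner_translate.
Qed.

Definition laurent_mul l1 l2 : seq (C * Zd) :=
  [seq (p.1 * q.1, p.2 + q.2) | p <- l1, q <- l2].

Lemma laurent_op_mul l1 l2 u :
  laurent_op (laurent_mul l1 l2) u = laurent_op l1 (laurent_op l2 u).
Proof.
apply/funext => n; rewrite /laurent_op /laurent_mul big_allpairs_dep.
apply: eq_bigr => p _; rewrite mulr_sumr; apply: eq_bigr => q _ /=.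
by rewrite mulrA opprD addrA.
Qed.

Lemma laurent_op_cat l1 l2 u :
  laurent_op (l1 ++ l2) u = addf (laurent_op l1 u) (laurent_op l2 u).
Proof. by apply/funext => n; rewrite /laurent_op big_cat. Qed.

Lemma laurent_op_comm l1 l2 u :
  laurent_op l1 (laurent_op l2 u) = laurent_op l2 (laurent_op l1 u).
Proof.
apply/funext => n; rewrite /laurent_op.
under eq_bigr do rewrite mulr_sumr.
rewrite exchange_big /=; apply: eq_bigr => q _; rewrite mulr_sumr.
by apply: eq_bigr => p _; rewrite mulrCA -!addrA (addrC (- p.2)).
Qed.

Lemma laurent_op_finsupp l u : finsupp u -> finsupp (laurent_op l u).
Proof.
move=> /finsupp_seq[s us u0].
apply: (@seq_finsupp _ _ _ [seq q + p.2 | q <- s, p <- l]) => n ns.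
rewrite /laurent_op big_seq big1// => p pl; rewrite u0 ?mulr0//.
apply: contra ns => h; apply/allpairsP; exists (n - p.2, p) => /=.
by split => //; rewrite subrK.
Qed.

Definition torus z := forall j, nsq (z j) = 1.

(** The plane wave, or character, of the lattice at the point [z] of the torus. *)
Definition chi z n : C := \prod_j z j ^ n 0 j.

Lemma torus_neq0 z j : torus z -> z j != 0.
Proof.
move=> tz; apply/eqP => z0; have := tz j.
by rewrite z0 /nsq /= expr0n /= addr0 => /esym/eqP; rewrite oner_eq0.
Qed.

Lemma torus_conj z j : torus z -> (z j)^*%C = (z j)^-1.
Proof.
move=> tz; apply: (mulIf (torus_neq0 j tz)).
by rewrite mulVf ?torus_neq0// conjM_nsq tz.
Qed.

Lemma chiD z m n : torus z -> chi z (m + n) = chi z m * chi z n.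
Proof.
move=> tz; rewrite /chi -big_split; apply: eq_bigr => j _.
by rewrite mxE expfzDr ?torus_neq0.
Qed.

Lemma chi0 z : chi z 0 = 1.
Proof. by rewrite /chi big1// => j _; rewrite mxE expr0z. Qed.

Lemma conjc_exprz (x : C) (k : int) : ((x ^ k)^*)%C = ((x^*)%C) ^ k.
Proof. by case: k => k; rewrite /exprz ?conjc_inv rmorphXn. Qed.

Lemma chi_conj z n : torus z -> (chi z n)^*%C = chi z (- n).
Proof.
move=> tz; rewrite /chi; transitivity (\prod_j ((z j ^ n 0 j)^*)%C).
  exact: rmorph_prod.
by apply: eq_bigr => j _; rewrite mxE conjc_exprz torus_conj// exprz_inv.
Qed.

Lemma nsq_chi z n : torus z -> (chi z n)^*%C * chi z n = 1.
Proof. by move=> tz; rewrite chi_conj// -chiD// addNr chi0. Qed.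

(** The plane wave [chi z] is a generalized eigenfunction of [laurent_op l], and
    this is its eigenvalue: translating by [m] multiplies it by
    [chi z (- m)]. *)
Definition symbol l z : C := \sum_(p <- l) p.1 * chi z (- p.2).

Lemma symbol_cat l1 l2 z : symbol (l1 ++ l2) z = symbol l1 z + symbol l2 z.
Proof. by rewrite /symbol big_cat. Qed.

Lemma symbol_mul l1 l2 z : torus z ->
  symbol (laurent_mul l1 l2) z = symbol l1 z * symbol l2 z.
Proof.
move=> tz; rewrite /symbol /laurent_mul big_allpairs_dep mulr_suml.
apply: eq_bigr => p _; rewrite mulr_sumr; apply: eq_bigr => q _ /=.
by rewrite opprD chiD//; ring.
Qed.

Lemma symbol_adj l z : torus z -> symbol (laurent_adj l) z = (symbol l z)^*%C.
Proof.
move=> tz; rewrite /symbol big_map rmorph_sum; apply: eq_bigr => p _ /=.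
by rewrite rmorphM /= chi_conj.
Qed.

(** Commuting with a position operator acts on Laurent operators as a
    derivation; [laurent_position] and [symbol_der_mul] make this precise. *)
Definition laurent_der j l : seq (C * Zd) :=
  [seq (p.1 * (p.2 0 j)%:~R, p.2) | p : C * Zd <- l].

Lemma laurent_position j l u :
  laurent_op l (position j u) =
  subf (position j (laurent_op l u)) (laurent_op (laurent_der j l) u).
Proof.
apply/funext => n; rewrite /subf /position /laurent_op big_map mulr_sumr -sumrB.
by apply: eq_bigr => p _ /=; rewrite !mxE intrD intrN; ring.
Qed.

Lemma symbol_der_mul j l1 l2 z : torus z ->
  symbol (laurent_der j (laurent_mul l1 l2)) z =
  symbol (laurent_der j l1) z * symbol l2 z + symbol l1 z * symbol (laurent_der j l2) z.
Proof.
move=> tz; rewrite /symbol !big_map /laurent_mul big_allpairs_dep /=.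
rewrite !mulr_suml -big_split /=; apply: eq_bigr => p _.
rewrite !mulr_sumr -big_split /=; apply: eq_bigr => q _ /=.
by rewrite mxE intrD opprD chiD//; ring.
Qed.

End Laurent.

(** * Positivity of Laurent operators *)

Section PrimRoot.
Context {R : realType}.

Lemma prim_root_exists (N : nat) : (0 < N)%N ->
  exists w : R[i], N.-primitive_root w.
Proof.
move=> N0; pose p : {poly R[i]} := 'X^N - 1.
have [r Dp] := closed_field_poly_normal p.
rewrite (monicP _) ?monicXnsubC // scale1r in Dp.
have rn1 : all N.-unity_root r by apply/allP=> z; rewrite -root_prod_XsubC -Dp.
have sz_r : (N < (size r).+1)%N by rewrite -(size_prod_XsubC r id) -Dp size_XnsubC.
have ur : uniq r.
  rewrite -separable.separable_prod_XsubC -Dp cyclotomic.separable_Xn_sub_1//.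
  by rewrite pnatr_eq0 -lt0n.
have /hasP[z _ hz] := cyclic.has_prim_root N0 rn1 ur sz_r.
by exists z.
Qed.

Lemma prim_root_nsq (N : nat) (w : R[i]) : (0 < N)%N -> N.-primitive_root w ->
  nsq w = 1.
Proof.
move=> N0 pw; have w0 : 0 <= nsq w by exact: nsq_ge0.
have H k : nsq (w ^+ k) = nsq w ^+ k.
  elim: k => [|k IH]; first by rewrite !expr0 /nsq /= expr0n /= addr0 expr1n.
  by rewrite !exprS nsqM IH.
have := H N; rewrite (prim_expr_order pw).
rewrite {1}/nsq /= expr0n /= addr0 expr1n => /esym/eqP.
by rewrite pexpr_eq1// => /eqP.
Qed.

(** A geometric sum, with ratio [w ^ q] different from [1] unless [q = 0]. *)
Lemma prim_root_sum (N : nat) (w : R[i]) (q : int) : (0 < N)%N ->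
  N.-primitive_root w -> (`|q| < N)%N ->
  \sum_(i < N) (w ^+ i) ^ q = if q == 0 then N%:R else 0.
Proof.
move=> N0 pw qN.
have w0 : w != 0.
  apply/eqP => w0; have := prim_expr_order pw.
  by rewrite w0 expr0n gtn_eqF// => /esym/eqP; rewrite oner_eq0.
case: eqP => [->|/eqP q0].
  by rewrite (eq_bigr (fun=> 1)) ?sumr_const ?card_ord// => i _; rewrite expr0z.
have E (i : 'I_N) : (w ^+ i) ^ q = (w ^ q) ^+ i.
  by rewrite !exprnP !exprz_exp mulrC.
under eq_bigr do rewrite E.
have wq1 : w ^ q != 1.
  have dvd (k : nat) : (0 < k < N)%N -> w ^+ k != 1.
    move=> /andP[k0 kN]; rewrite -(prim_order_dvd pw).
    by apply/negP => /(dvdn_leq k0); rewrite leqNgt kN.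
  case: q q0 qN {E} => k /= q0 qN.
    by apply: dvd; rewrite qN andbT lt0n.
  by rewrite NegzE -exprnN invr_eq1 dvd.
have : (w ^ q) ^+ N - 1 = 0.
  by rewrite exprnP exprz_exp mulrC -exprz_exp -exprnP (prim_expr_order pw) exp1rz subrr.
rewrite subrX1 => /eqP; rewrite mulf_eq0 subr_eq0 (negbTE wq1) /=.
by move=> /eqP.
Qed.

End PrimRoot.

Section Toeplitz.
Context {R : realType} {d : nat}.
Local Notation C := R[i].
Local Notation Zd := 'rV[int]_d.
Local Notation fam := (fam R Zd).
Local Notation op := (op R Zd).
Implicit Types (u v w : fam) (l : seq (C * Zd)) (z : 'I_d -> C) (m n : Zd).

(** Orthogonality of the characters of the finite torus of side [N]. *)
Lemma chi_sum (N : nat) (w : C) n : (0 < N)%N -> N.-primitive_root w ->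
  (forall j, (absz (n 0%R j) < N)%N) ->
  \sum_(f : {ffun 'I_d -> 'I_N}) chi (fun j => w ^+ f j) n =
  if n == 0 then N%:R ^+ d else 0.
Proof.
move=> N0 pw nN; rewrite /chi.
rewrite -(bigA_distr_bigA (fun j i => (w ^+ (i : 'I_N)) ^ n 0 j)) /=.
under eq_bigr do rewrite (prim_root_sum N0 pw (nN _)).
case: eqP => [->|/eqP n0].
  by rewrite (eq_bigr (fun=> N%:R)) ?prodr_const ?card_ord// => j _; rewrite mxE eqxx.
have [j nj] : exists j, n 0 j != 0.
  apply/existsP; apply: contraNT n0; rewrite negb_exists => /forallP h.
  by apply/eqP/rowP => j; have := h j; rewrite negbK => /eqP ->; rewrite mxE.
by rewrite (bigD1 j)//= (negbTE nj) mul0r.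
Qed.

(** Choose [N] so large that no nonzero displacement occurring in the form
    vanishes modulo [N].  Then [N ^ d] times the form of [u] is the sum,
    over the [N]-th roots of unity in the torus, of the symbol times the squared
    modulus of the discrete Fourier transform of [u]. *)
Lemma toeplitz_pos_fin l u : (forall z, torus z -> 0 <= complex.Re (symbol l z)) ->
  finsupp u -> 0 <= rip u (laurent_op l u).
Proof.
move=> lpos /finsupp_seq[s us u0].
pose bnd (n : Zd) := (\sum_j absz (n 0%R j))%N.
(* A crude bound: every coordinate of every displacement is one of the terms. *)
pose N := (\sum_(n <- s) \sum_(n' <- s) \sum_(p <- l) bnd (n - n' - p.2)%R).+1.
have N0 : (0 < N)%N by [].
have hN n n' p j : n \in s -> n' \in s -> p \in l -> (absz ((n - n' - p.2)%R 0%R j) < N)%N.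
  move=> sn sn' pl; rewrite /N ltnS.
  rewrite (big_rem n sn) (big_rem n' sn') (big_rem p pl) /=.
  apply: (@leq_trans (bnd (n - n' - p.2)%R)).
    by rewrite /bnd (bigD1 j)//= leq_addr.
  by rewrite -!addnA leq_addr.
have [w pw] := prim_root_exists (R := R) N0.
pose zf (f : {ffun 'I_d -> 'I_N}) := fun j => w ^+ f j.
have tz f : torus (zf f).
  move=> j; rewrite /zf; elim: (f j : nat) => [|k IH].
    by rewrite expr0 /nsq /= expr0n /= addr0 expr1n.
  by rewrite exprS nsqM IH (prim_root_nsq N0 pw) mul1r.
pose uh z := \sum_(n <- s) chi z (- n) * u n.
have E z : torus z -> symbol l z * ((uh z)^*%C * uh z) =
    \sum_(p <- l) \sum_(n <- s) \sum_(n' <- s)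
      (p.1 * ((u n)^*%C * u n')) * chi z (n - n' - p.2).
  move=> t; rewrite /symbol mulr_suml; apply: eq_bigr => p _.
  rewrite /uh rmorph_sum mulr_suml mulr_sumr; apply: eq_bigr => n _.
  rewrite !mulr_sumr; apply: eq_bigr => n' _.
  have e : ((chi z (- n) * u n)^*)%C = chi z n * ((u n)^*)%C.
    by rewrite rmorphM /= chi_conj// opprK.
  transitivity (p.1 * chi z (- p.2) * (chi z n * ((u n)^*)%C * (chi z (- n') * u n'))).
    by rewrite -e.
  by rewrite !chiD//; ring.
have S : \sum_(f : {ffun 'I_d -> 'I_N}) symbol l (zf f) * ((uh (zf f))^*%C * uh (zf f))
   = N%:R ^+ d * inner u (laurent_op l u).
  under eq_bigr do rewrite E//.
  rewrite exchange_big /= (inner_fin _ us u0).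
  have -> : \sum_(n <- s) (u n)^*%C * laurent_op l u n =
     \sum_(p <- l) \sum_(n <- s) p.1 * ((u n)^*%C * u (n - p.2)).
    rewrite exchange_big /=; apply: eq_bigr => n _; rewrite /laurent_op mulr_sumr.
    by apply: eq_bigr => p _; ring.
  rewrite mulr_sumr; apply: eq_big_seq => p pl.
  rewrite exchange_big mulr_sumr; apply: eq_big_seq => n sn.
  rewrite exchange_big /=.
  transitivity (\sum_(n' <- s) (p.1 * ((u n)^*%C * u n')) *
      (if n - n' - p.2 == 0 then N%:R ^+ d else 0)).
    apply: eq_big_seq => n' sn'; rewrite -mulr_sumr.
    by rewrite (chi_sum N0 pw)// => j; exact: hN.
  have [ns|ns] := boolP (n - p.2 \in s).
    rewrite (bigD1_seq (n - p.2))//= big1 ?addr0.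
      by rewrite opprB addrCA subrr addr0 subrr eqxx; ring.
    move=> n' nn'; rewrite (_ : (_ == 0) = false) ?mulr0//.
    apply/negbTE; apply: contra nn'; rewrite subr_eq0 => /eqP e.
    by rewrite -e opprB addrCA subrr addr0.
  rewrite (u0 _ ns) !mulr0 big_seq big1// => n' sn'.
  rewrite (_ : (_ == 0) = false) ?mulr0//.
  apply/negbTE; apply: contra ns; rewrite subr_eq0 => /eqP e.
  by rewrite -e opprB addrCA subrr addr0.
have Np : 0 < N%:R ^+ d :> R by rewrite exprn_gt0// ltr0n.
rewrite -(pmulr_rge0 _ Np).
have -> : N%:R ^+ d * rip u (laurent_op l u) =
    complex.Re (N%:R ^+ d * inner u (laurent_op l u)).
  have -> : (N%:R ^+ d : C) = ((N%:R ^+ d : R)%:C)%C by rewrite rmorphXn rmorph_nat.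
  by rewrite cRe_mul /= mul0r subr0.
rewrite -S (big_morph (@complex.Re R) (@cRe_add R) erefl).
apply: sumr_ge0 => f _; rewrite conjM_nsq cRe_mul mulr0 subr0.
by rewrite mulr_ge0 ?nsq_ge0// lpos.
Qed.

Lemma toeplitz_pos l u : (forall z, torus z -> 0 <= complex.Re (symbol l z)) ->
  l2 u -> 0 <= rip u (laurent_op l u).
Proof.
move=> lpos lu; have [u_ fu cu] := density_seq lu.
have lu_ (m : nat) := l2_fin (fu m).
have bl := laurent_op_bounded l.
have c := rip_cvg lu (bounded_l2 bl lu) lu_ (fun m : nat => bounded_l2 bl (lu_ m)) cu
  (bounded_cvg bl lu lu_ cu).
rewrite -(cvg_lim _ c)//; apply: limr_ge.
  by apply/cvg_ex; exists (rip u (laurent_op l u)).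
by near=> m; exact: toeplitz_pos_fin.
Unshelve. all: by end_near. Qed.

(** The points of the cube of side [N], indexed by the finite functions over
    which [bigA_distr_bigA] distributes products. *)
Definition vec N (f : {ffun 'I_d -> 'I_N}) : Zd := \row_j (f j : nat)%:Z.

Lemma vec_inj N : injective (@vec N).
Proof.
move=> f g /rowP h; apply/ffunP => j; apply: val_inj.
by have := h j; rewrite !mxE => -[].
Qed.

Definition in_range (N : nat) (a : int) : bool := (0 <= a) && (a < N%:Z).

Definition in_cube N n : bool := [forall j, in_range N (n 0 j)].

Lemma in_cubeP N n : reflect (exists f : {ffun 'I_d -> 'I_N}, n = vec f) (in_cube N n).
Proof.
apply: (iffP forallP) => [h|[f ->] j]; last first.
  by rewrite mxE /in_range lez_nat ltz_nat ltn_ord.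
have hj j : exists i : 'I_N, n 0 j = (i : nat)%:Z.
  have /andP[h1 h2] := h j.
  have k : (absz (n 0%R j) < N)%N by rewrite -ltz_nat gez0_abs.
  by exists (Ordinal k); rewrite /= gez0_abs.
have [f hf] := choice hj; exists [ffun j => f j].
by apply/rowP => j; rewrite mxE ffunE hf.
Qed.

Definition truncated_wave N z : fam := fun n => if in_cube N n then chi z n else 0.

(** A shift by [a] pushes at most [|a|] points out of an interval. *)
Lemma in_range_count (N : nat) (a : int) :
  (N%:R - (absz a)%:R : R) <= \sum_(i < N) (in_range N (i%:Z - a))%:R <= (N%:R : R).
Proof.
apply/andP; split; last first.
  have -> : (N%:R : R) = \sum_(i < N) 1 by rewrite sumr_const card_ord.
  by apply: ler_sum => i _; case: in_range.
rewrite -natr_sum lerBlDr -natrD ler_nat.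
case: a => k.
  rewrite (eq_bigr (fun i : 'I_N => (k <= i)%N : nat)); last first.
    by move=> i _; rewrite /in_range; have := ltn_ord i; lia.
  have H M : (M <= \sum_(i < M) (k <= i)%N + k)%N.
    elim: M => // M; rewrite big_ord_recr /=.
    by set T := (X in (_ <= X + k)%N -> _); case: leqP => /= h1 h2; lia.
  exact: H.
rewrite (eq_bigr (fun i : 'I_N => (i + k.+1 < N)%N : nat)); last first.
  by move=> i _; rewrite /in_range; have := ltn_ord i; lia.
have H M : (minn M (N - k.+1) <= \sum_(i < M) (i + k.+1 < N))%N.
  elim: M => [|M]; first by rewrite min0n.
  rewrite big_ord_recr /=; set T := (\sum_(i < M) _)%N.
  by case: ltnP => /= h1 h2; lia.
have := H N; set T := (\sum_(i < N) _)%N => h; rewrite /absz; lia.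
Qed.

(** The fraction of the cube of side [N] that stays in the cube when translated
    by [- m]; it factors over the coordinates. *)
Definition overlap N m : R := \prod_j ((\sum_(i < N) (in_range N (i%:Z - m 0 j))%:R) / N%:R).

Lemma truncated_wave_form N l z : torus z -> (0 < N)%N ->
  inner (truncated_wave N z) (laurent_op l (truncated_wave N z)) =
  ((N%:R ^+ d)%:C)%C * \sum_(p <- l) p.1 * chi z (- p.2) * ((overlap N p.2)%:C)%C.
Proof.
move=> tz N0; set u := truncated_wave N z.
pose s := [seq vec f | f <- enum {: {ffun 'I_d -> 'I_N}}].
have us : uniq s by rewrite map_inj_uniq ?enum_uniq//; exact: vec_inj.
have u0 n : n \notin s -> u n = 0.
  rewrite /u /truncated_wave; case: in_cubeP => // -[f ->].
  by rewrite map_f// mem_enum.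
rewrite (inner_fin _ us u0) /laurent_op.
under eq_bigr do rewrite mulr_sumr.
rewrite exchange_big mulr_sumr; apply: eq_bigr => p _ /=.
rewrite /s big_map big_enum /=.
transitivity (\sum_(f : {ffun 'I_d -> 'I_N})
    p.1 * chi z (- p.2) * ((\prod_j ((in_range N ((f j : nat)%:Z - p.2 0 j))%:R : R))%:C)%C).
  apply: eq_bigr => f _; rewrite /u /truncated_wave.
  have -> : in_cube N (vec f) by apply/in_cubeP; exists f.
  case: (boolP (in_cube N (vec f - p.2))) => [/forallP h|].
    rewrite big1; last by move=> j _; have := h j; rewrite !mxE => ->.
    rewrite chiD// rmorph1 mulr1.
    transitivity (((chi z (vec f))^*%C * chi z (vec f)) * (p.1 * chi z (- p.2))).
      by ring.
    by rewrite nsq_chi// mul1r.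
  rewrite negb_forall => /existsP[j /negbTE]; rewrite !mxE => hj.
  by rewrite (bigD1 j)//= hj mul0r rmorph0 !mulr0.
rewrite -mulr_sumr -rmorph_sum /=.
rewrite -(bigA_distr_bigA (fun j i => (in_range N ((i : 'I_N)%:Z - p.2 0 j))%:R)) /=.
rewrite mulrCA; congr (_ * _); rewrite -rmorphM; congr ((_)%:C)%C.
rewrite /overlap prodf_div prodr_const card_ord mulrC divfK//.
by rewrite expf_neq0// pnatr_eq0 -lt0n.
Qed.

Lemma overlap_cvg m : (fun N => overlap N.+1 m) @ \oo --> (1 : R).
Proof.
have H (a : int) : (fun N : nat => (\sum_(i < N.+1) (in_range N.+1 (i%:Z - a))%:R) / N.+1%:R : R)
    @ \oo --> (1 : R).
  apply: (@squeeze_cvgr _ _ _ _ (fun N : nat => 1 - (absz a)%:R * N.+1%:R^-1) (fun=> 1)).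
  - near=> N; have /andP[h1 h2] := in_range_count N.+1 a.
    have N0 : 0 < N.+1%:R :> R by rewrite ltr0n.
    rewrite ler_pdivrMr// mul1r h2 andbT ler_pdivlMr// mulrBl mul1r.
    by rewrite divfK// gt_eqF.
  - rewrite -[X in _ --> X](subr0 1); apply: cvgB; first exact: cvg_cst.
    rewrite -[X in _ --> X](mulr0 (absz a)%:R); apply: cvgM; first exact: cvg_cst.
    exact: cvg_harmonic.
  - exact: cvg_cst.
have -> : (1 : R) = \prod_(j < d) 1 by rewrite big1.
by apply: cvg_big => //; exact: mul_continuous.
Unshelve. all: by end_near. Qed.

(** The form of a plane wave cut off to a cube, divided by the volume of the
    cube, is the symbol up to the factors [overlap], which tend to [1]. *)
Lemma toeplitz_symbol l z : torus z ->
  (forall u, finsupp u -> 0 <= rip u (laurent_op l u)) ->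
  0 <= complex.Re (symbol l z).
Proof.
move=> tz h.
pose a N := \sum_(p <- l) complex.Re (p.1 * chi z (- p.2)) * overlap N.+1 p.2.
have c : a N @[N --> \oo] --> complex.Re (symbol l z).
  rewrite /symbol (big_morph (@complex.Re R) (@cRe_add R) erefl).
  apply: cvg_big => //; first exact: add_continuous.
  move=> p _; rewrite -[X in _ --> X]mulr1; apply: cvgM; first exact: cvg_cst.
  exact: overlap_cvg.
rewrite -(cvg_lim _ c)//; apply: limr_ge.
  by apply/cvg_ex; exists (complex.Re (symbol l z)).
near=> N; have N0 : (0 < N.+1)%N by [].
have /h : finsupp (truncated_wave N.+1 z).
  apply: (@seq_finsupp _ _ _ [seq vec f | f <- enum {: {ffun 'I_d -> 'I_N.+1}}]).
  move=> n; rewrite /truncated_wave; case: in_cubeP => // -[f ->].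
  by rewrite map_f// mem_enum.
rewrite /rip truncated_wave_form// cRe_mul mul0r subr0 /=.
rewrite pmulr_rge0 ?exprn_gt0 ?ltr0n//.
rewrite (big_morph (@complex.Re R) (@cRe_add R) erefl).
by under eq_bigr do rewrite cRe_mul /= mulr0 subr0.
Unshelve. all: by end_near. Qed.

End Toeplitz.

(** * The commutator with the conjugate operator *)

Section Commutator.
Context {R : realType} {d : nat}.
Local Notation C := R[i].
Local Notation Zd := 'rV[int]_d.
Local Notation fam := (fam R Zd).
Local Notation op := (op R Zd).
Implicit Types (u v w : fam) (l : seq (C * Zd)) (z : 'I_d -> C) (m n : Zd).

(** Besides the symbol, the predicate records the symbols of the [laurent_der],
    since both are needed to compose operators by the Leibniz rule. *)
Definition has_symbol (T : op) (s : ('I_d -> C) -> C) (ds : 'I_d -> ('I_d -> C) -> C) :=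
  exists l, [/\ forall u, T u = laurent_op l u,
    forall z, torus z -> symbol l z = s z
  & forall j z, torus z -> symbol (laurent_der j l) z = ds j z].

Lemma has_symbol_id : has_symbol id (fun=> 1) (fun _ _ => 0).
Proof.
exists [:: (1, 0)]; split=> [u|z _|j z _].
- by apply/funext => n; rewrite /laurent_op big_seq1 /= mul1r subr0.
- by rewrite /symbol big_seq1 /= oppr0 chi0 mulr1.
- by rewrite /symbol big_seq1 /= mxE mulr0 mul0r.
Qed.

Lemma has_symbol_comp T1 T2 s1 s2 ds1 ds2 :
  has_symbol T1 s1 ds1 -> has_symbol T2 s2 ds2 ->
  has_symbol (T1 \o T2) (fun z => s1 z * s2 z)
    (fun j z => ds1 j z * s2 z + s1 z * ds2 j z).
Proof.
move=> [l1 [h1 h2 h3]] [l2 [k1 k2 k3]]; exists (laurent_mul l1 l2); split.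
- by move=> u; rewrite laurent_op_mul /= h1 k1.
- by move=> z tz; rewrite symbol_mul// h2// k2.
- by move=> j z tz; rewrite symbol_der_mul// h2// h3// k2// k3.
Qed.

Lemma chi_delta z j : chi z (delta_mx 0 j) = z j.
Proof.
rewrite /chi (bigD1 j)//= mxE !eqxx /= expr1z big1 ?mulr1// => i ij.
by rewrite mxE eqxx /= (negbTE ij) expr0z.
Qed.

Lemma chi_muln z m k : torus z -> chi z (m *+ k) = chi z m ^+ k.
Proof.
move=> tz; elim: k => [|k IH]; first by rewrite mulr0n chi0 expr0.
by rewrite mulrS chiD// IH exprS.
Qed.

Lemma chi_opp z m : torus z -> chi z (- m) = (chi z m)^-1.
Proof.
move=> tz; apply: (mulIf (x := chi z m)).
  by apply/eqP => h; have /eqP := nsq_chi m tz; rewrite h mulr0 eq_sym oner_eq0.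
rewrite -chiD// addNr chi0 mulVf//.
by apply/eqP => h; have /eqP := nsq_chi m tz; rewrite h mulr0 eq_sym oner_eq0.
Qed.

(** [(z^-1 + z) / 2] and [(z^-1 - z) / 2]: the symbol of [Delta j], and that of
    its derivation along its own coordinate. *)
Definition cosz z j : C := 2^-1 * ((z j)^-1 + z j).
Definition sinz z j : C := 2^-1 * ((z j)^-1 - z j).

Lemma has_symbol_Delta j : has_symbol (Delta j) (fun z => cosz z j)
  (fun i z => if i == j then sinz z j else 0).
Proof.
exists [:: (2^-1, delta_mx 0 j); (2^-1, - delta_mx 0 j)]; split=> [u|z tz|i z tz].
- apply/funext => n; rewrite /laurent_op big_cons big_seq1 /= opprK.
  by rewrite /Delta /scalef /addf /shift_op /shift_inv mulrDr.
- rewrite /symbol big_cons big_seq1 /= opprK chi_opp// chi_delta.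
  by rewrite -mulrDr.
- rewrite /symbol big_cons big_seq1 /= opprK chi_opp// chi_delta !mxE eqxx /=.
  case: eqP => _; rewrite ?mulr0 ?mul0r ?addr0//=.
  by rewrite mulr1 mulrN mulr1 /sinz mulNr -mulrBr.
Qed.

Lemma has_symbol_eq T T' s s' ds ds' : has_symbol T s ds ->
  (forall u, T' u = T u) -> (forall z, torus z -> s' z = s z) ->
  (forall j z, torus z -> ds' j z = ds j z) -> has_symbol T' s' ds'.
Proof.
move=> [l [h1 h2 h3]] e1 e2 e3; exists l; split.
- by move=> u; rewrite e1 h1.
- by move=> z tz; rewrite e2// h2.
- by move=> j z tz; rewrite e3// h3.
Qed.

Lemma has_symbol_prod (r : seq 'I_d) : uniq r ->
  has_symbol (\big[(fun f g => f \o g)/id]_(j <- r) Delta j)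
    (fun z => \prod_(j <- r) cosz z j)
    (fun i z => if i \in r then sinz z i * \prod_(j <- r | j != i) cosz z j else 0).
Proof.
elim: r => [_|j r IH /= /andP[jr ur]].
  apply: (has_symbol_eq has_symbol_id) => [u|z _|j z _].
  - by rewrite big_nil.
  - by rewrite big_nil.
  - by rewrite in_nil.
apply: (has_symbol_eq (has_symbol_comp (has_symbol_Delta j) (IH ur))) => [u|z _|i z _].
- by rewrite big_cons.
- by rewrite big_cons.
rewrite inE big_cons (eq_sym j i).
case: eqP => [->|_] /=.
  rewrite (negbTE jr) mulr0 addr0; congr (_ * _).
  rewrite big_seq_cond [in RHS]big_seq; apply: eq_bigl => i'.
  by case: eqP => [->|_]; rewrite ?(negbTE jr) ?andbF ?andbT.
case: ifPn => ir; rewrite ?mul0r ?mulr0 ?addr0 ?add0r//.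
by rewrite mulrCA.
Qed.

Lemma has_symbol_MV : has_symbol MV_laplacian
    (fun z => \prod_j cosz z j)
    (fun i z => sinz z i * \prod_(j | j != i) cosz z j).
Proof.
apply: (has_symbol_eq (has_symbol_prod (index_enum_uniq 'I_d))) => [u|z _|i z _].
- by [].
- by [].
- by rewrite mem_index_enum.
Qed.

Lemma laurent_op_sum l (F : 'I_d -> fam) n :
  laurent_op l (fun m => \sum_j F j m) n = \sum_j laurent_op l (F j) n.
Proof.
rewrite /laurent_op; under eq_bigr do rewrite mulr_sumr.
by rewrite exchange_big.
Qed.

Lemma l2_sum (F : 'I_d -> fam) (r : seq 'I_d) : (forall j, l2 (F j)) ->
  l2 (fun n => \sum_(j <- r) F j n).
Proof.
move=> lF; elim: r => [|j r IH].
  by under eq_fun do rewrite big_nil; exact: l2_zero.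
by under eq_fun do rewrite big_cons; exact: l2_add.
Qed.

Lemma inner_sumr u (F : 'I_d -> fam) (r : seq 'I_d) : l2 u -> (forall j, l2 (F j)) ->
  inner u (fun n => \sum_(j <- r) F j n) = \sum_(j <- r) inner u (F j).
Proof.
move=> lu lF; elim: r => [|j r IH].
  rewrite big_nil; under eq_fun do rewrite big_nil.
  have -> : (fun=> 0) = scalef 0 u by apply/funext => n; rewrite /scalef mul0r.
  by rewrite innerZr// mul0r.
rewrite big_cons -IH; under eq_fun do rewrite big_cons.
by rewrite -innerDr//; exact: l2_sum.
Qed.

Lemma inner_suml u (F : 'I_d -> fam) (r : seq 'I_d) : l2 u -> (forall j, l2 (F j)) ->
  inner (fun n => \sum_(j <- r) F j n) u = \sum_(j <- r) inner (F j) u.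
Proof.
move=> lu lF; rewrite innerC inner_sumr// rmorph_sum.
by apply: eq_bigr => j _; rewrite [RHS]innerC.
Qed.

Definition shift_diff_laurent j k : seq (C * Zd) :=
  [:: (1, delta_mx 0 j *+ k); (-1, - (delta_mx 0 j *+ k))].

Lemma shift_diffE j k u : shift_diff j k u = laurent_op (shift_diff_laurent j k) u.
Proof.
have H1 i n : iter i (shift_op j) u n = u (n - delta_mx 0 j *+ i).
  elim: i n => [|i IH] n; first by rewrite mulr0n subr0.
  by rewrite iterS {1}/shift_op IH -addrA -opprD -mulrS.
have H2 i n : iter i (shift_inv j) u n = u (n + delta_mx 0 j *+ i).
  elim: i n => [|i IH] n; first by rewrite mulr0n addr0.
  by rewrite iterS {1}/shift_inv IH -addrA -mulrS.
apply/funext => n; rewrite /laurent_op big_cons big_seq1 /= opprK mul1r mulN1r.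
by rewrite /shift_diff /subf H1 H2.
Qed.

Lemma finsupp_position j u : finsupp u -> finsupp (position j u).
Proof.
apply: sub_finite_set => n /=; apply: contraNN => /eqP un.
by rewrite /position un mulr0.
Qed.

Variable k : nat.
Local Notation W j := (laurent_op (shift_diff_laurent j k)).
Local Notation A0 := (conjugate_core (fun _ : 'I_d => k)).

Lemma conjugate_coreE u : A0 u =
  (fun n => \sum_j (4 * 'i%C)^-1 * (W j (position j u) n + position j (W j u) n)).
Proof.
by apply/funext => n; apply: eq_bigr => j _; rewrite !shift_diffE.
Qed.

Lemma finsupp_sum (F : 'I_d -> fam) (r : seq 'I_d) : (forall j, finsupp (F j)) ->
  finsupp (fun n => \sum_(j <- r) F j n).
Proof.
move=> fF; elim: r => [|j r IH].
  apply: (@seq_finsupp _ _ _ [::]) => n _; by rewrite big_nil.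
have : finite_set ([set n | F j n != 0] `|` [set n | \sum_(j <- r) F j n != 0]).
  by rewrite finite_setU; split; [exact: fF|exact: IH].
apply: sub_finite_set => n /=; rewrite big_cons => h.
have [h1|h1] := boolP (F j n != 0); first by left.
by right; move: h; rewrite (eqP (negbNE h1)) add0r.
Qed.

Lemma finsupp_add u v : finsupp u -> finsupp v -> finsupp (addf u v).
Proof.
move=> fu fv; have : finite_set ([set n | u n != 0] `|` [set n | v n != 0]).
  by rewrite finite_setU.
apply: sub_finite_set => n /= h.
have [h1|h1] := boolP (u n != 0); first by left.
by right; move: h; rewrite /addf (eqP (negbNE h1)) add0r.
Qed.

Lemma finsupp_scale a u : finsupp u -> finsupp (scalef a u).
Proof.
apply: sub_finite_set => n /=; apply: contraNN => /eqP un.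
by rewrite /scalef un mulr0.
Qed.

Definition core_term j u : fam :=
  scalef (4 * 'i%C)^-1 (addf (W j (position j u)) (position j (W j u))).

Lemma finsupp_core_term j u : finsupp u -> finsupp (core_term j u).
Proof.
move=> fu; apply/finsupp_scale/finsupp_add.
  exact/laurent_op_finsupp/finsupp_position.
exact/finsupp_position/laurent_op_finsupp.
Qed.

Lemma finsupp_core u : finsupp u -> finsupp (A0 u).
Proof.
by move=> fu; rewrite conjugate_coreE; apply: finsupp_sum => j; exact: finsupp_core_term.
Qed.

Lemma inner_position j u v : inner (position j u) v = inner u (position j v).
Proof.
rewrite /inner; congr csum; apply/funext => n; rewrite /position.
have -> : (((n 0 j)%:~R * u n)^*)%C = (n 0 j)%:~R * ((u n)^*)%C.
  by rewrite rmorphM /= rmorph_int.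
by rewrite mulrCA mulrA.
Qed.

Lemma inner_shift_diff j u v : l2 u -> l2 v ->
  inner (W j u) v = - inner u (W j v).
Proof.
move=> lu lv; rewrite inner_laurent_op//.
have -> : laurent_op (laurent_adj (shift_diff_laurent j k)) v = scalef (-1) (W j v).
  apply/funext => n; rewrite /scalef /laurent_op !big_cons !big_nil /=.
  have -> : Complex 1 (- 0) = 1 :> C by apply: complex_ext; rewrite /= ?oppr0.
  have -> : Complex (-1) (- - 0) = -1 :> C by apply: complex_ext; rewrite /= ?oppr0.
  by rewrite opprK; ring.
by rewrite innerZr ?mulN1r//; exact: laurent_op_l2.
Qed.

(** [W j] is skew-adjoint and [position j] symmetric, so their anticommutator is
    skew-adjoint, which the imaginary factor [(4 i)^-1] compensates. *)
Lemma core_symmetric u v : finsupp u -> finsupp v -> inner (A0 u) v = inner u (A0 v).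
Proof.
move=> fu fv; rewrite !conjugate_coreE.
have lu := l2_fin fu; have lv := l2_fin fv.
have l j w : finsupp w -> l2 (core_term j w) by move=> fw; exact/l2_fin/finsupp_core_term.
rewrite (@inner_suml v (core_term ^~ u))// ?(@inner_sumr u (core_term ^~ v))//; last first.
- by move=> j; exact: l.
- by move=> j; exact: l.
apply: eq_bigr => j _; rewrite /core_term.
have l1 w : finsupp w -> l2 (W j (position j w)).
  by move=> fw; apply/l2_fin/laurent_op_finsupp/finsupp_position.
have l2' w : finsupp w -> l2 (position j (W j w)).
  by move=> fw; apply/l2_fin/finsupp_position/laurent_op_finsupp.
have lN w : finsupp w -> l2 (position j w).
  by move=> fw; apply/l2_fin/finsupp_position.
have lW w : finsupp w -> l2 (W j w).
  by move=> fw; apply/l2_fin/laurent_op_finsupp.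
rewrite innerZl//; [|by apply: l2_add; [exact: l1|exact: l2']].
rewrite innerZr//; [|by apply: l2_add; [exact: l1|exact: l2']].
rewrite innerDl//; [|exact: l1|exact: l2'].
rewrite innerDr//; [|exact: l1|exact: l2'].
rewrite inner_shift_diff//; last exact: lN.
rewrite !inner_position inner_shift_diff//; last exact: lN.
have -> : (((4 * 'i%C)^-1 : C)^*)%C = - (4 * 'i%C)^-1.
  rewrite conjc_inv -invrN; congr (_^-1).
  transitivity (((4 : C)^*)%C * ('i%C^*)%C); first exact: rmorphM.
  by rewrite conjc_nat -mulrN; congr (_ * _); apply: complex_ext; rewrite /= ?oppr0.
ring.
Qed.

(** Since Laurent operators commute with each other,
    [[T, W N + N W] = W [T, N] + [T, N] W = 2 W [T, N]], and [[T, N]] is minus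
    the derivation of [T].  This is again a Laurent operator, so the unbounded
    position operators cancel. *)
Definition commutator_laurent l : seq (C * Zd) :=
  flatten [seq laurent_mul [:: (- 2^-1, 0)]
     (laurent_mul (shift_diff_laurent j k) (laurent_der j l)) | j <- index_enum 'I_d].

Lemma laurent_op_flatten (ls : seq (seq (C * Zd))) u n :
  laurent_op (flatten ls) u n = \sum_(l <- ls) laurent_op l u n.
Proof.
elim: ls => [|l ls IH]; first by rewrite laurent_op_nil big_nil.
by rewrite /= laurent_op_cat big_cons -IH.
Qed.

Lemma symbol_flatten (ls : seq (seq (C * Zd))) z :
  symbol (flatten ls) z = \sum_(l <- ls) symbol l z.
Proof.
elim: ls => [|l ls IH]; first by rewrite /symbol !big_nil.
by rewrite /= symbol_cat big_cons -IH.
Qed.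

Lemma symbol_scalar a z : symbol [:: (a, 0)] z = a.
Proof. by rewrite /symbol big_seq1 /= oppr0 chi0 mulr1. Qed.

Lemma laurent_op_scalar a u : laurent_op [:: (a, 0)] u = scalef a u.
Proof. by apply/funext => n; rewrite /laurent_op big_seq1 /= subr0. Qed.

Lemma commutator_laurentE l u :
  laurent_op (commutator_laurent l) u =
  subf (scalef 'i%C (laurent_op l (A0 u))) (scalef 'i%C (A0 (laurent_op l u))).
Proof.
apply/funext => n; rewrite /subf /scalef !conjugate_coreE.
rewrite (laurent_op_sum l (core_term ^~ u)) laurent_op_flatten big_map.
rewrite -mulrBr -sumrB mulr_sumr; apply: eq_bigr => j _.
rewrite !laurent_op_mul laurent_op_scalar /core_term.
have bl := laurent_op_bounded l.
have ZE a w : laurent_op l (scalef a w) n = a * laurent_op l w n.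
  by rewrite /laurent_op mulr_sumr; apply: eq_bigr => p _; rewrite mulrCA.
have DE w w' : laurent_op l (addf w w') n = laurent_op l w n + laurent_op l w' n.
  by rewrite /laurent_op -big_split; apply: eq_bigr => p _; rewrite mulrDr.
rewrite ZE DE (laurent_op_comm l) (laurent_position j l (W j u)).
rewrite (laurent_position j l u) (laurent_op_comm l _ u) (laurent_op_comm (laurent_der j l)).
have BE w w' : W j (subf w w') n = W j w n - W j w' n.
  by rewrite /laurent_op -sumrB; apply: eq_bigr => p _; rewrite mulrBr.
rewrite BE /scalef /subf.
have i0 : ('i%C : C) != 0 by rewrite eq_complex /= oner_eq0 andbF.
have E : 'i%C * (4 * 'i%C)^-1 = 4^-1 :> C by rewrite invfM mulrCA divff// mulr1.
by rewrite -mulrBr mulrA E; field.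
Qed.

Lemma laurent_form_commutator l u v : finsupp u -> finsupp v ->
  (forall u v, l2 u -> l2 v -> inner (laurent_op l u) v = inner u (laurent_op l v)) ->
  inner u (laurent_op (commutator_laurent l) v) =
  inner (laurent_op l u) (scalef 'i%C (A0 v)) + inner (scalef 'i%C (A0 u)) (laurent_op l v).
Proof.
move=> fu fv sl; have lu := l2_fin fu; have lv := l2_fin fv.
have lA w : finsupp w -> l2 (A0 w) by move=> fw; exact/l2_fin/finsupp_core.
have fl := laurent_op_finsupp l fv.
rewrite sl//; last by apply: l2_scale; exact: lA.
rewrite boundedZ//; [|exact: laurent_op_bounded|exact: lA].
rewrite (@innerZl _ _ _ _ (A0 u))//; [|exact: l2_fin|exact: lA].
rewrite core_symmetric// commutator_laurentE innerBr//; last 2 first.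
- by apply/l2_scale/laurent_op_l2; exact: lA.
- by apply/l2_scale; exact: lA.
rewrite (@innerZr _ _ _ u (A0 _))//; last exact: lA.
have -> : ('i%C^*)%C = - 'i%C :> C by apply: complex_ext; rewrite /= ?oppr0.
by rewrite mulNr.
Qed.

(** The identity holds on finitely supported families, and closing it in the
    graph norm shows that the Laurent operator extends the commutator.  Any
    other bounded extension agrees with it on finitely supported families, hence
    everywhere by density, and [commutator] can pick no other operator. *)
Lemma commutatorE T l : (forall u, T u = laurent_op l u) ->
  (forall u v, l2 u -> l2 v -> inner (T u) v = inner u (T v)) ->
  forall v, l2 v ->
  commutator T (conjugate_operator (fun _ : 'I_d => k)) v =
  laurent_op (commutator_laurent l) v.
Proof.
move=> /funext Tl; rewrite Tl => sl.
set A := conjugate_operator _.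
have bl := laurent_op_bounded l.
have bG := laurent_op_bounded (commutator_laurent l).
have ex : extends_commutator (laurent_op l) A (laurent_op (commutator_laurent l)).
  split=> // u f v g [lu lf [u_ [fu cu cf]]] [lv lg [v_ [fv cv cg]]].
  have lu_ (m : nat) := l2_fin (fu m); have lv_ (m : nat) := l2_fin (fv m).
  have lAu (m : nat) : l2 (A0 (u_ m)) by exact/l2_fin/finsupp_core/fu.
  have lAv (m : nat) : l2 (A0 (v_ m)) by exact/l2_fin/finsupp_core/fv.
  have li w : l2 w -> l2 (scalef 'i%C w) by exact: l2_scale.
  exact: (inner_lim_add lu (bounded_l2 bG lv) (bounded_l2 bl lu) (li _ lg)
    (li _ lf) (bounded_l2 bl lv) lu_ (fun m : nat => bounded_l2 bG (lv_ m))
    (fun m : nat => bounded_l2 bl (lu_ m)) (fun m : nat => li _ (lAv m))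
    (fun m : nat => li _ (lAu m)) (fun m : nat => bounded_l2 bl (lv_ m))
    cu (bounded_cvg bG lv lv_ cv) (bounded_cvg bl lu lu_ cu)
    (cvg_l2_scale _ lg lAv cg) (cvg_l2_scale _ lf lAu cf) (bounded_cvg bl lv lv_ cv)
    (fun m : nat => laurent_form_commutator (fu m) (fv m) sl)).
have [bB hB] : extends_commutator (laurent_op l) A (commutator (laurent_op l) A).
  exact: (xgetPex (fun u => u) (ex_intro (fun B => extends_commutator (laurent_op l) A B) _ ex)).
have gr w : finsupp w -> A w (A0 w).
  move=> fw; have lA : l2 (A0 w) by exact/l2_fin/finsupp_core.
  split; [exact: l2_fin|by []|exists (fun=> w); split=> //].
    exact/cvg_l2_cst/l2_fin.
  exact: cvg_l2_cst.
move=> v lv; have lB := bounded_l2 bB lv; have lG := bounded_l2 bG lv.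
apply: (inner_inj lB lG) => w fw; have lw := l2_fin fw.
have [v_ fv cv] := density_seq lv; have lv_ (m : nat) := l2_fin (fv m).
apply: (inner_lim lw lB lw lG (fun _ : nat => lw)
  (fun m : nat => bounded_l2 bB (lv_ m)) (fun _ : nat => lw)
  (fun m : nat => bounded_l2 bG (lv_ m)) (cvg_l2_cst lw) (bounded_cvg bB lv lv_ cv)
  (cvg_l2_cst lw) (bounded_cvg bG lv lv_ cv)) => m.
by rewrite (hB _ _ _ _ (gr _ fw) (gr _ (fv m))) laurent_form_commutator.
Qed.

End Commutator.

(** * Laurent operators with a real symbol *)

Section RealSymbol.
Context {R : realType} {d : nat}.
Local Notation C := R[i].
Local Notation Zd := 'rV[int]_d.
Local Notation fam := (fam R Zd).
Local Notation op := (op R Zd).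
Implicit Types (u v w : fam) (l : seq (C * Zd)) (z : 'I_d -> C).

Lemma inner_scalar_mul a l u v : l2 u -> l2 v ->
  inner u (laurent_op (laurent_mul [:: (a, 0)] l) v) = a * inner u (laurent_op l v).
Proof.
by move=> lu lv; rewrite laurent_op_mul laurent_op_scalar innerZr//; exact: laurent_op_l2.
Qed.

(** Both [l] and its negative have nonnegative forms, so the form vanishes and
    polarization applies; the imaginary part is reached by multiplying [l] and
    the vectors by [i]. *)
Lemma toeplitz_zero l : (forall z, torus z -> symbol l z = 0) ->
  forall u v, l2 u -> l2 v -> inner u (laurent_op l v) = 0.
Proof.
move=> l0.
have Q l' : (forall z, torus z -> symbol l' z = 0) ->
    forall u, l2 u -> rip u (laurent_op l' u) = 0.
  move=> h u lu; apply/eqP; rewrite eq_le; apply/andP; split; last first.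
    by apply: toeplitz_pos => // z tz; rewrite h.
  rewrite -oppr_ge0.
  have -> : - rip u (laurent_op l' u) = rip u (laurent_op (laurent_mul [:: (-1, 0)] l') u).
    by rewrite /rip inner_scalar_mul// mulN1r cRe_opp.
  by apply: toeplitz_pos => // z tz; rewrite symbol_mul// h// mulr0.
have B l' : (forall z, torus z -> symbol l' z = 0) -> forall u v, l2 u -> l2 v ->
    rip u (laurent_op l' v) + rip v (laurent_op l' u) = 0.
  move=> h u v lu lv; have := Q l' h _ (l2_add lu lv).
  have bl := laurent_op_bounded l'.
  have lu' := bounded_l2 bl lu; have lv' := bounded_l2 bl lv.
  rewrite (boundedD bl lu lv) (ripDr (l2_add lu lv) lu' lv') (ripDl lu' lu lv) (ripDl lv' lu lv).
  by rewrite !Q//; lra.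
have bl := laurent_op_bounded l.
have I0 u v : l2 u -> l2 v -> complex.Im (inner u (laurent_op l v)) = 0.
  move=> lu lv; have liv := l2_scale 'i%C lv.
  have h1 := B l l0 u _ lu liv.
  have h2 : rip u (laurent_op (laurent_mul [:: ('i%C, 0)] l) v) +
     rip v (laurent_op (laurent_mul [:: ('i%C, 0)] l) u) = 0.
    by apply: B => // z tz; rewrite symbol_mul// l0// mulr0.
  move: h1 h2; rewrite /rip !inner_scalar_mul// (boundedZ _ bl lv).
  rewrite (innerZr _ lu (bounded_l2 bl lv)) (innerZl _ (bounded_l2 bl lu) lv) !ReImE /=.
  by rewrite !mul0r !mul1r; lra.
move=> u v lu lv; apply: complex_ext; last exact: I0.
have := I0 _ _ (l2_scale 'i%C lu) lv.
rewrite (innerZl _ (laurent_op_l2 _ lv) lu) !ReImE /=; lra.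
Qed.

(** The difference between the operator and its adjoint has symbol zero. *)
Lemma real_symbol_symmetric l :
  (forall z, torus z -> complex.Im (symbol l z) = 0) -> symmetric_op (laurent_op l).
Proof.
move=> rl u v lu lv; rewrite inner_laurent_op//; apply/eqP; rewrite -subr_eq0; apply/eqP.
have := @toeplitz_zero (laurent_adj l ++ laurent_mul [:: (-1, 0)] l) _ u v lu lv.
rewrite laurent_op_cat innerDr ?inner_scalar_mul ?mulN1r//; [|exact: laurent_op_l2..].
apply=> z tz; rewrite symbol_cat symbol_mul// symbol_scalar symbol_adj// mulN1r.
apply: complex_ext; rewrite !ReImE /=; first by rewrite subrr.
by rewrite rl// oppr0 addr0.
Qed.

(** Both sides say that [G + M (D - E)^2 - c], itself a Laurent operator, is
    nonnegative. *)
Lemma form_bound_symbol (lG lD : seq (C * Zd)) (gG gD : ('I_d -> C) -> R) (E M c : R) :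
  (forall z, torus z -> symbol lG z = (gG z)%:C%C) ->
  (forall z, torus z -> symbol lD z = (gD z)%:C%C) ->
  form_bound (laurent_op lG) (laurent_op lD) E M c <->
  forall z, torus z -> c <= gG z + M * (gD z - E) ^+ 2.
Proof.
move=> hG hD.
have sD : symmetric_op (laurent_op lD) by apply: real_symbol_symmetric => z /hD ->.
have bD := laurent_op_bounded lD.
pose lE := lD ++ [:: (- (E%:C)%C, 0)].
pose L := lG ++ (laurent_mul [:: ((M%:C)%C, 0)] (laurent_mul lE lE) ++ [:: (- (c%:C)%C, 0)]).
have EE u : laurent_op lE u = sub_scalar (laurent_op lD) E u.
  rewrite laurent_op_cat laurent_op_scalar /sub_scalar subfE; congr addf.
  by apply/funext => n; rewrite /scalef; ring.
have form u : l2 u -> rip u (laurent_op L u) =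
    rip u (laurent_op lG u) + M * N2 (sub_scalar (laurent_op lD) E u) - c * N2 u.
  move=> lu; rewrite (laurent_op_cat lG) (laurent_op_cat (laurent_mul _ _)).
  have lG' := laurent_op_l2 lG lu; have lu1 := laurent_op_l2 (laurent_mul [:: ((M%:C)%C, 0)] (laurent_mul lE lE)) lu.
  have lu2 := laurent_op_l2 [:: (- (c%:C)%C, 0)] lu.
  rewrite (ripDr lu lG' (l2_add lu1 lu2)) (ripDr lu lu1 lu2).
  have -> : rip u (laurent_op (laurent_mul [:: ((M%:C)%C, 0)] (laurent_mul lE lE)) u) =
      M * N2 (sub_scalar (laurent_op lD) E u).
    rewrite laurent_op_mul laurent_op_scalar ripZr//; last exact: laurent_op_l2.
    congr (_ * _); rewrite laurent_op_mul (EE (laurent_op lE u)) -sub_scalar_sym//.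
      by rewrite -EE ripN2.
    exact: laurent_op_l2.
  have -> : rip u (laurent_op [:: (- (c%:C)%C, 0)] u) = - c * N2 u.
    have -> : - (c%:C)%C = ((- c)%:C)%C by rewrite rmorphN.
    by rewrite laurent_op_scalar ripZr// ripN2.
  by ring.
have sL z : torus z -> complex.Re (symbol L z) = gG z + M * (gD z - E) ^+ 2 - c.
  move=> tz; rewrite (symbol_cat lG) (symbol_cat (laurent_mul _ _)) !symbol_mul// !symbol_scalar hG//.
  rewrite /lE symbol_cat symbol_scalar hD//.
  by rewrite !ReImE /=; ring.
split=> [h z tz|h u lu].
  have := @toeplitz_symbol R d L z tz; rewrite sL// subr_ge0; apply => u fu.
  have lu := l2_fin fu; rewrite form// subr_ge0; exact: h.
rewrite -subr_ge0 -form//; apply: toeplitz_pos => // z tz.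
by rewrite sL// subr_ge0 h.
Qed.

End RealSymbol.

Section Symbols.
Context {R : realType} {d : nat}.
Local Notation C := R[i].
Implicit Types (z : 'I_d -> C) (x : 'I_d -> R).

(** [gfun k] is the polynomial with
    [sin (k t) sin t = cos t * gfun k (cos t ^ 2)], for [k] equal to 2, 4
    or 6. *)
Definition gfun (k : nat) (t : R) : R :=
  match k with
  | 2 => 2 * (1 - t)
  | 4 => 4 * ((1 - t) * (2 * t - 1))
  | 6 => 2 * ((1 - t) * (4 * t - 1) * (4 * t - 3))
  | _ => 0
  end.

Definition energy x : R := \prod_j x j.
(** The symbol of the commutator [[D, iA]] as a function of the cosines. *)
Definition virial k x : R := energy x * \sum_j gfun k (x j ^+ 2).

Lemma cosz_real z j : torus z -> cosz z j = ((complex.Re (z j))%:C)%C.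
Proof.
move=> tz; rewrite /cosz -torus_conj// addrC addcJ mulrA mulVf ?mul1r// pnatr_eq0.
Qed.

(** The one-dimensional commutator, with [sin (k t) sin t] written in terms of
    [z] and its inverse. *)
Lemma gfun_symbol (k : nat) z j : k \in [:: 2; 4; 6]%N -> torus z ->
  - 2^-1 * (((z j)^-1 ^+ k - z j ^+ k) * sinz z j) =
  ((complex.Re (z j) * gfun k (complex.Re (z j) ^+ 2))%:C)%C.
Proof.
move=> hk tz; have z0 := torus_neq0 j tz.
have e := cosz_real j tz; set r := complex.Re (z j) in e *.
rewrite rmorphM /= -e.
have ge : ((gfun k (r ^+ 2))%:C)%C = match k with
  | 2 => 2 * (1 - cosz z j ^+ 2)
  | 4 => 4 * ((1 - cosz z j ^+ 2) * (2 * cosz z j ^+ 2 - 1))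
  | 6 => 2 * ((1 - cosz z j ^+ 2) * (4 * cosz z j ^+ 2 - 1) * (4 * cosz z j ^+ 2 - 3))
  | _ => 0 end.
  rewrite e; move: hk; rewrite !inE => /or3P[] /eqP -> /=;
  by rewrite !(rmorphM, rmorphB, rmorphXn, rmorph1, rmorph_nat).
rewrite ge /cosz /sinz; move: hk; rewrite !inE => /or3P[] /eqP -> /=; field; exact: z0.
Qed.

Variable k : nat.
Hypothesis hk : k \in [:: 2; 4; 6]%N.

Lemma commutator_symbol l z : torus z ->
  (forall i, symbol (laurent_der i l) z = sinz z i * \prod_(j | j != i) cosz z j) ->
  symbol (commutator_laurent k l) z = ((virial k (fun j => complex.Re (z j)))%:C)%C.
Proof.
move=> tz h; rewrite /commutator_laurent symbol_flatten big_map.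
rewrite /virial mulr_sumr rmorph_sum /=; apply: eq_bigr => j _.
rewrite !symbol_mul// symbol_scalar h.
have -> : symbol (shift_diff_laurent j k) z = (z j)^-1 ^+ k - z j ^+ k.
  rewrite /symbol big_cons big_seq1 /= opprK mul1r mulN1r.
  by rewrite chi_opp// chi_muln// chi_delta exprVn.
rewrite [X in _ * X]mulrA mulrA gfun_symbol//.
have -> : \prod_(i | i != j) cosz z i = ((\prod_(i | i != j) complex.Re (z i))%:C)%C.
  by rewrite rmorph_prod; apply: eq_bigr => i _; rewrite cosz_real.
rewrite -rmorphM; congr (_%:C)%C.
by rewrite /energy [in RHS](bigD1 j)//=; ring.
Qed.

End Symbols.

(** * Compactness of the energy shell *)

Section Compactness.
Context {R : realType}.

(** Where [f <= 0], a compact set, [h] has a positive minimum, so a large multiple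
    of [h] makes [f + M h] positive there, and elsewhere it is positive already;
    its minimum over [K] is [c]. *)
Lemma penalty_bound (X : topologicalType) (K : set X) (f h : X -> R) :
  compact K -> continuous f -> continuous h ->
  (forall x, K x -> 0 <= h x) -> (forall x, K x -> h x = 0 -> 0 < f x) ->
  exists M c : R, 0 < c /\ forall x, K x -> c <= f x + M * h x.
Proof.
move=> cK cf ch h0 hf.
have within A (g : X -> R) : continuous g -> {within A, continuous g}.
  exact: continuous_subspaceT.
have [K0|/set0P Kne] := eqVneq K set0.
  by exists 0, 1; split => // x; rewrite K0.
have cM (M : R) : continuous (fun x => f x + M * h x).
  move=> x; apply: cvgD; first exact: cf.
  by apply: cvgM; [exact: cvg_cst|exact: ch].
have [M hM] : exists M, forall x, K x -> 0 < f x + M * h x.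
  pose K' := K `&` f @^-1` [set y | y <= 0].
  have cK' : compact K'.
    by apply: compact_closedI => //; apply: closed_comp => //; exact: closed_le.
  have [K0|/set0P K'ne] := eqVneq K' set0.
    exists 0 => x Kx; rewrite mul0r addr0 ltNge; apply/negP => fx.
    by have : K' x by []; rewrite K0.
  have [a aK' ha] := compact_EVT_min K'ne cK' (within _ _ ch).
  have [b bK' hb] := compact_EVT_min K'ne cK' (within _ _ cf).
  have hapos : 0 < h a.
    move: aK'; rewrite inE => -[Ka fa]; rewrite lt_neqAle h0// andbT eq_sym.
    by apply/eqP => /(hf _ Ka); rewrite ltNge fa.
  have fb : f b <= 0 by move: bK'; rewrite inE => -[].
  exists ((1 - f b) / h a) => x Kx.
  have m0 : 0 <= (1 - f b) / h a by rewrite divr_ge0 ?(ltW hapos)// subr_ge0; lra.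
  have [fx|fx] := ltP 0 (f x); first by rewrite ltr_pwDl// mulr_ge0// h0.
  have K'x : x \in K' by rewrite inE.
  have : (1 - f b) / h a * h a <= (1 - f b) / h a * h x by rewrite ler_wpM2l// ha.
  rewrite divfK ?gt_eqF// => h1; have := hb _ K'x; lra.
have [a aK ha] := compact_EVT_min Kne cK (within _ _ (cM M)).
exists M, (f a + M * h a); split; first by apply: hM; move: aK; rewrite inE.
by move=> x Kx; apply: ha; rewrite inE.
Qed.

Context {d : nat}.
Implicit Types (x : 'I_d -> R).

Definition on_cube (E : R) x := (forall j, -1 <= x j <= 1) /\ energy x = E.

Lemma gfun_continuous k : continuous (@gfun R k).
Proof.
have c (a b : R) : continuous (fun t : R => a * t + b).
  move=> t; apply: cvgD; last exact: cvg_cst.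
  by apply: cvgM; [exact: cvg_cst|exact: cvg_id].
have c1 : continuous (fun t : R => 1 - t).
  move=> t; apply: cvgB; [exact: cvg_cst|exact: cvg_id].
have z : continuous (fun _ : R => 0 : R) by move=> t; exact: cvg_cst.
case: k => [|[|[|[|[|[|[|k]]]]]]]; try exact: z.
- by move=> t; apply: cvgM; [exact: cvg_cst|exact: c1].
- move=> t; apply: cvgM; first exact: cvg_cst.
  by apply: cvgM; [exact: c1|exact: c].
- move=> t; apply: cvgM; first exact: cvg_cst.
  apply: cvgM; last exact: c.
  by apply: cvgM; [exact: c1|exact: c].
Qed.

Lemma energy_continuous : continuous (fun v : 'rV[R]_d => energy (v 0)).
Proof.
move=> v; have Fv : Filter (nbhs v) by exact: nbhs_filter.
by apply: cvg_big => [|j _]; [exact: mul_continuous|exact: coord_continuous].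
Qed.

Lemma virial_continuous k : continuous (fun v : 'rV[R]_d => virial k (v 0)).
Proof.
move=> v; have Fv : Filter (nbhs v) by exact: nbhs_filter.
apply: cvgM; first exact: energy_continuous.
apply: cvg_big => [|j _]; first exact: add_continuous.
apply: (continuous_comp (f := fun v : 'rV[R]_d => v 0 j)
  (g := fun t : R => gfun k (t ^+ 2))); first exact: coord_continuous.
apply: (continuous_comp (f := fun t : R => t ^+ 2)); first exact: exprn_continuous.
exact: gfun_continuous.
Qed.

Lemma virial_penalty (k : nat) (s E : R) :
  (forall x, on_cube E x -> 0 < s * virial k x) ->
  exists M c : R, 0 < c /\ forall x, (forall j, -1 <= x j <= 1) ->
    c <= s * virial k x + M * (energy x - E) ^+ 2.
Proof.
move=> h.
have cK : compact [set v : 'rV[R]_d | forall j, `[-1, 1]%classic (v 0 j)].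
  have := @rV_compact R d (fun=> `[-1, 1]%classic).
  by apply => j; exact: segment_compact.
pose f (v : 'rV[R]_d) := s * virial k (v 0).
pose g (v : 'rV[R]_d) := (energy (v 0) - E) ^+ 2.
have cf : continuous f.
  move=> v; have Fv : Filter (nbhs v) by exact: nbhs_filter.
  by apply: cvgM; [exact: cvg_cst|exact: virial_continuous].
have cg : continuous g.
  move=> v; apply: (continuous_comp (f := fun v : 'rV[R]_d => energy (v 0))
    (g := fun t : R => (t - E) ^+ 2)); first exact: energy_continuous.
  have c1 : continuous (fun t : R => t - E).
    by move=> t; apply: cvgB; [exact: cvg_id|exact: cvg_cst].
  by apply: cvgM; exact: c1.
have g0 v : [set v : 'rV[R]_d | forall j, `[-1, 1]%classic (v 0 j)] v -> 0 <= g v.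
  by move=> _; exact: sqr_ge0.
have fg v : [set v : 'rV[R]_d | forall j, `[-1, 1]%classic (v 0 j)] v ->
    g v = 0 -> 0 < f v.
  move=> Kv /eqP; rewrite sqrf_eq0 subr_eq0 => /eqP e; by apply: h; split.
have [M [c [c0 hM]]] := penalty_bound cK cf cg g0 fg.
exists M, c; split=> // x hx; have := hM (\row_j x j) _.
rewrite /f /g (_ : (\row_j x j) 0 = x); last by apply/funext => j; rewrite mxE.
by apply => j /=; rewrite mxE in_itv /= hx.
Qed.

End Compactness.

(** * Polynomial inequalities *)

Section Inequalities.
Context {R : realType}.
Implicit Types (a b c t E : R).

(** [phi] and [psi] are [gfun 4] and [gfun 6] without their constant factors. *)
Definition phi t := (1 - t) * (2 * t - 1).
Definition psi t := (1 - t) * (4 * t - 1) * (4 * t - 3).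

Lemma phi_le t : phi t <= 1 / 8.
Proof. by rewrite /phi; have := sqr_ge0 (t - 3 / 4); nra. Qed.

Lemma lt_of_mul (p q a b : R) : 0 <= p -> 0 <= q -> q <= b -> a * b < p * q -> a < p.
Proof.
move=> p0 q0 qb; rewrite !ltNge; apply: contra => pa.
exact: ler_pM.
Qed.

Lemma lt_of_sqr (p a b : R) : 0 <= p -> a <= b -> a * b < p * p -> a < p.
Proof.
move=> p0 ab h; rewrite ltNge; apply/negP => pa.
have : p * p <= a * b by apply: ler_pM => //; exact: le_trans ab.
by rewrite leNgt h.
Qed.

Lemma lt_of_cube (p q a b c : R) : 0 <= p -> 0 <= q -> a <= b ->
  (p <= a -> q <= c) -> a * (b * c) < p * (p * q) -> a < p.
Proof.
move=> p0 q0 ab qc h; rewrite ltNge; apply/negP => pa.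
have : p * (p * q) <= a * (b * c).
  apply: ler_pM => //; first exact: mulr_ge0.
  by apply: ler_pM => //; [exact: le_trans ab|exact: qc].
by rewrite leNgt h.
Qed.

(** The left-hand side is a concave quadratic in [a + b] with vertex at [3 / 4].
    If [a b < 9 / 64] its maximal value is negative.  Otherwise
    [a + b >= 2 E >= 3 / 4] with [E ^ 2 = a b], and the value at [2 E] is
    [- 2 (1 - 2 E) (1 - E)]. *)
Lemma phi_sum2_neg a b : 0 <= a -> 0 <= b -> a * b < 1 / 4 -> phi a + phi b < 0.
Proof.
move=> a0 b0 ab; rewrite /phi.
have [h|h] := ltP (a * b) (9 / 64).
  by have := sqr_ge0 (a + b - 3 / 4); nra.
pose E := Num.sqrt (a * b).
have E0 : 0 <= E by exact: sqrtr_ge0.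
have EE : E * E = a * b by rewrite -expr2 sqr_sqrtr// mulr_ge0.
have E1 : 3 / 8 <= E.
  rewrite leNgt; apply/negP => h'; have : E * E < 3 / 8 * (3 / 8); last lra.
  by apply: ltr_pM.
have E2 : E < 1 / 2 by apply: (@lt_of_sqr (1 / 2) E E); lra.
have m : 2 * E <= a + b.
  have := sqr_ge0 (a - b) => h1.
  rewrite -(ler_pXn2r (n:=2))// ?nnegrE; [|lra|lra].
  by rewrite !expr2; nra.
have h1 : 0 <= (a + b - 2 * E) * (2 * (a + b) + 4 * E - 3) by apply: mulr_ge0; lra.
have h2 : 0 < (1 - 2 * E) * (1 - E) by apply: mulr_gt0; lra.
nra.
Qed.

(** The roots of [phi t = - (1 / 4)] are [(3 - sqrt 3) / 4] and
    [(3 + sqrt 3) / 4], and [phi] never exceeds [1 / 8].  So if the smallest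
    variable is below the first root, it outweighs the other two.  If not, the
    other two have a product less than [1 / 4], and [phi_sum2_neg] applies. *)
Lemma phi_sum3_neg a b c : 0 <= a -> a <= b -> b <= c -> c <= 1 ->
  a * (b * c) < (3 - Num.sqrt 3) / 16 -> phi a + (phi b + phi c) < 0.
Proof.
move=> a0 ab bc c1 h; set r := Num.sqrt 3 in h *.
have r0 : 0 <= r by exact: sqrtr_ge0.
have rr : r * r = 3 by rewrite -expr2 sqr_sqrtr.
have r2 : r < 2 by apply: (@lt_of_sqr 2 r r); lra.
have r1 : 1 < r.
  rewrite ltNge; apply/negP => h'; have : r * r <= 1 * 1; last lra.
  exact: ler_pM.
have [l|l] := ltP a ((3 - r) / 4).
  have := phi_le b; have := phi_le c; suff : phi a < - (1 / 4) by lra.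
  have : 0 < ((3 - r) / 4 - a) * ((3 + r) / 4 - a) by apply: mulr_gt0; lra.
  by rewrite /phi; nra.
have bc4 : b * c < 1 / 4.
  by apply: (@lt_of_mul (1 / 4) ((3 - r) / 4) (b * c) a); rewrite ?(mulrC _ a); lra.
have := phi_sum2_neg (le_trans a0 ab) (le_trans (le_trans a0 ab) bc) bc4.
have a2 : a < 1 / 2.
  apply: (@lt_of_sqr (1 / 2) a b); [lra|lra|].
  have b0 : b * b <= b * c by apply: ler_pM; lra.
  have : a * b <= b * b by apply: ler_pM; lra.
  lra.
rewrite /phi => h1; have : 0 <= (1 - a) * (1 - 2 * a) by apply: mulr_ge0; lra.
nra.
Qed.

(** The bounds here and in the next lemma round outwards the local extrema of
    [psi], which are attained near [446 / 1000] and [887 / 1000]; each proof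
    factors the difference up to a small linear remainder. *)
Lemma psi_ge t : 0 <= t <= 1 -> - (54 / 100) <= psi t.
Proof.
move=> /andP[t0 t1]; rewrite /psi.
have : 0 <= (t - 446 / 1000) ^+ 2 * (1108 / 1000 - t).
  by apply: mulr_ge0; [exact: sqr_ge0|lra].
nra.
Qed.

Lemma psi_le t : 1 / 4 <= t <= 1 -> psi t <= 16 / 100.
Proof.
move=> /andP[t0 t1]; rewrite /psi.
have : 0 <= (t - 887 / 1000) ^+ 2 * (t - 226 / 1000).
  by apply: mulr_ge0; [exact: sqr_ge0|lra].
nra.
Qed.

Lemma psi_gt0_low t : t < 1 / 4 -> 0 < psi t.
Proof.
move=> t4; have -> : psi t = (1 - t) * ((1 - 4 * t) * (3 - 4 * t)) by rewrite /psi; ring.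
by apply: mulr_gt0; [lra|apply: mulr_gt0; lra].
Qed.

Lemma psi_le_low t t' : t <= t' -> t' <= 1 / 4 -> psi t' <= psi t.
Proof.
move=> h1 h2.
have -> : psi t = (1 - t) * ((1 - 4 * t) * (3 - 4 * t)) by rewrite /psi; ring.
have -> : psi t' = (1 - t') * ((1 - 4 * t') * (3 - 4 * t')) by rewrite /psi; ring.
have l1 : 0 <= 1 - t' by lra. have l2 : 0 <= 1 - 4 * t' by lra.
have l3 : 0 <= 3 - 4 * t' by lra.
apply: ler_pM => //; [exact: mulr_ge0|lra|].
apply: ler_pM => //; lra.
Qed.

Lemma psi_lt0 t : 1 / 4 < t -> t < 3 / 4 -> psi t < 0.
Proof.
move=> h1 h2; rewrite -oppr_gt0.
have -> : - psi t = (1 - t) * ((4 * t - 1) * (3 - 4 * t)) by rewrite /psi; ring.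
by apply: mulr_gt0; [lra|apply: mulr_gt0; lra].
Qed.

Lemma psi_le0 t : 1 / 4 <= t -> t <= 3 / 4 -> psi t <= 0.
Proof.
move=> h1 h2; rewrite -oppr_ge0.
have -> : - psi t = (1 - t) * ((4 * t - 1) * (3 - 4 * t)) by rewrite /psi; ring.
by apply: mulr_ge0; [lra|apply: mulr_ge0; lra].
Qed.

(** A small [a] outweighs the minimum of [psi]; otherwise both variables are
    below [1 / 4], where [psi] is positive. *)
Lemma psi_sum2_pos a b : 0 <= a -> a <= b -> b <= 1 ->
  a * b < 21 / 100 * (21 / 100) -> 0 < psi a + psi b.
Proof.
move=> a0 ab b1 h; have [l|l] := leP a (177 / 1000).
  have : - (54 / 100) <= psi b by apply: psi_ge; lra.
  have : psi (177 / 1000) <= psi a by apply: psi_le_low => //; lra.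
  have : 55 / 100 <= psi (177 / 1000) by rewrite /psi; lra.
  lra.
have b4 : b < 1 / 4.
  by apply: (@lt_of_mul (1 / 4) (177 / 1000) b a); rewrite ?(mulrC b a); lra.
by apply: addr_gt0; apply: psi_gt0_low; lra.
Qed.

(** If [b <= 3 / 4] then [psi a] is negative and [psi b] is not positive.
    Otherwise [a] lies between [28 / 100] and [673 / 1000], where [psi a]
    outweighs the local maximum of [psi].  To bound [psi] on an interval, here
    and in [psi_sum3_neg], one subtracts a multiple of the product of the
    distances to its two ends; what remains is nearly linear. *)
Lemma psi_sum2_neg a b : 0 <= a -> a <= b -> b <= 1 ->
  53 / 100 * (53 / 100) < a * b -> a * b < 71 / 100 * (71 / 100) ->
  psi a + psi b < 0.
Proof.
move=> a0 ab b1 h1 h2.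
have a1 : 28 / 100 < a.
  have : a * b <= a * 1 by apply: ler_wpM2l.
  lra.
have a2 : a < 71 / 100 by apply: (@lt_of_sqr (71 / 100) a b) => //; lra.
have [l|l] := leP b (3 / 4).
  have pa : psi a < 0 by apply: psi_lt0; lra.
  have pb : psi b <= 0 by apply: psi_le0; lra.
  lra.
have a3 : a < 673 / 1000 by apply: (@lt_of_mul (673 / 1000) (3 / 4) a b); lra.
have pb : psi b <= 16 / 100 by apply: psi_le; lra.
suff : psi a <= - (161 / 1000) by lra.
have : 0 <= (a - 28 / 100) * (673 / 1000 - a) * (16752 / 1000 - 16 * a).
  by apply: mulr_ge0; [apply: mulr_ge0|]; lra.
rewrite /psi; nra.
Qed.

(** If [a <= 1 / 8] then [psi a] outweighs twice the minimum of [psi].  If not,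
    [a] and [b] are both below [1 / 4], and [psi a + psi b] outweighs the minimum
    once. *)
Lemma psi_sum3_pos a b c : 0 <= a -> a <= b -> b <= c -> c <= 1 ->
  a * (b * c) < 8 / 100 * (8 / 100) -> 0 < psi a + (psi b + psi c).
Proof.
move=> a0 ab bc c1 h.
have pc : - (54 / 100) <= psi c by apply: psi_ge; lra.
have pb : - (54 / 100) <= psi b by apply: psi_ge; lra.
have [l|l] := leP a (1 / 8).
  have : psi (1 / 8) <= psi a by apply: psi_le_low => //; lra.
  have : 109 / 100 <= psi (1 / 8) by rewrite /psi; lra.
  lra.
have h1 : b * c < 52 / 1000.
  by apply: (@lt_of_mul (52 / 1000) (1 / 8) (b * c) a); rewrite ?(mulrC _ a); lra.
have b1 : b < 229 / 1000 by apply: (@lt_of_sqr (229 / 1000) b c); lra.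
have a1 : a < 186 / 1000.
  by apply: (@lt_of_cube (186 / 1000) (186 / 1000) a b c); lra.
have : psi (186 / 1000) <= psi a by apply: psi_le_low; lra.
have : psi (229 / 1000) <= psi b by apply: psi_le_low; lra.
have : 46 / 100 <= psi (186 / 1000) by rewrite /psi; lra.
have : 13 / 100 <= psi (229 / 1000) by rewrite /psi; lra.
lra.
Qed.

(** Each of [psi b] and [psi c] is at most [16 / 100].  If [a <= 6 / 10] then
    [psi a] outweighs both.  If [a > 6 / 10] then [b < 3 / 4], so only [psi c] can
    be positive, and only for [c > 3 / 4]; this forces [a < 67 / 100], where
    [psi a] outweighs [psi c]. *)
Lemma psi_sum3_neg a b c : 0 <= a -> a <= b -> b <= c -> c <= 1 ->
  57 / 100 * (57 / 100) < a * (b * c) -> a * (b * c) < 58 / 100 * (58 / 100) ->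
  psi a + (psi b + psi c) < 0.
Proof.
move=> a0 ab bc c1 h1 h2.
have b0 : 0 <= b by lra. have c0 : 0 <= c by lra.
have a1 : 32 / 100 < a.
  have : b * c <= 1 * 1 by apply: ler_pM; lra.
  rewrite mulr1 => h3; have : a * (b * c) <= a * 1 by apply: ler_wpM2l.
  lra.
have a2 : a < 696 / 1000.
  by apply: (@lt_of_cube (696 / 1000) (696 / 1000) a b c); lra.
have pb : psi b <= 16 / 100 by apply: psi_le; lra.
have pc : psi c <= 16 / 100 by apply: psi_le; lra.
have [l|l] := leP a (6 / 10).
  suff : psi a <= - (325 / 1000) by lra.
  have : 0 <= (a - 32 / 100) * (6 / 10 - a) * (1728 / 100 - 16 * a).
    by apply: mulr_ge0; [apply: mulr_ge0|]; lra.
  rewrite /psi; nra.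
have h3 : b * c < 561 / 1000.
  by apply: (@lt_of_mul (561 / 1000) (6 / 10) (b * c) a); rewrite ?(mulrC _ a); lra.
have b1 : b < 3 / 4 by apply: (@lt_of_sqr (3 / 4) b c); lra.
have pb' : psi b <= 0 by apply: psi_le0; lra.
have [lc|lc] := leP c (3 / 4).
  have pa : psi a < 0 by apply: psi_lt0; lra.
  have pc' : psi c <= 0 by apply: psi_le0; lra.
  lra.
have a3 : a < 67 / 100.
  by apply: (@lt_of_cube (67 / 100) (3 / 4) a b c); lra.
suff : psi a <= - (17 / 100) by lra.
have : 0 <= (a - 6 / 10) * (67 / 100 - a) * (1168 / 100 - 16 * a).
  by apply: mulr_ge0; [apply: mulr_ge0|]; lra.
rewrite /psi; nra.
Qed.

End Inequalities.

(** * Energies where the virial has a sign *)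

Section Regions.
Context {R : realType}.
Implicit Types (a b c t E : R).

Lemma virial1 k (x : 'I_1 -> R) E : on_cube E x -> virial k x = E * gfun k (E ^+ 2).
Proof.
by move=> [_ e]; rewrite /virial e big_ord1; move: e; rewrite /energy big_ord1 => ->.
Qed.

Lemma sqr_itv (t : R) : -1 <= t <= 1 -> 0 <= t ^+ 2 <= 1.
Proof.
move=> /andP[h1 h2]; rewrite sqr_ge0 /= expr2.
have : 0 <= (1 - t) * (1 + t) by apply: mulr_ge0; lra.
lra.
Qed.

Lemma virial2 k (x : 'I_2 -> R) E : on_cube E x -> exists a b,
  [/\ 0 <= a <= 1, 0 <= b <= 1, a * b = E ^+ 2 & virial k x = E * (gfun k a + gfun k b)].
Proof.
move=> [h e]; exists (x ord0 ^+ 2), (x (lift ord0 ord0) ^+ 2); split.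
- exact/sqr_itv.
- exact/sqr_itv.
- by rewrite -e /energy !big_ord_recl big_ord0 mulr1 exprMn.
- by rewrite /virial e !big_ord_recl big_ord0 addr0.
Qed.

Lemma virial3 k (x : 'I_3 -> R) E : on_cube E x -> exists a b c,
  [/\ [/\ 0 <= a <= 1, 0 <= b <= 1 & 0 <= c <= 1], a * (b * c) = E ^+ 2 &
    virial k x = E * (gfun k a + (gfun k b + gfun k c))].
Proof.
move=> [h e]; exists (x ord0 ^+ 2), (x (lift ord0 ord0) ^+ 2),
  (x (lift ord0 (lift ord0 ord0)) ^+ 2); split.
- by split; exact/sqr_itv.
- by rewrite -e /energy !big_ord_recl big_ord0 mulr1 !exprMn.
- by rewrite /virial e !big_ord_recl big_ord0 addr0.
Qed.

Lemma sort2 (g : R -> R) (C S : R -> Prop) :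
  (forall a b, 0 <= a -> a <= b -> b <= 1 -> C (a * b) -> S (g a + g b)) ->
  forall a b, 0 <= a <= 1 -> 0 <= b <= 1 -> C (a * b) -> S (g a + g b).
Proof.
move=> h a b /andP[a0 a1] /andP[b0 b1].
have [ab|/ltW ab] := leP a b; first exact: h.
by rewrite mulrC addrC; exact: h.
Qed.

Lemma sort3 (g : R -> R) (C S : R -> Prop) :
  (forall a b c, 0 <= a -> a <= b -> b <= c -> c <= 1 -> C (a * (b * c)) ->
    S (g a + (g b + g c))) ->
  forall a b c, 0 <= a <= 1 -> 0 <= b <= 1 -> 0 <= c <= 1 -> C (a * (b * c)) ->
    S (g a + (g b + g c)).
Proof.
move=> h a b c /andP[a0 a1] /andP[b0 b1] /andP[c0 c1].
have [ab|/ltW ab] := leP a b; have [bc|/ltW bc] := leP b c; have [ac|/ltW ac] := leP a c.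
- exact: h.
- by apply: h => //; exact: le_trans bc.
- by rewrite (mulrC b) (addrC (g b)); exact: h.
- by rewrite mulrA (addrA (g a)) (mulrC _ c) (addrC _ (g c)); exact: h.
- by rewrite mulrCA addrCA; exact: h.
- rewrite mulrCA addrCA (mulrC a) (addrC (g a)); exact: h.
- rewrite (mulrC b) (addrC (g b)) mulrCA addrCA (mulrC a) (addrC (g a)).
  by apply: h => //; exact: le_trans ac _.
- rewrite (mulrC b) (addrC (g b)) mulrCA addrCA (mulrC a) (addrC (g a)); exact: h.
Qed.

Lemma gfun4 t : gfun 4 t = 4 * phi t. Proof. by []. Qed.
Lemma gfun6 t : gfun 6 t = 2 * psi t. Proof. by []. Qed.

Lemma gfun_at1 k : gfun k 1 = 0 :> R.
Proof.
by case: k => [|[|[|[|[|[|[|k]]]]]]] //=; rewrite subrr ?mul0r ?mulr0 ?mul0r ?mulr0.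
Qed.

(** Every [x j ^ 2] is at least the product [E ^ 2], so each term is
    nonnegative, and one is positive because the product is less than [1]. *)
Lemma virial_near_top (d : nat) k E (x : 'I_d -> R) : on_cube E x -> 0 < E -> E < 1 ->
  (forall t, E ^+ 2 <= t -> t < 1 -> 0 < gfun k t) -> 0 < virial k x.
Proof.
move=> [hx e] E0 E1 hg; rewrite /virial e mulr_gt0//.
have t1 j : 0 <= x j ^+ 2 <= 1 by exact: sqr_itv.
have tE : \prod_j (x j ^+ 2) = E ^+ 2 by rewrite -e /energy prodrXl.
have tj j : E ^+ 2 <= x j ^+ 2.
  rewrite -tE (bigD1 j)//= ler_piMr ?sqr_ge0// prodr_ile1//.
have g0 j : 0 <= gfun k (x j ^+ 2).
  have /andP[_] := t1 j; rewrite le_eqVlt => /orP[/eqP ->|l]; first by rewrite gfun_at1.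
  exact/ltW/hg.
rewrite lt_neqAle sumr_ge0// andbT eq_sym; apply/eqP => s0.
have z j : x j ^+ 2 = 1.
  have /andP[_] := t1 j; rewrite le_eqVlt => /orP[/eqP //|l].
  have /psumr_eq0P : forall i : 'I_d, true -> 0 <= gfun k (x i ^+ 2) by [].
  by move=> /(_ s0 j isT) e0; have := hg _ (tj j) l; rewrite e0 ltxx.
have : E ^+ 2 < 1 by rewrite expr_lt1// ltW.
by rewrite -tE big1 ?ltxx.
Qed.

Definition definite_sign (d k : nat) E :=
  exists s, (s = 1 \/ s = -1) /\
    forall x : 'I_d -> R, on_cube E x -> 0 < s * virial k x.

Lemma definite_near_top (d k : nat) E : 0 < E -> E < 1 ->
  (forall t, E ^+ 2 <= t -> t < 1 -> 0 < gfun k t) -> definite_sign d k E.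
Proof.
move=> E0 E1 h; exists 1; split; first by left.
by move=> x hx; rewrite mul1r (virial_near_top hx).
Qed.

Lemma definite_dim1 (k : nat) E : 0 < E -> gfun k (E ^+ 2) != 0 -> definite_sign 1 k E.
Proof.
move=> E0; rewrite neq_lt => /orP[] h.
  exists (-1); split; first by right.
  by move=> x /virial1 ->; rewrite mulN1r oppr_gt0 pmulr_rlt0.
exists 1; split; first by left.
by move=> x /virial1 ->; rewrite mul1r mulr_gt0.
Qed.

Lemma definite_dim2 (k : nat) E s : 0 < E -> s = 1 \/ s = -1 ->
  (forall a b, 0 <= a <= 1 -> 0 <= b <= 1 -> a * b = E ^+ 2 ->
    0 < s * (gfun k a + gfun k b)) -> definite_sign 2 k E.
Proof.
move=> E0 hs h; exists s; split=> // x /(virial2 k)[a [b [ha hb hab ->]]].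
by rewrite mulrCA mulr_gt0// h.
Qed.

Lemma definite_dim3 (k : nat) E s : 0 < E -> s = 1 \/ s = -1 ->
  (forall a b c, 0 <= a <= 1 -> 0 <= b <= 1 -> 0 <= c <= 1 -> a * (b * c) = E ^+ 2 ->
    0 < s * (gfun k a + (gfun k b + gfun k c))) -> definite_sign 3 k E.
Proof.
move=> E0 hs h; exists s; split=> // x /(virial3 k)[a [b [c [[ha hb hc] habc ->]]]].
by rewrite mulrCA mulr_gt0// h.
Qed.

Lemma sqr_inv_sqrt2 : (1 / Num.sqrt 2 : R) ^+ 2 = 1 / 2.
Proof. by rewrite expr_div_n expr1n sqr_sqrtr. Qed.

Lemma inv_sqrt2_ge0 : 0 <= 1 / Num.sqrt 2 :> R.
Proof. by rewrite divr_ge0 ?sqrtr_ge0. Qed.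

Lemma sqr_sqrt3_half : (Num.sqrt 3 / 2 : R) ^+ 2 = 3 / 4.
Proof. by rewrite expr_div_n sqr_sqrtr//; congr (_ / _); rewrite expr2; ring. Qed.

Lemma sqrt3_half_ge0 : 0 <= Num.sqrt 3 / 2 :> R.
Proof. by rewrite divr_ge0 ?sqrtr_ge0. Qed.

Lemma lt_sqr (p q : R) : 0 <= p -> p < q -> p ^+ 2 < q ^+ 2.
Proof. by move=> p0 pq; rewrite ltr_pXn2r// nnegrE ?(le_trans p0 (ltW pq)). Qed.

Lemma le_sqr (p q : R) : 0 <= p -> p <= q -> p ^+ 2 <= q ^+ 2.
Proof. by move=> p0 pq; rewrite ler_pXn2r// nnegrE ?(le_trans p0 pq). Qed.

Lemma inv_sqrt2_lt1 : 1 / Num.sqrt 2 < 1 :> R.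
Proof.
rewrite ltNge; apply/negP => h; have := le_sqr ler01 h.
by rewrite sqr_inv_sqrt2 expr1n; lra.
Qed.

(** In dimension one the sign is that of [gfun k (E ^ 2)].  In higher
    dimension [virial_near_top] covers the interval that ends at [1]; in the
    other intervals the sign comes from the inequalities for [phi] and [psi],
    applied to the squares of the coordinates. *)
Lemma open_region_sign (d k : nat) E : d \in [:: 1; 2; 3]%N -> k \in [:: 2; 4; 6]%N ->
  open_region d k E -> [/\ 0 < E, E < 1 & definite_sign d k E].
Proof.
have top2 d' : 0 < E -> E < 1 -> definite_sign d' 2 E.
  by move=> E0 E1; apply: definite_near_top => // t _ t1; rewrite /gfun; lra.
have top4 d' : 1 / Num.sqrt 2 < E -> E < 1 ->
    [/\ 0 < E, E < 1 & definite_sign d' 4 E].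
  move=> h E1; have E0 : 0 < E := le_lt_trans inv_sqrt2_ge0 h.
  split=> //; apply: definite_near_top => // t ht t1.
  have := lt_sqr inv_sqrt2_ge0 h; rewrite sqr_inv_sqrt2 => h2.
  by rewrite gfun4 /phi mulr_gt0//; apply: mulr_gt0; lra.
have top6 d' : Num.sqrt 3 / 2 < E -> E < 1 ->
    [/\ 0 < E, E < 1 & definite_sign d' 6 E].
  move=> h E1; have E0 : 0 < E := le_lt_trans sqrt3_half_ge0 h.
  split=> //; apply: definite_near_top => // t ht t1.
  have := lt_sqr sqrt3_half_ge0 h; rewrite sqr_sqrt3_half => h2.
  by rewrite gfun6 /psi mulr_gt0//; apply: mulr_gt0; [apply: mulr_gt0|]; lra.
have uniq_root (p : R) : 0 <= p -> 0 < E -> E ^+ 2 = p ^+ 2 -> E = p.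
  by move=> p0 E0 /eqP; rewrite eqrXn2// ?(ltW E0)// => /eqP.
rewrite !inE => /or3P[] /eqP -> /or3P[] /eqP -> /=.
- by rewrite in_itv /= => /andP[E0 E1]; split=> //; exact: top2.
- move=> []; rewrite in_itv /= => /andP[E0 E1] ne; split=> //.
  apply: definite_dim1 => //; rewrite gfun4 /phi; apply/eqP => h; apply: ne.
  apply: uniq_root; [exact: inv_sqrt2_ge0|exact: E0|].
  have : E ^+ 2 < 1 by rewrite expr_lt1// ltW.
  move: h; rewrite sqr_inv_sqrt2 => /eqP; rewrite mulf_eq0 pnatr_eq0 /= mulf_eq0.
  by move=> /orP[] /eqP; lra.
- move=> []; rewrite in_itv /= => /andP[E0 E1] ne; split=> //.
  apply: definite_dim1 => //; rewrite gfun6 /psi; apply/eqP => h; apply: ne.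
  have : E ^+ 2 < 1 by rewrite expr_lt1// ltW.
  move: h => /eqP; rewrite mulf_eq0 pnatr_eq0 /= !mulf_eq0 => /orP[/orP[]|] /eqP h1 h2.
  + by exfalso; lra.
  + left; apply: uniq_root; [lra|exact: E0|rewrite !expr2 in h1 h2 *; lra].
  + right; apply: uniq_root; [exact: sqrt3_half_ge0|exact: E0|].
    rewrite sqr_sqrt3_half; lra.
- by rewrite in_itv /= => /andP[E0 E1]; split=> //; exact: top2.
- move=> []; rewrite in_itv /= => /andP[h1 h2]; last exact: top4.
  split=> //; first lra.
  apply: (definite_dim2 (s := -1)) => //; first by right.
  move=> a b /andP[a0 _] /andP[b0 _] ab; rewrite !gfun4.
  have : phi a + phi b < 0.
    apply: phi_sum2_neg => //; rewrite ab.
    by have := lt_sqr (ltW h1) h2; rewrite [(1 / 2) ^+ 2]expr2; lra.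
  by lra.
- move=> [[|]|]; rewrite in_itv /= => /andP[h1 h2]; last exact: top6.
    split=> //; first lra.
    apply: (definite_dim2 (s := 1)) => //; first by left.
    have := lt_sqr (ltW h1) h2; rewrite [(21 / 100) ^+ 2]expr2 => h3.
    move=> a b ha hb ab; rewrite !gfun6 mul1r -mulrDr mulr_gt0//.
    apply: (@sort2 psi (fun t => t < 21 / 100 * (21 / 100)) (fun t => 0 < t)) => //.
      exact: psi_sum2_pos.
    by rewrite ab.
  split; [lra|lra|].
  apply: (definite_dim2 (s := -1)) => //; [lra|by right|].
  have h3 : 53 / 100 * (53 / 100) < E ^+ 2.
    by rewrite -expr2; apply: lt_sqr.
  have h4 : E ^+ 2 < 71 / 100 * (71 / 100).
    by rewrite -expr2; apply: lt_sqr => //; lra.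
  move=> a b ha hb ab; rewrite !gfun6 mulN1r oppr_gt0 -mulrDr pmulr_rlt0//.
  apply: (@sort2 psi (fun t => 53 / 100 * (53 / 100) < t /\ t < 71 / 100 * (71 / 100))
    (fun t => t < 0)) => //.
    by move=> a' b' ? ? ? [? ?]; exact: psi_sum2_neg.
  by rewrite ab.
- by rewrite in_itv /= => /andP[E0 E1]; split=> //; exact: top2.
- move=> []; rewrite in_itv /= => /andP[h1 h2]; last exact: top4.
  have r0 : 0 <= Num.sqrt 3 :> R by exact: sqrtr_ge0.
  have rr : Num.sqrt 3 * Num.sqrt 3 = 3 :> R by rewrite -expr2 sqr_sqrtr.
  have r1 : Num.sqrt 3 < 3 :> R by apply: (@lt_of_sqr _ 3 (Num.sqrt 3) (Num.sqrt 3)); lra.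
  have h3 : E ^+ 2 < (3 - Num.sqrt 3) / 16.
    have := lt_sqr (ltW h1) h2; rewrite expr_div_n sqr_sqrtr; last lra.
    by rewrite [4 ^+ 2]expr2; lra.
  split=> //.
    rewrite ltNge; apply/negP => h; have := le_sqr ler01 h; rewrite expr1n; lra.
  apply: (definite_dim3 (s := -1)) => //; first by right.
  move=> a b c ha hb hc habc; rewrite !gfun4 mulN1r oppr_gt0 -!mulrDr pmulr_rlt0//.
  apply: (@sort3 phi (fun t => t < (3 - Num.sqrt 3) / 16) (fun t => t < 0)) => //.
    exact: phi_sum3_neg.
  by rewrite habc.
- move=> [[|]|]; rewrite in_itv /= => /andP[h1 h2]; last exact: top6.
    split=> //; first lra.
    apply: (definite_dim3 (s := 1)) => //; first by left.
    have := lt_sqr (ltW h1) h2; rewrite [(8 / 100) ^+ 2]expr2 => h3.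
    move=> a b c ha hb hc abc; rewrite !gfun6 mul1r -!mulrDr mulr_gt0//.
    apply: (@sort3 psi (fun t => t < 8 / 100 * (8 / 100)) (fun t => 0 < t)) => //.
      exact: psi_sum3_pos.
    by rewrite abc.
  split; [lra|lra|].
  apply: (definite_dim3 (s := -1)) => //; [lra|by right|].
  have h3 : 57 / 100 * (57 / 100) < E ^+ 2.
    by rewrite -expr2; apply: lt_sqr.
  have h4 : E ^+ 2 < 58 / 100 * (58 / 100).
    by rewrite -expr2; apply: lt_sqr => //; lra.
  move=> a b c ha hb hc abc; rewrite !gfun6 mulN1r oppr_gt0 -!mulrDr pmulr_rlt0//.
  apply: (@sort3 psi (fun t => 57 / 100 * (57 / 100) < t /\ t < 58 / 100 * (58 / 100))
    (fun t => t < 0)) => //.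
    by move=> a' b' c' ? ? ? ? [? ?]; exact: psi_sum3_neg.
  by rewrite abc.
Qed.

End Regions.

(** * Energies where the virial has no sign *)

Section ClosedRegions.
Context {R : realType}.
Implicit Types (E r : R).

Definition indefinite_sign (d k : nat) E :=
  (exists2 x : 'I_d -> R, on_cube E x & virial k x <= 0) /\
  (exists2 x : 'I_d -> R, on_cube E x & 0 <= virial k x).

Definition corner_point (n : nat) E : 'I_n.+1 -> R := fun j => if j == ord0 then E else 1.

Lemma corner_point_energy n E : energy (@corner_point n E) = E.
Proof.
rewrite /energy (bigD1 ord0)//= {1}/corner_point eqxx big1 ?mulr1// => j.
by rewrite /corner_point => /negbTE ->.
Qed.

Lemma corner_point_on_cube n E : 0 <= E <= 1 -> on_cube E (@corner_point n E).
Proof.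
move=> /andP[E0 E1]; split; last exact: corner_point_energy.
by move=> j; rewrite /corner_point; case: eqP => _; lra.
Qed.

Lemma corner_point_virial n k E : virial k (@corner_point n E) = E * gfun k (E ^+ 2).
Proof.
rewrite /virial corner_point_energy (bigD1 ord0)//= {1}/corner_point eqxx.
rewrite big1 ?addr0// => j; rewrite /corner_point => /negbTE ->.
by rewrite expr1n gfun_at1.
Qed.

Lemma diagonal_on_cube n r : 0 <= r <= 1 -> on_cube (r ^+ n) (fun _ : 'I_n => r).
Proof.
move=> /andP[r0 r1]; split; first by move=> j; lra.
by rewrite /energy prodr_const card_ord.
Qed.

Lemma diagonal_virial n k r : virial k (fun _ : 'I_n => r) = r ^+ n * (gfun k (r ^+ 2) *+ n).
Proof. by rewrite /virial /energy prodr_const sumr_const card_ord. Qed.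

Lemma root_exists n E : 0 <= E <= 1 -> exists2 r, 0 <= r <= 1 & r ^+ n.+1 = E.
Proof.
move=> /andP[E0 E1]; pose r := E `^ (n.+1%:R^-1).
have r0 : 0 <= r by exact: powR_ge0.
have rE : r ^+ n.+1 = E.
  by rewrite -powR_mulrn// -powRrM mulVf ?pnatr_eq0// powRr1.
exists r => //; rewrite r0 /= leNgt; apply/negP => r1.
have : 1 < r ^+ n.+1 by rewrite exprn_egt1.
by rewrite rE ltNge E1.
Qed.

(** Since [gfun k 1 = 0], only one coordinate contributes at the corner. *)
Lemma indefinite_corner n k E : 0 <= E <= 1 -> E * gfun k (E ^+ 2) = 0 ->
  indefinite_sign n.+1 k E.
Proof.
by move=> hE h; split; exists (@corner_point n E);
  rewrite ?corner_point_virial ?h//; exact: corner_point_on_cube.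
Qed.

Lemma indefinite_0 n k : indefinite_sign n.+1 k 0.
Proof. by apply: indefinite_corner; rewrite ?mul0r// lexx ler01. Qed.

Lemma indefinite_1 n k : indefinite_sign n.+1 k 1.
Proof. by apply: indefinite_corner; rewrite ?expr1n ?gfun_at1 ?mulr0// lexx ler01. Qed.

(** On the diagonal all the squares equal the root [t] of [E ^ 2] of order [n.+1], so the
    sign of the virial is that of [gfun k t]; at the corner it is that of
    [gfun k (E ^ 2)]. *)
Lemma indefinite_mixed n k E : 0 <= E <= 1 ->
  (forall t, 0 <= t <= 1 -> t ^+ n.+1 = E ^+ 2 ->
     (gfun k t <= 0 <= gfun k (E ^+ 2)) || (gfun k (E ^+ 2) <= 0 <= gfun k t)) ->
  indefinite_sign n.+1 k E.
Proof.
move=> hE h; have [r hr rE] := root_exists n hE.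
have /andP[r0 r1] := hr; have /andP[E0 E1] := hE.
have ht : 0 <= r ^+ 2 <= 1 by rewrite sqr_ge0 expr_le1.
have tE : (r ^+ 2) ^+ n.+1 = E ^+ 2 by rewrite -exprM mulnC exprM rE.
have cd := @diagonal_on_cube n.+1 r hr; have cc := @corner_point_on_cube n E hE.
have vd := @diagonal_virial n.+1 k r; rewrite rE in cd vd.
have vc := @corner_point_virial n k E.
have /orP[/andP[h1 h2]|/andP[h1 h2]] := h _ ht tE.
  split; [exists (fun=> r)|exists (@corner_point n E)] => //.
    by rewrite vd mulr_ge0_le0// mulrn_wle0.
  by rewrite vc mulr_ge0.
split; [exists (@corner_point n E)|exists (fun=> r)] => //.
  by rewrite vc mulr_ge0_le0.
by rewrite vd mulr_ge0// mulrn_wge0.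
Qed.

Lemma le_of_expr n (p t : R) : 0 <= p -> 0 <= t -> p ^+ n.+1 <= t ^+ n.+1 -> p <= t.
Proof. by move=> p0 t0; rewrite ler_pXn2r ?nnegrE. Qed.

Lemma gfun4_ge0 (t : R) : 1 / 2 <= t <= 1 -> 0 <= gfun 4 t.
Proof. by move=> /andP[h1 h2]; rewrite gfun4 mulr_ge0//; apply: mulr_ge0; lra. Qed.

Lemma gfun4_le0 (t : R) : t <= 1 / 2 -> gfun 4 t <= 0.
Proof. by move=> h; rewrite gfun4 mulr_ge0_le0//; apply: mulr_ge0_le0; lra. Qed.

Lemma gfun6_le0 (t : R) : 1 / 4 <= t -> t <= 3 / 4 -> gfun 6 t <= 0.
Proof. by move=> h1 h2; rewrite gfun6 mulr_ge0_le0// psi_le0. Qed.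

Lemma gfun6_ge0 (t : R) : t <= 1 / 4 -> 0 <= gfun 6 t.
Proof.
move=> h; rewrite gfun6 mulr_ge0//.
by have := psi_le_low h (lexx _); apply: le_trans; rewrite /psi; lra.
Qed.

Lemma gfun6_ge0_top (t : R) : 3 / 4 <= t <= 1 -> 0 <= gfun 6 t.
Proof.
move=> /andP[h1 h2]; rewrite gfun6 mulr_ge0//.
by apply: mulr_ge0; [apply: mulr_ge0|]; lra.
Qed.

Lemma indefinite_sign4 n E : 0 <= E -> E <= 1 / Num.sqrt 2 -> (1 / 2) ^+ n.+1 <= E ^+ 2 ->
  0 <= E <= 1 /\ indefinite_sign n.+1 4 E.
Proof.
move=> E0 h1 h2; have hE : 0 <= E <= 1.
  by rewrite E0 (le_trans h1)// ltW// inv_sqrt2_lt1.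
split=> //; apply: indefinite_mixed => // t /andP[t0 t1] tE.
have := le_sqr E0 h1; rewrite sqr_inv_sqrt2 => /gfun4_le0 ->.
have t2 : 1 / 2 <= t by apply: (@le_of_expr n) => //; rewrite tE.
by rewrite (@gfun4_ge0 t) ?orbT// t2.
Qed.

Lemma indefinite_sign6_low n E : 0 <= E -> E <= 1 / 2 -> (1 / 4) ^+ n.+1 <= E ^+ 2 ->
  1 / 4 <= (3 / 4 : R) ^+ n.+1 ->
  0 <= E <= 1 /\ indefinite_sign n.+1 6 E.
Proof.
move=> E0 h1 h2 h3; have hE : 0 <= E <= 1 by rewrite E0 (le_trans h1)//; lra.
split=> //; apply: indefinite_mixed => // t /andP[t0 t1] tE.
have h4 : E ^+ 2 <= 1 / 4 by have := le_sqr E0 h1; rewrite [(1 / 2) ^+ 2]expr2; lra.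
rewrite (gfun6_ge0 h4) gfun6_le0//.
  by rewrite (@le_of_expr n)// ?tE//; lra.
by apply: (@le_of_expr n) => //; rewrite ?tE ?(le_trans h4)//; lra.
Qed.

Lemma indefinite_sign6_high n E : 0 <= E -> E <= Num.sqrt 3 / 2 ->
  (3 / 4) ^+ n.+1 <= E ^+ 2 -> 1 / 4 <= (3 / 4 : R) ^+ n.+1 ->
  0 <= E <= 1 /\ indefinite_sign n.+1 6 E.
Proof.
move=> E0 h1 h2 h3; have h4 : E ^+ 2 <= 3 / 4.
  by have := le_sqr E0 h1; rewrite sqr_sqrt3_half.
have hE : 0 <= E <= 1.
  rewrite E0 /= leNgt; apply/negP => h; have := lt_sqr ler01 h; rewrite expr1n; lra.
split=> //; apply: indefinite_mixed => // t /andP[t0 t1] tE.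
have t2 : 3 / 4 <= t by apply: (@le_of_expr n) => //; rewrite tE.
by rewrite (gfun6_le0 (le_trans h3 h2) h4) (@gfun6_ge0_top t) ?orbT// t2.
Qed.

Lemma closed_region_sign (d k : nat) E : d \in [:: 1; 2; 3]%N -> k \in [:: 2; 4; 6]%N ->
  closed_region d k E -> 0 <= E <= 1 /\ indefinite_sign d k E.
Proof.
have z n k' : E = 0 -> 0 <= E <= 1 /\ indefinite_sign n.+1 k' E.
  by move=> ->; split; [rewrite lexx ler01|exact: indefinite_0].
have o n k' : E = 1 -> 0 <= E <= 1 /\ indefinite_sign n.+1 k' E.
  by move=> ->; split; [rewrite lexx ler01|exact: indefinite_1].
rewrite !inE => /or3P[] /eqP -> /or3P[] /eqP -> /=.
- by move=> []; [exact: z|exact: o].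
- move=> [[]|]; [exact: z| |exact: o] => ->.
  apply: indefinite_sign4; [exact: inv_sqrt2_ge0|exact: lexx|].
  by rewrite expr1 sqr_inv_sqrt2.
- move=> [[[]|]|]; [exact: z| | |exact: o] => ->.
    by apply: indefinite_sign6_low => //; rewrite ?expr1 ?expr2; lra.
  apply: indefinite_sign6_high; [exact: sqrt3_half_ge0|exact: lexx| |].
    by rewrite expr1 sqr_sqrt3_half.
  by rewrite expr1; lra.
- by move=> []; [exact: z|exact: o].
- move=> [|[]]; [|exact: z|exact: o]; rewrite in_itv /= => /andP[h1 h2].
  have E0 : 0 <= E by lra.
  by apply: indefinite_sign4 => //; apply: le_sqr; lra.
- move=> [[|]|[]]; [| |exact: z|exact: o]; rewrite in_itv /= => /andP[h1 h2].
    have E0 : 0 <= E by lra.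
    by apply: indefinite_sign6_low => //; [apply: le_sqr; lra|rewrite expr2; lra].
  have E0 : 0 <= E by lra.
  by apply: indefinite_sign6_high => //; [apply: le_sqr; lra|rewrite expr2; lra].
- by move=> []; [exact: z|exact: o].
- move=> [|[]]; [|exact: z|exact: o]; rewrite in_itv /= => /andP[h1 h2].
  have q0 : 0 <= 1 / (2 * Num.sqrt 2) :> R by rewrite divr_ge0// mulr_ge0// sqrtr_ge0.
  apply: indefinite_sign4 => //; first exact: le_trans h1.
  apply: le_trans (le_sqr q0 h1).
  by rewrite [leRHS]expr_div_n [(2 * _) ^+ 2]exprMn sqr_sqrtr// expr1n !exprS !expr0; lra.
- move=> [[|]|[]]; [| |exact: z|exact: o]; rewrite in_itv /= => /andP[h1 h2].
    have E0 : 0 <= E by lra.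
    apply: indefinite_sign6_low => //; last by rewrite !exprS expr0; lra.
    have e8 : 0 <= 1 / 8 :> R by lra.
    by apply: le_trans (le_sqr e8 h1); rewrite !exprS !expr0; lra.
  have q0 : 0 <= 3 * Num.sqrt 3 / 8 :> R by rewrite divr_ge0// mulr_ge0// sqrtr_ge0.
  apply: indefinite_sign6_high => //; first exact: le_trans h1.
    apply: le_trans (le_sqr q0 h1).
    by rewrite [leRHS]expr_div_n [(3 * _) ^+ 2]exprMn sqr_sqrtr// !exprS !expr0; lra.
  by rewrite !exprS expr0; lra.
Qed.

End ClosedRegions.

Section MourreSets.
Context {R : realType} {d : nat}.
Local Notation C := R[i].
Local Notation Zd := 'rV[int]_d.
Local Notation fam := (fam R Zd).
Variables (k : nat) (P : set (measurableTypeR R) -> op R Zd).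
Hypothesis hk : k \in [:: 2; 4; 6]%N.
Hypothesis hP : spectral_measure MV_laplacian P.

Local Notation D := (@MV_laplacian R d).
Local Notation A := (conjugate_operator (fun _ : 'I_d => k)).

Lemma MV_symbols : exists lD : seq (C * Zd), [/\ D = laurent_op lD,
  forall z, torus z -> symbol lD z = ((energy (fun j => complex.Re (z j)))%:C)%C
& forall z, torus z ->
    symbol (commutator_laurent k lD) z = ((virial k (fun j => complex.Re (z j)))%:C)%C].
Proof.
have [lD [h1 h2 h3]] := @has_symbol_MV R d; exists lD; split.
- by apply/funext.
- move=> z tz; rewrite h2// /energy rmorph_prod.
  by apply: eq_bigr => j _; rewrite cosz_real.
- by move=> z tz; apply: commutator_symbol => // i; rewrite h3.
Qed.

Lemma torus_of_cube (x : 'I_d -> R) : (forall j, -1 <= x j <= 1) ->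
  exists2 z : 'I_d -> C, torus z & (fun j => complex.Re (z j)) = x.
Proof.
move=> hx; exists (fun j => Complex (x j) (Num.sqrt (1 - x j ^+ 2))) => // j.
have /andP[_ h] := sqr_itv (hx j).
by rewrite /nsq /= sqr_sqrtr ?subr_ge0// addrC subrK.
Qed.

Lemma cube_of_torus (z : 'I_d -> C) j : torus z -> -1 <= complex.Re (z j) <= 1.
Proof.
move=> tz; rewrite -ler_norml -(ler_pXn2r (n:=2))// ?nnegrE// real_normK ?num_real//.
by rewrite expr1n -(tz j) /nsq lerDl sqr_ge0.
Qed.

(** Taking [s = 1] and [s = -1] covers both signs in the definition of [mu] at
    once. *)
Definition signed_estimate (s E : R) := exists a b c : R, [/\ a < E, E < b, 0 < c &
  op_le (fun u => scalef (c%:C)%C (P (`]a, b[%classic) u))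
    (fun u => P (`]a, b[%classic) (scalef (s%:C)%C (commutator D A (P (`]a, b[%classic) u))))].

(** If the estimate holds, so does a form bound; evaluated at the symbol level at
    [x] with [energy x = E], its penalty term vanishes.  Conversely positivity
    on the energy shell yields a form bound by compactness, and a form bound
    localizes. *)
Lemma signed_estimateP (s E : R) :
  signed_estimate s E <-> forall x : 'I_d -> R, on_cube E x -> 0 < s * virial k x.
Proof.
have [lD [eD sD sG]] := MV_symbols.
have bD := laurent_op_bounded lD.
have yD : symmetric_op (laurent_op lD) by apply: real_symbol_symmetric => z /sD ->.
pose ls := laurent_mul [:: ((s%:C)%C, 0)] (commutator_laurent k lD).
have ss z : torus z -> symbol ls z = ((s * virial k (fun j => complex.Re (z j)))%:C)%C.
  move=> tz; rewrite symbol_mul// symbol_scalar sG//; exact/esym/rmorphM.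
have bs := laurent_op_bounded ls.
have ys : symmetric_op (laurent_op ls) by apply: real_symbol_symmetric => z /ss ->.
have hP' : spectral_measure (laurent_op lD) P by rewrite -eD.
have comm u : l2 u -> scalef (s%:C)%C (commutator D A u) = laurent_op ls u.
  move=> lu; rewrite (@commutatorE _ _ k D lD)//.
  - by rewrite laurent_op_mul laurent_op_scalar.
  - by move=> v; rewrite eD.
  - by rewrite eD; exact: yD.
have fbE M c : form_bound (laurent_op ls) (laurent_op lD) E M c <->
    forall x : 'I_d -> R, (forall j, -1 <= x j <= 1) ->
      c <= s * virial k x + M * (energy x - E) ^+ 2.
  split=> [|h].
    move=> /(form_bound_symbol E M c ss sD) h x hx.
    by have [z tz <-] := torus_of_cube hx; exact: h.
  apply/(form_bound_symbol E M c ss sD) => z tz.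
  by apply: h => j; exact: cube_of_torus.
split=> [[a [b [c [aE Eb c0 h]]]] x hx|h].
  have mB : measurable (`]a, b[%classic : set (measurableTypeR R)) by exact: measurable_itv.
  have [|M [c' [c'0 /fbE fb]]] := form_bound_of_localized hP' bD yD bs ys aE Eb c0.
    move=> u lu; have := h u lu; rewrite comm//; exact: (proj_l2 hP mB).
  have [hc he] := hx; have := fb x hc; rewrite he subrr expr0n /= mulr0 addr0.
  exact: lt_le_trans.
have [M [c [c0 hM]]] := virial_penalty h.
have [a [b [c' [aE Eb c'0 hl]]]] := localize_form_bound hP' bD yD bs ys c0 ((fbE M c).2 hM).
exists a, b, c'; split=> // u lu; have := hl u lu; rewrite comm//.
apply: (proj_l2 hP) => //; exact: measurable_itv.
Qed.

(** Otherwise [(D - E)^2 >= c] for some [c > 0], hence [(energy - E)^2 >= c] on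
    the cube, which fails at [x]. *)
Lemma energy_in_spectrum (E : R) (x : 'I_d -> R) : on_cube E x -> spectrum D (E%:C)%C.
Proof.
move=> [hx he]; have [lD [-> sD _]] := MV_symbols.
have bD := laurent_op_bounded lD.
apply: spectrumP => // c c0; apply: contrapT => hn.
have s0 (z : 'I_d -> C) : torus z -> symbol [::] z = ((0 : R)%:C)%C by rewrite /symbol big_nil.
have fb : form_bound (laurent_op [::]) (laurent_op lD) E 1 c.
  move=> u lu; rewrite laurent_op_nil (rip0 lu) add0r mul1r leNgt; apply/negP => h.
  by apply: hn; exists u.
have [z tz zx] := torus_of_cube hx.
have := (form_bound_symbol E 1 c s0 sD).1 fb z tz.
by rewrite zx he subrr expr0n /= mulr0 addr0 leNgt c0.
Qed.

Lemma mu_plusP (E : R) : mu_plus P D A E <-> spectrum D (E%:C)%C /\ signed_estimate 1 E.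
Proof.
have e1 (u : fam) : scalef ((1 : R)%:C)%C u = u.
  by apply/funext => n; rewrite /scalef mul1r.
by split=> -[hs [a [b [c [h1 h2 h3 h4]]]]]; split=> //; exists a, b, c; split=> // u lu;
  have := h4 u lu; rewrite e1.
Qed.

Lemma commutator_l2 (u : fam) : l2 u -> l2 (commutator D A u).
Proof.
move=> lu; have [lD [eD sD _]] := MV_symbols.
rewrite (@commutatorE _ _ k D lD)//; first exact: laurent_op_l2.
  by move=> v; rewrite eD.
by rewrite eD; apply: real_symbol_symmetric => z /sD ->.
Qed.

Lemma mu_minusP (E : R) :
  mu_minus P D A E <-> spectrum D (E%:C)%C /\ signed_estimate (-1) E.
Proof.
have e1 : ((-1 : R)%:C)%C = -1 :> C by rewrite rmorphN1.
have mB a b : measurable (`]a, b[%classic : set (measurableTypeR R)) by exact: measurable_itv.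
by split=> -[hs [a [b [c [h1 h2 h3 h4]]]]]; split=> //; exists a, b, c; split=> // u lu;
  have := h4 u lu; rewrite e1 (boundedZ _ (proj_bounded hP (mB a b)))//;
  apply: commutator_l2; exact: (proj_l2 hP (mB a b)).
Qed.

Lemma mu_of_definite_sign (E : R) (x : 'I_d -> R) : on_cube E x ->
  definite_sign d k E -> mu_set P D A E.
Proof.
move=> hx [s [[->|->] h]]; [left; apply/mu_plusP|right; apply/mu_minusP];
  by split; [exact: energy_in_spectrum hx|exact/signed_estimateP].
Qed.

Lemma not_mu_of_indefinite_sign (E : R) :
  indefinite_sign d k E -> ~ mu_set P D A E.
Proof.
move=> [[x hx vx] [y hy vy]] [/mu_plusP|/mu_minusP] [_ /signed_estimateP h].
  by have := h _ hx; rewrite mul1r ltNge vx.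
by have := h _ hy; rewrite mulN1r oppr_gt0 ltNge vy.
Qed.

End MourreSets.

(** * The theorem *)

Theorem theorem4p1 (R : realType) (d k : nat)
    (P : set (measurableTypeR R) -> op R 'rV[int]_d)
    (hd : d \in [:: 1; 2; 3]%N) (hk : k \in [:: 2; 4; 6]%N)
    (hP : spectral_measure MV_laplacian P) :
  let mu := mu_set P MV_laplacian (conjugate_operator (fun _ : 'I_d => k)) in
  open_region d k `<=` mu `&` `[0, 1] /\
  closed_region d k `<=` `[0, 1] `\` mu.
Proof.
move=> mu; split=> E hE.
  have [E0 E1 ds] := open_region_sign hd hk hE.
  split; last by rewrite /= in_itv /= !ltW.
  have [x hx] : exists x : 'I_d -> R, on_cube E x.
    move: hd; case: (d) => // n _; exists (@corner_point R n E).
    by apply: corner_point_on_cube; rewrite !ltW.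
  exact: (mu_of_definite_sign hk hP hx ds).
have [h01 ind] := closed_region_sign hd hk hE.
split; first by rewrite /= in_itv.
exact: (not_mu_of_indefinite_sign hk hP ind).
Qed.
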